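(* Let $\beta>1$ and $\rho>0$. For every $r>0$ there exist real numbers $k\in\mathbb{R}$ and $0<a<b<\infty$ such that $$\frac{k\rho}{\sqrt{(1+\rho a)(1+\rho b)}}+\frac{\beta-1}{\sqrt{ab}}=1,$$ $$\frac{a+b-2k-2(\beta-1)}{4}+\frac{k}{2\sqrt{(1+\rho a)(1+\rho b)}}=1,$$ and such that the function $$p(x)=\frac{1}{2\pi}\,\frac{\sqrt{(b-x)(x-a)}}{x(1+\rho x)}\left(\rho x+\frac{\beta-1}{\sqrt{ab}}\right)\quad (a\le x\le b),\qquad p(x)=0\ \text{ otherwise},$$ satisfies $\int_a^b p(x)\log(1+\rho x)\,dx=r$. This $p$ is the unique minimizer of $\mathcal{E}$ over $\mathcal{X}_r$. Moreover, with $\Delta=b-a$, the minimum value $\mathcal{E}_1(r)=\inf_{q\in\mathcal{X}_r}\mathcal{E}[q]$ equals $$\begin{aligned}\mathcal{E}_1(r)={}&\frac{\Delta^2}{32}+\frac a2-\log\Delta-\frac{\beta-1}{2}\log(a\Delta)\\&+\frac k2\left(r-\log(1+\rho a)-\frac{\left(\sqrt{1+\rho b}-\sqrt{1+\rho a}\right)^2}{4\rho\sqrt{(1+\rho a)(1+\rho b)}}\right)\\&-\frac{\Delta k\rho}{2\sqrt{(1+\rho a)(1+\rho b)}}\left[G\!\left(0,\tfrac{1+\rho a}{\Delta\rho}\right)+\frac{\beta-1}{2}G\!\left(\tfrac a\Delta,\tfrac{1+\rho a}{\Delta\rho}\right)\right]\\&-\frac\Delta2\left(1-\frac{k\rho}{\sqrt{(1+\rho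 a)(1+\rho b)}}\right)\left[G\!\left(0,\tfrac a\Delta\right)+\frac{\beta-1}{2}G\!\left(\tfrac a\Delta,\tfrac a\Delta\right)\right].\end{aligned}$$
   Context: An integrable function $p:\mathbb{R}_+\to\mathbb{R}$ is called tame if $\int_0^\infty x|p(x)|\,dx<\infty$ and there is some $\varepsilon>0$ with $\int_0^\infty|p(x)|^{1+\varepsilon}dx<\infty$. Let $\Omega$ be the set of tame functions (identified when equal almost everywhere). For $\beta\ge1$ and $p\in\Omega$ the energy functional is $$\mathcal{E}[p]=\int_0^\infty x\,p(x)\,dx-(\beta-1)\int_0^\infty p(x)\log x\,dx-\int_0^\infty\!\!\int_0^\infty p(x)p(y)\log|x-y|\,dx\,dy .$$ $\mathcal{X}=\{p\in\Omega: p\ge0,\ \int_0^\infty p(x)\,dx=1\}$ and, for given $\rho>0$ and $r>0$, $\mathcal{X}_r=\{p\in\mathcal{X}:\int_0^\infty p(x)\log(1+\rho x)\,dx=r\}$. Here $\log$ is the natural logarithm. The function $G$ is $$G(x,y)=\frac1\pi\int_0^1\sqrt{t(1-t)}\,\frac{\log(t+x)}{t+y}\,dt\qquad(x\ge0,\ y\geq 0).$$ *)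

(* Defs.v *)
From HB Require Import structures.
From mathcomp Require Import all_boot all_order all_algebra.
From mathcomp Require Import all_classical all_reals all_analysis.

Set Implicit Arguments.
Unset Strict Implicit.
Unset Printing Implicit Defensive.

Import Order.TTheory GRing.Theory Num.Theory.
Import numFieldNormedType.Exports.

Local Open Scope classical_set_scope.
Local Open Scope ring_scope.

Section Defs.
Context {R : realType}.
Implicit Types (p q : R -> R) (beta rho r : R).

Local Notation mu := (@lebesgue_measure R).

Definition Rplus : set R := `[0, +oo[.

(* Functions on the half-line are represented by functions on R of which only
   the values on Rplus matter; the almost-everywhere identification is made
   explicit in [pdf_space] and [unique_minimizer]. *)
Definition tame p : Prop :=
  [/\ mu.-integrable Rplus (EFin \o p),
      (\int[mu]_(x in Rplus) (x * `|p x|)%:E < +oo)%E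
    & exists2 eps : R, 0 < eps &
      (\int[mu]_(x in Rplus) (`|p x| `^ (1 + eps))%:E < +oo)%E].

(* The convention [ln x = 0] for [x <= 0] only intervenes at x = 0 and on the
   diagonal x = y, which are negligible.  For tame p each of the three terms is
   an absolutely convergent integral, so no indeterminate form occurs. *)
Definition energy beta p : \bar R :=
  (\int[mu]_(x in Rplus) (x * p x)%:E
   - (beta - 1)%:E * \int[mu]_(x in Rplus) (p x * ln x)%:E
   - \int[mu]_(y in Rplus) \int[mu]_(x in Rplus)
       (p x * p y * ln `|x - y|)%:E)%E.

Definition pdf_space : set (R -> R) := [set p |
  [/\ tame p,
      {ae mu, forall x, Rplus x -> 0 <= p x}
    & (\int[mu]_(x in Rplus) (p x)%:E = 1)%E]].

Definition constrained_space rho r : set (R -> R) := [set p |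
  pdf_space p /\
  (\int[mu]_(x in Rplus) (p x * ln (1 + rho * x))%:E = r%:E)%E].

Definition minimizer (E : (R -> R) -> \bar R) (X : set (R -> R)) p : Prop :=
  X p /\ forall q, X q -> (E p <= E q)%E.

Definition unique_minimizer (E : (R -> R) -> \bar R) (X : set (R -> R)) p :
    Prop :=
  minimizer E X p /\ forall q, minimizer E X q -> ae_eq mu Rplus q p.

Definition min_energy beta rho r : \bar R :=
  ereal_inf (energy beta @` constrained_space rho r).

Definition G (x y : R) : R :=
  pi^-1 *
  \int[mu]_(t in `[0, 1]) (Num.sqrt (t * (1 - t)) * (ln (t + x) / (t + y))).

Definition opt_density beta rho (a b : R) (x : R) : R :=
  if a <= x <= b then
    (2 * pi)^-1 * (Num.sqrt ((b - x) * (x - a)) / (x * (1 + rho * x)))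
    * (rho * x + (beta - 1) / Num.sqrt (a * b))
  else 0.

End Defs.

(* Main.v *)
Require Import Defs.
From HB Require Import structures.
From mathcomp Require Import all_boot all_order all_algebra.
From mathcomp Require Import all_classical all_reals all_analysis.
From mathcomp Require Import measurable_realfun.
From mathcomp Require Import ring lra.

Set Implicit Arguments.
Unset Strict Implicit.
Unset Printing Implicit Defensive.
Unset SsrOldRewriteGoalsOrder.

Import Order.TTheory GRing.Theory Num.Theory.
Import numFieldNormedType.Exports.

Local Open Scope classical_set_scope.
Local Open Scope ring_scope.

(** The stationarity condition of the constrained problem is that
   [x - (beta - 1) ln x - k ln (1 + rho x) - 2 U^p(x)], with
   [U^p(x) = \int p(y) ln |x - y| dy], is constant on [[a, b]] and at least that
   constant on the rest of the half-line.  The optimal density is a combination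
   of [1] and [y - (a + b) / 2], both weighted by the arcsine density of
   [[a, b]], and of the balayages onto [[a, b]] of the unit charges at [0] and
   [- 1 / rho].  All four potentials are explicit: the arcsine potential on
   [[-1, 1]] is [- ln 2] by the functional equation of the map [2 x ^ 2 - 1], the
   balayages follow from it by a Moebius change of variables, and the potential
   of [y - (a + b) / 2] is a limit of balayages whose pole goes to infinity.

   The form [- \int\int (q - p)(x) (q - p)(y) ln |x - y|] is positive definite
   because [ln (M / |x - y|) - 1 + |x - y| / M] is a superposition of the
   products of indicators [1_(z <= x <= z + h) 1_(z <= y <= z + h)], the error
   [|x - y| / M] being negligible as [M] tends to infinity.  Together with the
   stationarity condition this gives minimality and uniqueness, and the
   multiplier identity gives the value of the minimum.  Finally [a], [b] and [k]
   are explicit functions of [sqrt (a b)], which is adjusted to the constraint by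
   the intermediate value theorem. *)

(** * Changes of variables in Lebesgue integrals *)

(** The kernel [- ln |x - y|] is positive only against differences of total mass 0: there the
    constant [ln M - 1] of the truncated kernel drops out. The squared window masses at level
    [M = e] are dominated by those at every larger [M], so the limit controls one fixed level; when
    it vanishes, the difference quotients of the primitive of [q - p] vanish almost everywhere, and
    Lebesgue differentiation identifies [q] and [p]. Tameness serves two bounds: the exponent
    [1 + eps] bounds the integral of [q y] times the negative part of [ln |x - y|] uniformly in [x],
    and the first moment controls large distances. The multiplier [k] can be negative, so the two
    swept charges may have opposite signs; the inequality off [[a, b]] then compares the two poles
    instead of treating each alone. The constraint is not shown to be monotone in [sqrt (a b)]: it
    lies between [ln (1 + rho a)] and [ln (1 + rho b)], which force values on both sides of [r], and
    it is continuous. *)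

Section transport.
Local Open Scope ereal_scope.
Context {R : realType}.
Local Notation mu := (@lebesgue_measure R).
Import HBNNSimple.

Variables (C D : set R) (phi w : R -> R).
Hypotheses (mC : measurable C) (mD : measurable D).
Hypothesis mphi : measurable_fun C phi.
Hypothesis phiCD : forall x, C x -> D (phi x).
Hypothesis mw : measurable_fun C w.
Hypothesis w0 : forall x, C x -> (0 <= w x)%R.
Hypothesis itvE : forall c d : R, (c < d)%R ->
  \int[mu]_(x in C `&` phi @^-1` `]c, d]) (w x)%:E = mu (`]c, d] `&` D).

Let mpre (E : set R) : measurable E -> measurable (C `&` phi @^-1` E).
Proof. by move=> mE; exact: mphi. Qed.

(** Adding Lebesgue measure outside [D] gives a measure on the whole line that agrees with [mu] on
    half-open intervals; uniqueness of Lebesgue measure then extends [itvE] to every measurable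
    set. *)
Let nu (E : set (measurableTypeR R)) : \bar R :=
  \int[mu]_(x in C `&` phi @^-1` E) (w x)%:E + mu (E `\` D).

Let nu0 : nu set0 = 0.
Proof. by rewrite /nu preimage_set0 setI0 integral_set0 set0D measure0 adde0. Qed.

Let nu_ge0 E : 0 <= nu E.
Proof.
by rewrite /nu adde_ge0// integral_ge0// => x [Cx _]; rewrite lee_fin w0.
Qed.

Let nu_sigma_additive : semi_sigma_additive nu.
Proof.
move=> F mF tF mUF.
rewrite /nu preimage_bigcup setI_bigcupr setD_bigcupl.
rewrite ge0_integral_bigcup//=.
- by move=> k; exact: (mpre (mF k)).
- rewrite -setI_bigcupr; apply/measurable_EFinP.
  by apply: measurable_funS mw => //; exact: subIsetl.
- by move=> x [k _ [Cx _]]; rewrite lee_fin w0.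
- apply/trivIsetP => i j _ _ ij; apply/seteqP; split => // x [[_ Fi] [_ Fj]].
  move/trivIsetP : tF => /(_ i j Logic.I Logic.I ij) FF.
  have : (F i `&` F j) (phi x) by [].
  by rewrite FF.
have mFD k : measurable (F k `\` D) by exact: measurableD.
have -> : mu (\bigcup_i (F i `\` D)) = \sum_(0 <= i <oo) mu (F i `\` D).
  rewrite measure_bigcup//; last by apply: eq_eseriesl => i; rewrite in_setT.
  apply/trivIsetP => i j _ _ ij; apply/seteqP; split => // x [[Fi _] [Fj _]].
  move/trivIsetP : tF => /(_ i j Logic.I Logic.I ij) FF.
  have : (F i `&` F j) x by [].
  by rewrite FF.
rewrite -nneseriesD//.
  by move=> i _ _; apply: integral_ge0 => x [Cx _]; rewrite lee_fin w0.
apply: is_cvg_nneseries => n _ _; exact: nu_ge0.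
Qed.

HB.instance Definition _ := isMeasure.Build _ _ _ nu nu0 nu_ge0 nu_sigma_additive.

Lemma transport_measure (E : set R) : measurable E ->
  \int[mu]_(x in C `&` phi @^-1` E) (w x)%:E = mu (E `&` D).
Proof.
move=> mE.
have H A : measurable A -> mu A = nu A.
  apply: lebesgue_measure_unique => /= _ [[c d]] _ <- /=.
  have [cd|dc] := ltP c d; last first.
    by rewrite set_itv_ge ?bnd_simp -?leNgt// nu0 measure0.
  rewrite /nu itvE// -{1}(setUIDK `]c, d] D).
  rewrite measureU//; [exact: measurableI|exact: measurableD|].
  by apply/seteqP; split => // x [[_ Dx] [_ /(_ Dx)]].
have mED : measurable (E `&` D) by exact: measurableI.
rewrite (H _ mED) /nu.
rewrite (_ : E `&` D `\` D = set0).
  by apply/seteqP; split => // x [[_ ? []]].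
rewrite measure0 adde0; congr (integral _ _ _).
apply/seteqP; split => x; last by move=> [? []].
by move=> [Cx Ex]; do !split => //; exact: phiCD.
Qed.

Lemma ge0_transport (f : R -> R) : measurable_fun setT f -> (forall x, 0 <= f x)%R ->
  \int[mu]_(x in D) (f x)%:E = \int[mu]_(x in C) (f (phi x) * w x)%:E.
Proof.
move=> mf f0; have mEf : measurable_fun D (EFin \o f).
  by apply/measurable_EFinP; exact: measurable_funS mf.
pose f_ := @nnsfun_approx _ (measurableTypeR R) R D mD (EFin \o f) mEf.
transitivity (limn (fun n => \int[mu]_(x in D) (f_ n x)%:E)).
  rewrite -monotone_convergence//.
  - move=> n; apply/measurable_EFinP.
    exact: measurable_funP.
  - by move=> n y _; rewrite lee_fin.
  - by move=> y _ m n mn; rewrite lee_fin; exact/lefP/nd_nnsfun_approx.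
  apply: eq_integral => y /[!inE] yD; apply/esym/cvg_lim => //.
  by apply: cvg_nnsfun_approx=> // *; rewrite lee_fin.
have mfphi (g : R -> R) : measurable_fun setT g ->
    measurable_fun C (EFin \o (fun x => g (phi x) * w x)%R).
  move=> mg; apply/measurable_EFinP; apply: measurable_funM => //.
  exact: measurableT_comp.
rewrite [X in limn X](_ : _ =
    (fun n => \int[mu]_(x in C) (f_ n (phi x) * w x)%:E)).
  apply/funext => n.
  have mS r : measurable (f_ n @^-1` [set r] : set R).
    by have := @measurable_funPTI _ _ (measurableTypeR R) R (f_ n) [set r] (measurable_set1 r).
  have mI r : measurable_fun setT (\1_(f_ n @^-1` [set r]) : R -> R).
    exact: measurable_indic.
  transitivity (\sum_(k \in range (f_ n))
      \int[mu]_(x in C) (k * (\1_(f_ n @^-1` [set k]) (phi x) * w x))%:E).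
    under eq_integral do rewrite fimfunE -fsumEFin//.
    rewrite ge0_integral_fsum//.
    - by move=> y; exact/measurable_EFinP/measurable_funM.
    - by move=> y x _; rewrite nnfun_muleindic_ge0.
    apply: eq_fsbigr => r /[!inE] fr.
    rewrite integralZl_indic_nnsfun// integral_indic//=.
    have r0 : (0 <= r)%R by case: fr => z _ <-.
    under [in RHS]eq_integral do rewrite EFinM.
    rewrite ge0_integralZl//.
    - exact: mfphi (mI r).
    - by move=> x Cx; rewrite lee_fin mulr_ge0// w0.
    congr (_ * _).
    rewrite -transport_measure// integral_mkcondr.
    apply: eq_integral => x _; rewrite patchE indicE.
    have -> : (x \in phi @^-1` (f_ n @^-1` [set r])) =
        (phi x \in f_ n @^-1` [set r]) by apply/idP/idP; rewrite !inE.
    by case: ifPn => ? /=; rewrite ?mul1r ?mul0r.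
  rewrite -ge0_integral_fsum//.
  - move=> r; under eq_fun do rewrite mulrA.
    by apply: (mfphi (fun y => r * \1_(f_ n @^-1` [set r]) y)%R); exact: measurable_funM.
  - move=> r x Cx; rewrite mulrA EFinM mule_ge0 ?lee_fin ?w0//.
    by have := nnfun_muleindic_ge0 (f_ n) r (phi x); rewrite lee_fin.
  apply: eq_integral => x _; rewrite fsumEFin//; congr EFin.
  by under eq_fsbigr do rewrite mulrA; rewrite -mulr_fsuml -fimfunE.
rewrite -monotone_convergence//.
- move=> n; apply: (mfphi (f_ n)).
  by have := @measurable_funP _ _ (measurableTypeR R) R setT (f_ n).
- by move=> n x Cx /=; rewrite lee_fin mulr_ge0// w0.
- move=> x Cx m n mn; rewrite lee_fin ler_wpM2r ?w0//.
  by have /lefP := @nd_nnsfun_approx _ (measurableTypeR R) R D mD _ mEf _ _ mn; exact.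
apply: eq_integral => x /[!inE] Cx /=; apply/cvg_lim => //.
under eq_fun do rewrite EFinM; rewrite EFinM.
apply: cvgeZr => //; apply: cvg_nnsfun_approx => //.
  by move=> *; rewrite lee_fin.
exact: phiCD.
Qed.
End transport.

(** * Calculus of derivatives at a point *)

Section pointwise_derivatives.
Context {R : realType}.
Implicit Types (f g : R -> R) (x df dg : R).

Lemma derC (c : R) x : is_derive x 1 (fun=> c : R) 0.
Proof. exact: is_derive_cst. Qed.

Lemma derI x : is_derive x 1 (fun y : R => y) 1.
Proof. exact: is_derive_id. Qed.

Lemma derD f g x df dg : is_derive x 1 f df -> is_derive x 1 g dg ->
  is_derive x 1 (fun y => f y + g y) (df + dg).
Proof. by move=> ? ?; exact: is_deriveD. Qed.

Lemma derN f x df : is_derive x 1 f df -> is_derive x 1 (fun y => - f y) (- df).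
Proof. by move=> ?; exact: is_deriveN. Qed.

Lemma derB f g x df dg : is_derive x 1 f df -> is_derive x 1 g dg ->
  is_derive x 1 (fun y => f y - g y) (df - dg).
Proof. by move=> ? ?; exact: is_deriveB. Qed.

Lemma derM f g x df dg : is_derive x 1 f df -> is_derive x 1 g dg ->
  is_derive x 1 (fun y => f y * g y) (df * g x + f x * dg).
Proof.
by move=> ? ?; apply: is_derive_eq; rewrite /GRing.scale/= addrC (mulrC (g x)).
Qed.

Lemma der_comp f g x df dg : is_derive (g x) 1 f df -> is_derive x 1 g dg ->
  is_derive x 1 (fun y => f (g y)) (df * dg).
Proof. by move=> ? ?; exact: is_derive1_comp. Qed.

Lemma derV f x df : f x != 0 -> is_derive x 1 f df ->
  is_derive x 1 (fun y => (f y)^-1) (- (f x) ^- 2 * df).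
Proof.
by move=> fx ?; exact: is_deriveV.
Qed.

Lemma der_ln f x df : 0 < f x -> is_derive x 1 f df ->
  is_derive x 1 (fun y => ln (f y)) (df / f x).
Proof.
by move=> fx fd; rewrite mulrC; apply: der_comp => //; exact: is_derive1_ln.
Qed.

Lemma der_eq f x df df' : is_derive x 1 f df -> df = df' -> is_derive x 1 f df'.
Proof. by move=> ? <-. Qed.

Lemma der_derivable f x df : is_derive x 1 f df -> derivable f x 1.
Proof. by case. Qed.

Lemma der_derive1 f x df : is_derive x 1 f df -> derive1 f x = df.
Proof. by move=> fd; rewrite derive1E; case: fd. Qed.

Lemma der_continuous f x df : is_derive x 1 f df -> {for x, continuous f}.
Proof. by move=> fd; apply/differentiable_continuous/derivable1_diffP; case: fd. Qed.

Lemma for_within (f : R -> R) (A : set R) :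
  (forall x, A x -> {for x, continuous f}) -> {within A, continuous f}.
Proof.
by move=> cf; apply: continuous_in_subspaceT => x /set_mem; exact: cf.
Qed.

Lemma der_gt0_incr f (df : R -> R) a b :
  (forall x, a <= x <= b -> is_derive x 1 f (df x)) ->
  (forall x, a < x < b -> 0 < df x) ->
  forall x y, a <= x -> x < y -> y <= b -> f x < f y.
Proof.
move=> fd df0; apply: gtr0_derive1_incr.
- by move=> x; rewrite in_itv/= => /andP[ax xb]; apply: der_derivable (fd _ _); rewrite !ltW.
- move=> x; rewrite in_itv/= => xab; case/andP: (xab) => ax xb.
  by rewrite (der_derive1 (fd _ _)) ?df0// !ltW.
- apply: for_within => x /=; rewrite in_itv/= => xab; exact: der_continuous (fd _ xab).
Qed.

End pointwise_derivatives.

(** * Integrable functions with a known integral *)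

Section hasint.
Context {R : realType}.
Local Notation mu := (@lebesgue_measure R).
Implicit Types (D : set R) (f g : R -> R) (v w : R).

(** Carrying integrability along with the value lets integrals be combined linearly, with no
    infinite value to exclude at each step. *)
Definition hasint D f v :=
  mu.-integrable D (EFin \o f) /\ (\int[mu]_(x in D) (f x)%:E = v%:E)%E.

Lemma hasint_int D f v : hasint D f v -> (\int[mu]_(x in D) (f x)%:E = v%:E)%E.
Proof. by case. Qed.

Lemma hasint_integrable D f v : hasint D f v -> mu.-integrable D (EFin \o f).
Proof. by case. Qed.

Lemma integrable_hasint D f : measurable D -> mu.-integrable D (EFin \o f) ->
  hasint D f (\int[mu]_(x in D) f x).
Proof.
by move=> mD fi; split => //; rewrite /Rintegral fineK//; exact: integrable_fin_num.
Qed.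

Lemma hasint_Rint D f v : hasint D f v -> \int[mu]_(x in D) f x = v.
Proof. by case=> _; rewrite /Rintegral => ->. Qed.

Lemma hasint_unique D f v w : hasint D f v -> hasint D f w -> v = w.
Proof. by move=> [_ fv] [_]; rewrite fv => -[]. Qed.

Lemma hasint_eq D f g v : measurable D -> (forall x, D x -> f x = g x) ->
  hasint D f v -> hasint D g v.
Proof.
move=> mD fg [fi fv]; split.
  by apply: eq_integrable fi => // x /set_mem xD /=; rewrite fg.
by rewrite -fv; apply: eq_integral => x /set_mem xD; rewrite fg.
Qed.

Lemma hasintD D f g v w : measurable D -> hasint D f v -> hasint D g w ->
  hasint D (fun x => f x + g x) (v + w).
Proof.
move=> mD [fi fv] [gi gw]; split; first exact: (@integrableD _ _ _ mu D mD _ _ fi gi).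
by rewrite integralD_EFin// fv gw.
Qed.

Lemma hasintZ D f v k : measurable D -> hasint D f v ->
  hasint D (fun x => k * f x) (k * v).
Proof.
move=> mD [fi fv]; split; first exact: (@integrableZl _ _ _ mu D mD k _ fi).
by under eq_integral do rewrite EFinM; rewrite integralZl// fv.
Qed.

Lemma hasintN D f v : measurable D -> hasint D f v ->
  hasint D (fun x => - f x) (- v).
Proof.
move=> mD /(hasintZ (-1) mD); rewrite mulN1r; apply: hasint_eq => // x _.
by rewrite mulN1r.
Qed.

Lemma hasintB D f g v w : measurable D -> hasint D f v -> hasint D g w ->
  hasint D (fun x => f x - g x) (v - w).
Proof. by move=> mD hf hg; apply: hasintD => //; exact: hasintN. Qed.

Lemma hasint_le D f g v w : measurable D -> hasint D f v -> hasint D g w ->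
  (forall x, D x -> f x <= g x) -> v <= w.
Proof.
move=> mD [fi fv] [gi gw] fg; rewrite -lee_fin -fv -gw.
by apply: le_integral => // x /set_mem Dx; rewrite lee_fin fg.
Qed.

Lemma hasint_ge0 D f v : hasint D f v -> (forall x, D x -> 0 <= f x) -> 0 <= v.
Proof.
move=> [fi fv] f0; rewrite -lee_fin -fv.
by apply: integral_ge0 => x Dx; rewrite lee_fin f0.
Qed.

Lemma ge0_hasint D f v : measurable_fun D f -> (forall x, D x -> 0 <= f x) ->
  (\int[mu]_(x in D) (f x)%:E = v%:E)%E -> hasint D f v.
Proof.
move=> mf f0 fv; split => //; apply/integrableP; split; first exact/measurable_EFinP.
suff -> : (\int[mu]_(x in D) `|(EFin \o f) x| = v%:E)%E by rewrite ltry.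
rewrite -fv; apply: eq_integral => x /set_mem Dx /=.
by rewrite ger0_norm// f0.
Qed.

Lemma dominated_hasint D f g v : measurable D -> measurable_fun D f -> hasint D g v ->
  (forall x, D x -> `|f x| <= g x) -> exists w, hasint D f w /\ `|w| <= v.
Proof.
move=> mD mf [gi gv] fg.
have fi : mu.-integrable D (EFin \o f).
  apply: le_integrable gi => //; first exact/measurable_EFinP.
  by move=> x Dx /=; rewrite lee_fin (le_trans (fg _ Dx))// ler_norm.
have fh := integrable_hasint mD fi.
exists (\int[mu]_(x in D) f x); split => //.
have gh : hasint D g v by [].
rewrite ler_norml; apply/andP; split.
  apply: (hasint_le mD (hasintN mD gh) fh) => x Dx.
  by have := fg _ Dx; rewrite ler_norml => /andP[].
apply: (hasint_le mD fh gh) => x Dx.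
by have := fg _ Dx; rewrite ler_norml => /andP[].
Qed.

Lemma hasint_setU D1 D2 f v w : measurable D1 -> measurable D2 ->
  [disjoint D1 & D2] -> hasint D1 f v -> hasint D2 f w -> hasint (D1 `|` D2) f (v + w).
Proof.
move=> m1 m2 d12 [i1 v1] [i2 v2].
have mf : measurable_fun (D1 `|` D2) (EFin \o f).
  by apply/measurable_funU => //; split; [have /integrableP[] := i1|have /integrableP[] := i2].
split; last first.
  by rewrite integral_setU// v1 v2.
apply/integrableP; split => //.
rewrite integral_setU//; last exact: lte_add_pinfty (integrableP _ _ _ i1).2 (integrableP _ _ _ i2).2.
exact: measurableT_comp.
Qed.

Lemma hasint_FTC (a b : R) (F f : R -> R) : a <= b ->
  (forall x, a <= x <= b -> is_derive x 1 F (f x)) ->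
  (forall x, a <= x <= b -> {for x, continuous f}) ->
  hasint `[a, b] f (F b - F a).
Proof.
rewrite le_eqVlt => /predU1P[<- _ _|ab Ff cf].
  rewrite subrr set_itv1; split; last by rewrite integral_set1.
  apply/integrableP; split; last by rewrite integral_set1.
  exact: measurable_fun_set1.
have wf : {within `[a, b], continuous f}.
  by apply: for_within => x /=; rewrite in_itv/=; exact: cf.
split; first by apply: continuous_compact_integrable => //; exact: segment_compact.
rewrite EFinB; apply: continuous_FTC2 => //.
  split.
  - move=> x; rewrite in_itv/= => /andP[ax xb].
    by apply: der_derivable (Ff _ _); rewrite !ltW.
  - apply: cvg_at_right_filter; apply: der_continuous (Ff a _).
    by rewrite lexx ltW.
  - apply: cvg_at_left_filter; apply: der_continuous (Ff b _).
    by rewrite lexx ltW.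
move=> x; rewrite in_itv/= => /andP[ax xb].
by apply: der_derive1 (Ff _ _); rewrite !ltW.
Qed.

Lemma hasint_oo (a b : R) (f : R -> R) v (b0 b1 : bool) :
  hasint [set` Interval (BSide b0 a) (BSide b1 b)] f v <-> hasint `]a, b[ f v.
Proof.
have sub : `]a, b[ `<=` [set` Interval (BSide b0 a) (BSide b1 b)].
  by apply: subset_itv; rewrite bnd_simp; case: b0 b1 => -[].
split=> [[fi fv]|[fi fv]].
  have fi' : mu.-integrable `]a, b[ (EFin \o f) by exact: integrableS fi.
  split => //; rewrite -fv [RHS]integral_itv_bndoo//.
  by have /integrableP[] := fi'.
have /integrableP[mf foo] := fi.
split; last by rewrite integral_itv_bndoo.
apply/integrableP; split; last first.
  by rewrite integral_itv_bndoo//; exact: measurableT_comp.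
apply/measurable_EFinP.
have : measurable_fun `[a, b] f.
  by apply: (@measurable_fun_itv_cc _ a b false true); exact/measurable_EFinP.
apply: measurable_funS => //; apply: subset_itv; rewrite bnd_simp.
  by case: (b0).
by case: (b1).
Qed.

End hasint.

Ltac der_rec := first
  [ eapply derC | eapply derI | assumption
  | eapply derB; [der_rec|der_rec] | eapply derD; [der_rec|der_rec]
  | eapply derN; der_rec | eapply derM; [der_rec|der_rec]
  | eapply derV; [|der_rec] | eapply der_ln; [|der_rec] | idtac ].
Ltac der := eapply der_eq; [der_rec|].

Section transport_hasint.
Context {R : realType}.
Local Notation mu := (@lebesgue_measure R).

(** The absolute value and the two parts of [G] are transported separately as nonnegative functions,
    so integrability itself passes in both directions. *)
Lemma transport_hasint (C D : set R) (phi p G : R -> R) (v : R) :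
  measurable C -> measurable D -> measurable_fun C phi ->
  (forall x, C x -> D (phi x)) ->
  measurable_fun C p -> (forall x, C x -> 0 <= p x) ->
  (forall c d : R, c < d ->
    (\int[mu]_(x in C `&` phi @^-1` `]c, d]) (p x)%:E = mu (`]c, d] `&` D))%E) ->
  measurable_fun setT G ->
  hasint D G v <-> hasint C (fun x => G (phi x) * p x) v.
Proof.
move=> mC mD mphi CD mp p0 itvE mG.
have ge0E (H : R -> R) : measurable_fun setT H -> (forall x, 0 <= H x) ->
    (\int[mu]_(x in D) (H x)%:E = \int[mu]_(x in C) (H (phi x) * p x)%:E)%E.
  by move=> mH H0; exact: ge0_transport.
have mGp : measurable_fun C (fun x => G (phi x) * p x).
  by apply: measurable_funM => //; exact: measurableT_comp.
have absE : (\int[mu]_(x in D) `|G x|%:E = \int[mu]_(x in C) (`|G (phi x)| * p x)%:E)%E.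
  by apply: (ge0E (fun x => `|G x|)) => //; exact: measurableT_comp.
have posE : (\int[mu]_(x in D) (Num.max (G x) 0)%:E =
    \int[mu]_(x in C) (Num.max (G (phi x)) 0 * p x)%:E)%E.
  apply: (ge0E (fun x => Num.max (G x) 0)); first exact: measurable_maxr.
  by move=> x; rewrite le_max lexx orbT.
have negE : (\int[mu]_(x in D) (Num.max (- G x) 0)%:E =
    \int[mu]_(x in C) (Num.max (- G (phi x)) 0 * p x)%:E)%E.
  apply: (ge0E (fun x => Num.max (- G x) 0)).
    by apply: measurable_maxr => //; exact: measurableT_comp.
  by move=> x; rewrite le_max lexx orbT.
have intE : (\int[mu]_(x in D) (G x)%:E =
    \int[mu]_(x in C) (G (phi x) * p x)%:E)%E.
  rewrite integralE [RHS]integralE; congr (_ - _)%E.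
    transitivity (\int[mu]_(x in D) (Num.max (G x) 0)%:E)%E.
      by apply: eq_integral => x _; rewrite funeposE EFin_max.
    rewrite posE; apply: eq_integral => x /set_mem/p0 px.
    by rewrite funeposE -EFin_max maxr_pMl// mul0r.
  transitivity (\int[mu]_(x in D) (Num.max (- G x) 0)%:E)%E.
    by apply: eq_integral => x _; rewrite funenegE EFin_max.
  rewrite negE; apply: eq_integral => x /set_mem/p0 px.
  by rewrite funenegE -EFinN -EFin_max maxr_pMl// mul0r mulNr.
have absE' : (\int[mu]_(x in D) `|(G x)%:E| =
    \int[mu]_(x in C) `|(G (phi x) * p x)%:E|)%E.
  rewrite absE; apply: eq_integral => x /set_mem/p0 px.
  by rewrite /= normrM (ger0_norm px).
split=> -[/integrableP[mi ifin] iv]; split; rewrite ?intE// -?intE//.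
  apply/integrableP; split; first exact/measurable_EFinP.
  by rewrite /comp -absE'.
apply/integrableP; split; last by rewrite /comp absE'.
by apply/measurable_EFinP; exact: measurable_funTS.
Qed.

End transport_hasint.

(** * Substitution along an increasing differentiable map *)

Section change_of_variables.
Context {R : realType}.
Local Notation mu := (@lebesgue_measure R).
Variables (a b : R) (F f : R -> R).
Hypothesis ab : a < b.
Hypothesis Ff : forall x, a <= x <= b -> is_derive x 1 F (f x).
Hypothesis cf : forall x, a <= x <= b -> {for x, continuous f}.
Hypothesis f_gt0 : forall x, a < x < b -> 0 < f x.

Let Fincr x y : a <= x -> x < y -> y <= b -> F x < F y.
Proof. exact: (der_gt0_incr Ff f_gt0). Qed.

Let Fle x y : a <= x -> x <= y -> y <= b -> F x <= F y.
Proof.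
by move=> ax; rewrite le_eqVlt => /predU1P[->//|xy] yb; rewrite ltW// Fincr.
Qed.

Let mF : measurable_fun `]a, b[ F.
Proof.
apply: subspace_continuous_measurable_fun => //; apply: for_within => x /=.
by rewrite in_itv/= => /andP[ax xb]; apply: der_continuous (Ff _); rewrite !ltW.
Qed.

Let mf : measurable_fun `]a, b[ f.
Proof.
apply: subspace_continuous_measurable_fun => //; apply: for_within => x /=.
by rewrite in_itv/= => /andP[ax xb]; apply: cf; rewrite !ltW.
Qed.

(** A generalized inverse of [F]: after clamping to [[F a, F b]] every level is attained, so the
    preimage of []c, d]] is an interval with known ends. *)
Let clamp (c : R) : exists t, [/\ a <= t <= b,
  F t = Num.max (F a) (Num.min c (F b)),
  (forall x, a < x < b -> (c < F x) = (t < x)) &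
  (forall x, a < x < b -> (F x <= c) = (x <= t))].
Proof.
have Fab : F a < F b by exact: Fincr.
have [t tab Ft] : exists2 t, t \in `[a, b]%R & F t = Num.max (F a) (Num.min c (F b)).
  apply: IVT; first exact: ltW.
    apply: for_within => x /=; rewrite in_itv/= => xab; exact: der_continuous (Ff xab).
  rewrite (min_idPl (ltW Fab)) (max_idPr (ltW Fab)).
  by rewrite le_max lexx/= ge_max ge_min lexx orbT ltW.
move: tab; rewrite in_itv/= => /andP[at_ tb].
have Fiff x : a < x < b -> (F t < F x) = (t < x).
  move=> /andP[ax xb]; have [tx|xt] := ltP t x; first by rewrite Fincr// ltW.
  by apply/negbTE; rewrite -leNgt Fle// ltW.
have cF x : a < x < b -> (c < F x) = (F t < F x).
  move=> /andP[ax xb]; rewrite Ft gt_max.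
  have -> /= : F a < F x by rewrite Fincr// ltW.
  have Fxb : F x < F b by rewrite Fincr// ltW.
  by rewrite gt_min (ltNge (F b)) (ltW Fxb) orbF.
exists t; split => //; first by rewrite at_ tb.
- by move=> x xab; rewrite cF// Fiff.
- by move=> x xab; rewrite !leNgt cF// Fiff.
Qed.

Let itvE (c d : R) : c < d ->
  (\int[mu]_(x in `]a, b[ `&` F @^-1` `]c, d]) (f x)%:E =
   mu (`]c, d] `&` `]F a, F b[))%E.
Proof.
move=> cd; have Fab : F a < F b by exact: Fincr.
have [g [/andP[ag gb] Fg cg gc]] := clamp c.
have [h [/andP[ah hb] Fh dh hd]] := clamp d.
have Fgh : F g <= F h.
  rewrite Fg Fh ge_max le_max lexx/= le_max; apply/orP; right.
  by rewrite le_min ge_min (ltW cd)/= ge_min lexx orbT.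
have gh : g <= h by rewrite leNgt; apply/negP => hg; move: Fgh; rewrite leNgt Fincr.
have [_ intgh] : hasint `[g, h] f (F h - F g).
  apply: hasint_FTC => // x /andP[gx xh].
    by apply: Ff; rewrite (le_trans ag)//= (le_trans xh).
  by apply: cf; rewrite (le_trans ag)//= (le_trans xh).
have mfgh : measurable_fun `]g, h[ f.
  by apply: measurable_funS mf => //; apply: subset_itv; rewrite bnd_simp.
have intgh' b0 b1 : (\int[mu]_(x in [set` Interval (BSide b0 g) (BSide b1 h)]) (f x)%:E = (F h - F g)%:E)%E.
  rewrite -intgh integral_itv_bndoo; first exact/measurable_EFinP.
  by rewrite [RHS]integral_itv_bndoo//; exact/measurable_EFinP.
(* If the level [d] reaches [F b], the right end of the preimage is [b], which the open interval
   excludes; the preimage is then []g, h[] instead of []g, h]]. *)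
have [hltb|] := ltP h b.
  have Fhltb : F h < F b by rewrite Fincr.
  have dE : d < F b.
    move: Fhltb; rewrite Fh gt_max => /andP[_].
    by rewrite gt_min ltxx orbF.
  have -> : `]a, b[ `&` F @^-1` `]c, d] = `]g, h]%classic.
    apply/seteqP; split => x /=; rewrite !in_itv/=.
      by move=> [xab]; rewrite cg// hd.
    move=> /andP[gx xh].
    have xab : a < x < b by rewrite (le_lt_trans ag gx) (le_lt_trans xh).
    by rewrite xab cg// hd// gx xh.
  have -> : `]c, d] `&` `]F a, F b[ = `]F g, F h]%classic.
    apply/seteqP; split => y /=; rewrite !in_itv/= Fg Fh.
      move=> [/andP[cy yd] /andP[ay yb]].
      by rewrite gt_max ay gt_min cy le_max le_min yd (ltW yb) orbT.
    rewrite (min_idPl (ltW dE)) (min_idPl (ltW (lt_trans cd dE))).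
    rewrite gt_max le_max => /andP[/andP[ay cy] /orP[ya|yd]].
      by move: (lt_le_trans ay ya); rewrite ltxx.
    by rewrite cy yd ay (le_lt_trans yd).
  rewrite (intgh' false false) lebesgue_measure_itv/= lte_fin.
  by case: ltgtP Fgh => // ->; rewrite subrr.
move=> bh; have hE : h = b by apply/le_anti; rewrite hb.
have dE : F b <= d.
  have : F b <= Num.max (F a) (Num.min d (F b)) by rewrite -Fh hE.
  by rewrite le_max leNgt Fab/= le_min => /andP[].
have -> : `]a, b[ `&` F @^-1` `]c, d] = `]g, h[%classic.
  apply/seteqP; split => x /=; rewrite !in_itv/= hE.
    by move=> [xab]; rewrite cg// => /andP[-> _]; case/andP: xab.
  move=> /andP[gx xh].
  have xab : a < x < b by rewrite (le_lt_trans ag gx).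
  by rewrite xab cg// hd// gx hE ltW.
have -> : `]c, d] `&` `]F a, F b[ = `]F g, F h[%classic.
  apply/seteqP; split => y /=; rewrite !in_itv/= hE Fg.
    move=> [/andP[cy yd] /andP[ay yb]].
    by rewrite gt_max ay gt_min cy yb.
  rewrite gt_max => /andP[/andP[ay]]; rewrite gt_min => /orP[cy|by_] yb.
    by rewrite cy ay yb (le_trans (ltW yb)).
  by move: (lt_trans by_ yb); rewrite ltxx.
rewrite (intgh' false true) lebesgue_measure_itv/= lte_fin.
by case: ltgtP Fgh => // ->; rewrite subrr.
Qed.

(** Positivity of [f] is asked only in the open interval, so that substitutions whose derivative
    vanishes at an end, such as [sin], [z ^ 4] and [2 y ^ 2 - 1], are covered. *)
Lemma change_of_variables (G : R -> R) v : measurable_fun setT G ->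
  hasint `]F a, F b[ G v <-> hasint `]a, b[ (fun x => G (F x) * f x) v.
Proof.
move=> mG; apply: transport_hasint => //.
  move=> x /=; rewrite !in_itv/= => /andP[ax xb].
  by rewrite !Fincr// ltW.
by move=> x /=; rewrite in_itv/= => xab; rewrite ltW// f_gt0.
Qed.

End change_of_variables.

(** * Measurability of explicit expressions *)

Section measurability.
Context {R : realType} d (T : measurableType d).
Implicit Types (D : set T) (f g : T -> R).

Lemma meas_cst D (c : R) : measurable_fun D (fun=> c).
Proof. exact: measurable_cst. Qed.

Lemma meas_add D f g : measurable_fun D f -> measurable_fun D g ->
  measurable_fun D (fun x => f x + g x).
Proof. by move=> mf mg; exact: measurable_funD. Qed.

Lemma meas_sub D f g : measurable_fun D f -> measurable_fun D g ->
  measurable_fun D (fun x => f x - g x).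
Proof. by move=> mf mg; exact: measurable_funB. Qed.

Lemma meas_mul D f g : measurable_fun D f -> measurable_fun D g ->
  measurable_fun D (fun x => f x * g x).
Proof. by move=> mf mg; exact: measurable_funM. Qed.

Lemma meas_opp D f : measurable_fun D f -> measurable_fun D (fun x => - f x).
Proof. by move=> mf; exact: measurable_funN. Qed.

Lemma meas_norm D f : measurable_fun D f -> measurable_fun D (fun x => `|f x|).
Proof. by move=> mf; exact: measurableT_comp. Qed.

Lemma meas_ln D f : measurable_fun D f -> measurable_fun D (fun x => ln (f x)).
Proof. by move=> mf; apply: measurableT_comp => //; exact: measurable_ln. Qed.

Lemma meas_powR D f (p : R) : measurable_fun D f ->
  measurable_fun D (fun x => f x `^ p).
Proof.
by move=> mf; apply: (measurableT_comp (f := fun y => y `^ p)) => //; exact: measurable_powR.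
Qed.

Lemma meas_max D f g : measurable_fun D f -> measurable_fun D g ->
  measurable_fun D (fun x => Num.max (f x) (g x)).
Proof. exact: measurable_maxr. Qed.

Lemma meas_inv D f : measurable_fun D f -> measurable_fun D (fun x => (f x)^-1).
Proof.
(* The real power with exponent [- 1] is the inverse on nonnegative numbers, hence the detour
   through the square; both sides are 0 where [f] vanishes. *)
move=> mf; have -> : (fun x => (f x)^-1) = (fun x => f x * (f x * f x) `^ (- 1)).
  apply/funext => x; rewrite powR_inv1 ?sqr_ge0 -?expr2 ?sqr_ge0//.
  have [->|fx] := eqVneq (f x) 0; first by rewrite invr0 mul0r.
  by rewrite expr2 invfM mulrA divff// mul1r.
by apply: meas_mul => //; apply: meas_powR; exact: meas_mul.
Qed.

Lemma meas_sqrt D f : measurable_fun D f -> measurable_fun D (fun x => Num.sqrt (f x)).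
Proof.
move=> mf; apply: (measurableT_comp (f := @Num.sqrt R)) => //.
by apply: continuous_measurable_fun; exact: sqrt_continuous.
Qed.

Lemma meas_ifle (a b f g : T -> R) : measurable_fun setT a -> measurable_fun setT b ->
  measurable_fun setT f -> measurable_fun setT g ->
  measurable_fun setT (fun x => if a x <= b x then f x else g x).
Proof.
by move=> ma mb mf mg; apply: measurable_fun_ifT => //; exact: measurable_fun_ler.
Qed.

End measurability.

Ltac meas := repeat first
  [ assumption | apply: meas_cst | apply: measurable_id | apply: measurable_fst | apply: measurable_snd
  | apply: meas_add | apply: meas_sub | apply: meas_mul | apply: meas_opp
  | apply: meas_norm | apply: meas_ln | apply: meas_inv | apply: meas_sqrt
  | apply: meas_powR | apply: meas_max | apply: meas_ifle
  | match goal with H : measurable_fun _ ?q |- measurable_fun _ (fun x => ?q _) =>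
      apply: (measurableT_comp H) end ].

Section hasint_more.
Context {R : realType}.
Local Notation mu := (@lebesgue_measure R).
Implicit Types (D : set R) (f g : R -> R) (v w : R).

Lemma hasintT_restrict D f v : measurable D -> (forall x, ~ D x -> f x = 0) ->
  hasint setT f v <-> hasint D f v.
Proof.
move=> mD f0.
have fE : (EFin \o f) \_ D = EFin \o f.
  apply/funext => x; rewrite patchE; case: ifPn => // /negP; rewrite inE => /f0.
  by rewrite /= => ->.
have intE : (\int[mu]_(x in D) (f x)%:E = \int[mu]_x (f x)%:E)%E.
  by rewrite integral_mkcond fE.
split=> -[fi fv]; split; rewrite ?intE// -?intE//.
  exact: integrableS fi.
by rewrite -fE; apply/integrable_restrict => //; rewrite setTI.
Qed.

Lemma hasint_reflect (a b : R) (G : R -> R) v : measurable_fun setT G ->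
  hasint `](- b), (- a)[ G v <-> hasint `]a, b[ (fun x => G (- x)) v.
Proof.
move=> mG; rewrite (@transport_hasint R `]a, b[ `](- b), (- a)[ -%R (fun=> 1))//.
- by move=> x /=; rewrite !in_itv/= !ltrN2 andbC.
- move=> c d cd; rewrite integral_cst//; last first.
    rewrite mul1e -lebesgue_measureN; first exact: measurableI.
    rewrite /pushforward preimage_setI opp_preimage_itvbndbnd/= setIC.
    by rewrite opp_preimage_itvbndbnd/= !opprK.
  by apply: measurableI => //; rewrite opp_preimage_itvbndbnd.
- by split; apply: hasint_eq => // x _; rewrite mulr1.
Qed.

Lemma hasint_affine (m e a b : R) G v : measurable_fun setT G -> 0 < e -> a < b ->
  hasint `](m + e * a), (m + e * b)[ G v <->
  hasint `]a, b[ (fun x => G (m + e * x) * e) v.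
Proof.
move=> mG e0 ab.
apply: (@change_of_variables R a b (fun x => m + e * x) (fun=> e)) => // x _.
  by der; rewrite /=; ring.
exact: cst_continuous.
Qed.

End hasint_more.

(** * Logarithmic potentials *)

Section log_kernel.
Context {R : realType}.
Local Notation mu := (@lebesgue_measure R).
Implicit Types (y u t : R).

Definition neglog u : R := Num.max 0 (- ln `|u|).

(* [|u| ^ (- 3 / 4)], truncated to an integrable function *)
Definition kap u : R :=
  if 16 <= `|u| then 0 else (Num.sqrt `|u| * Num.sqrt (Num.sqrt `|u|))^-1.

Lemma neglog_ge0 u : 0 <= neglog u. Proof. by rewrite le_max lexx. Qed.

Lemma ln_le_id t : 0 < t -> ln t <= t.
Proof. by move=> t0; rewrite ltW// ln_sublinear. Qed.

Lemma normln_le u : `|ln `|u| | <= neglog u + `|u|.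
Proof.
have [->|u0] := eqVneq u 0; first by rewrite normr0 ln0// normr0 addr0 neglog_ge0.
have u1 : ln `|u| <= `|u| by apply: ln_le_id; rewrite normr_gt0.
have h : - ln `|u| <= neglog u by rewrite le_max lexx orbT.
have := neglog_ge0 u; have := normr_ge0 u.
rewrite ler_norml; lra.
Qed.

Lemma kap_ge0 u : 0 <= kap u.
Proof. by rewrite /kap; case: ifP => // _; rewrite invr_ge0 mulr_ge0// sqrtr_ge0. Qed.

Lemma meas_neglog d (T : measurableType d) (f : T -> R) :
  measurable_fun setT f -> measurable_fun setT (fun x => neglog (f x)).
Proof. by move=> mf; rewrite /neglog; meas. Qed.

Lemma meas_kap (f : R -> R) :
  measurable_fun setT f -> measurable_fun setT (fun x => kap (f x)).
Proof. by move=> mf; rewrite /kap; meas. Qed.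

(** Under [u = z ^ 4] the weight [u ^ (- 3 / 4)] becomes the constant 4 on []0, 2[]; the cut-off 16
    is [2 ^ 4]. *)
Lemma kap_half : hasint `]0, 16[ kap 8.
Proof.
have mk : measurable_fun setT kap by exact: meas_kap.
pose F (z : R) := z * z * (z * z).
have FE0 : F 0 = 0 by rewrite /F; ring.
have FE2 : F 2 = 16 by rewrite /F; ring.
rewrite -FE0 -FE2.
apply/(@change_of_variables R 0 2 F (fun z => 4 * (z * z * z)))=> //.
- by move=> x _; rewrite /F; der; rewrite /=; ring.
- by move=> x _; apply: (der_continuous (df := 12 * (x * x))); der; rewrite /=; ring.
- by move=> x /andP[x0 _]; rewrite !mulr_gt0.
have H : hasint `]0, 2[ (fun=> 4 : R) 8.
  have H2 : hasint `[0, 2] (fun=> 4 : R) (4 * 2 - 4 * 0).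
    apply: (@hasint_FTC R 0 2 (fun x => 4 * x)) => // x _; last exact: cst_continuous.
    by der; rewrite /=; ring.
  have E8 : 4 * 2 - 4 * 0 = 8 :> R by ring.
  by apply/(@hasint_oo _ _ _ _ _ true false); rewrite -E8.
apply: hasint_eq H => // z /=; rewrite in_itv/= => /andP[z0 z2].
have F0 : 0 <= F z by rewrite /F !mulr_ge0// ltW.
rewrite /kap ger0_norm// leNgt.
have -> /= : F z < 16.
  by rewrite -FE2; apply: (der_gt0_incr (f := F) (df := fun z => 4 * (z * z * z)) (a := 0) (b := 2)) => //;
   [by move=> x _; rewrite /F; der; rewrite /=; ring|by move=> x /andP[x0 _]; rewrite !mulr_gt0|exact: ltW].
rewrite /F -expr2 sqrtr_sqr ger0_norm ?mulr_ge0 ?ltW// -expr2 sqrtr_sqr ger0_norm ?ltW//.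
by field; rewrite gt_eqF.
Qed.

Lemma kapN u : kap (- u) = kap u.
Proof. by rewrite /kap normrN. Qed.

Lemma kap_int x : hasint setT (fun y => kap (x - y)) 16.
Proof.
have mk : measurable_fun setT kap by exact: meas_kap.
have H1 : hasint `](- 16), (- 0)[ kap 8.
  apply/hasint_reflect => //; apply: hasint_eq kap_half => // y _.
  by rewrite kapN.
have H2 : hasint `](- 16), 16[ kap 16.
  rewrite (_ : 16 = 8 + 8 :> R) in H1 *; first by ring.
  rewrite (_ : `](- (8 + 8)), (8 + 8)[%classic = `](- (8 + 8)), (- 0)[ `|` `[0, (8 + 8)[).
    rewrite oppr0; apply/seteqP; split=> y /=; rewrite !in_itv/=.
      by move=> /andP[y1 y2]; have [y0|y0] := ltP y 0; [left; rewrite y1|right].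
    by move=> [/andP[-> y0]|/andP[y0 ->]]; rewrite ?andbT/=; lra.
  apply: hasint_setU => //.
    by rewrite oppr0; apply/disj_setPS => y /= []; rewrite !in_itv/= => /andP[_ y0] /andP[]; rewrite leNgt y0.
  by apply/hasint_oo; have := kap_half; rewrite (_ : 16 = 8 + 8 :> R)//; ring.
have H3 : hasint `](x + 1 * (- 16)), (x + 1 * 16)[ (fun y => kap (x - y)) 16.
  apply/hasint_affine => //; [by apply: meas_kap; meas|lra|].
  apply: hasint_eq H2 => // y _; rewrite mulr1 mul1r.
  by rewrite (_ : x - (x + y) = - y) ?kapN//; ring.
apply/(@hasintT_restrict _ `](x + 1 * (- 16)), (x + 1 * 16)[) => // y /=.
rewrite in_itv/= /kap; case: ifPn => //; rewrite -ltNge ltr_norml => /andP[xy1 xy2] H.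
by exfalso; apply: H; apply/andP; split; lra.
Qed.

(** Compare [q] with [|u| ^ (- 1 / 2)]. If [q] is smaller, [- ln |u| <= 4 |u| ^ (- 1 / 4)] leaves
    [4 |u| ^ (- 3 / 4)]; if it is larger, [- ln |u| <= 2 ln q], which is at most
    [2 / eps * q ^ eps]. With [u = x - y], the integral of the bound over [y] does not depend on
    [x]. *)
Lemma mul_neglog_le (q eps u : R) : 0 <= q -> 0 < eps ->
  q * neglog u <= 2 / eps * q `^ (1 + eps) + 4 * kap u.
Proof.
move=> q0 eps0.
have R0 : 0 <= 2 / eps * q `^ (1 + eps) + 4 * kap u.
  by rewrite addr_ge0 ?mulr_ge0 ?powR_ge0 ?kap_ge0// invr_ge0 ltW.
have [u00|u0] := eqVneq u 0.
  by rewrite {1}/neglog {1}u00 normr0 ln0// oppr0 maxxx mulr0.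
have [u1|u1] := leP 1 `|u|.
  by rewrite {1}/neglog max_l ?mulr0// oppr_le0 ln_ge0.
have t0 : 0 < `|u| by rewrite normr_gt0.
rewrite {1}/neglog max_r; first by rewrite oppr_ge0 ln_le0// ltW.
set t := `|u| in t0 u1 *.
have [qt|qt] := leP q (Num.sqrt t)^-1.
  have st : 0 < Num.sqrt t by rewrite sqrtr_gt0.
  have sst : 0 < Num.sqrt (Num.sqrt t) by rewrite sqrtr_gt0.
  apply: (@le_trans _ _ (4 * kap u)); last by rewrite lerDr mulr_ge0 ?powR_ge0// mulr_ge0 ?invr_ge0 ?ltW.
  have lt : - ln t <= 4 * (Num.sqrt (Num.sqrt t))^-1.
    have -> : t = Num.sqrt (Num.sqrt t) ^+ 4.
      by rewrite (exprM _ 2 2) sqr_sqrtr ?ltW// sqr_sqrtr ?ltW.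
    rewrite (_ : Num.sqrt (Num.sqrt (_ ^+ 4)) = Num.sqrt (Num.sqrt t)).
      by rewrite (exprM _ 2 2) sqr_sqrtr ?ltW// sqr_sqrtr ?ltW.
    rewrite lnXn// -mulNrn -lnV ?posrE// -[leLHS]mulr_natl ler_pM2l//.
    by apply: ln_le_id; rewrite invr_gt0.
  have -> : kap u = (Num.sqrt t)^-1 * (Num.sqrt (Num.sqrt t))^-1.
    by rewrite /kap leNgt (lt_trans u1) ?invfM// ltr1n.
  apply: (le_trans (ler_pM _ _ qt lt)) => //; first by rewrite oppr_ge0 ln_le0// ltW.
  by rewrite mulrCA.
apply: (@le_trans _ _ (2 / eps * q `^ (1 + eps))); last by rewrite lerDl mulr_ge0// kap_ge0.
have st : 0 < (Num.sqrt t)^-1 by rewrite invr_gt0 sqrtr_gt0.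
have q_gt0 : 0 < q by exact: lt_trans qt.
rewrite powRD; first by rewrite (gt_eqF q_gt0) implybT.
rewrite powRr1// mulrCA ler_pM2l//.
have : ln (Num.sqrt t)^-1 <= ln q by rewrite ler_ln ?posrE// ltW.
rewrite lnV ?posrE ?sqrtr_gt0//.
have lst : ln t = 2 * ln (Num.sqrt t).
  by rewrite -{1}[t]sqr_sqrtr ?ltW// lnXn ?sqrtr_gt0// mulr_natl.
have lq : ln q <= eps^-1 * q `^ eps.
  by rewrite -ler_pdivrMl ?invr_gt0// invrK -ln_powR ln_le_id// powR_gt0.
move=> h; rewrite lst -mulrA; lra.
Qed.

End log_kernel.

(** * Densities whose near-field logarithmic potential is uniformly bounded *)

Section log_density.
Context {R : realType}.
Local Notation mu := (@lebesgue_measure R).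
Implicit Types (q : R -> R).

(** This is what the potential theory uses of a tame density: [m] is the first absolute moment and
    [C] bounds the part of the potential coming from [|x - y| < 1], uniformly in [x]. Later
    estimates are expressed through these two numbers. *)
Definition log_density q m C : Prop :=
  [/\ measurable_fun setT q, forall x, 0 <= q x, hasint setT q 1,
      hasint setT (fun y => `|y| * q y) m &
      forall x, exists2 v, hasint setT (fun y => q y * neglog (x - y)) v & v <= C].

Definition pot q (x : R) : R := \int[mu]_y (q y * ln `|x - y|).

Lemma log_density_pot q m C : log_density q m C -> forall x,
  hasint setT (fun y => q y * ln `|x - y|) (pot q x) /\ `|pot q x| <= C + `|x| + m.
Proof.
move=> [mq q0 q1 qm qL] x; have [v qv vC] := qL x.
have D := hasintD measurableT (hasintD measurableT qv (hasintZ `|x| measurableT q1)) qm.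
have [|||w [hw wv]] := dominated_hasint _ _ D (f := fun y => q y * ln `|x - y|) => //.
- by meas.
- move=> y _; rewrite normrM (ger0_norm (q0 y)).
  apply: (@le_trans _ _ (q y * (neglog (x - y) + (`|x| + `|y|)))).
    rewrite ler_wpM2l// (le_trans (normln_le _))// lerD2l.
    by rewrite (le_trans (ler_normB _ _)).
  by rewrite le_eqVlt; apply/orP; left; apply/eqP; ring.
rewrite /pot (hasint_Rint hw); split => //.
by rewrite (le_trans wv)// mulr1 !lerD2r.
Qed.

Lemma log_densityI q m eps M : measurable_fun setT q -> (forall x, 0 <= q x) ->
  hasint setT q 1 -> hasint setT (fun y => `|y| * q y) m -> 0 < eps ->
  hasint setT (fun y => q y `^ (1 + eps)) M -> exists C, log_density q m C.
Proof.
move=> mq q0 q1 qm eps0 qM; exists (2 / eps * M + 4 * 16); split => // x.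
have D := hasintD measurableT (hasintZ (2 / eps) measurableT qM)
  (hasintZ 4 measurableT (kap_int x)).
have [|||v [hv vv]] := dominated_hasint _ _ D (f := fun y => q y * neglog (x - y)) => //.
- by apply: meas_mul => //; apply: meas_neglog; meas.
- by move=> y _; rewrite ger0_norm ?mulr_ge0 ?neglog_ge0// mul_neglog_le.
by exists v => //; rewrite (le_trans (ler_norm _)).
Qed.

(** For [a <= b] the density vanishes off []a, b[] without a case distinction: the square root of a
    nonpositive number is 0, and so is the inverse of 0. *)
Definition arcsine (a b y : R) : R := (pi * Num.sqrt ((b - y) * (y - a)))^-1.

Lemma arcsine_ge0 a b y : 0 <= arcsine a b y.
Proof. by rewrite invr_ge0 mulr_ge0 ?pi_ge0// sqrtr_ge0. Qed.

Lemma meas_arcsine a b (f : R -> R) : measurable_fun setT f ->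
  measurable_fun setT (fun x => arcsine a b (f x)).
Proof. by move=> mf; rewrite /arcsine; meas. Qed.

Lemma arcsine_out a b y : ~ (`]a, b[%classic y) -> a <= b -> arcsine a b y = 0.
Proof.
move=> nab ab; rewrite /arcsine ler0_sqrtr ?mulr0 ?invr0//.
move/negP : nab; rewrite in_itv/= negb_and -!leNgt => /orP[ya|by_].
  by rewrite mulr_ge0_le0// ?subr_ge0 ?subr_le0// (le_trans ya).
by rewrite mulr_le0_ge0// ?subr_ge0 ?subr_le0// (le_trans ab).
Qed.

Lemma arcsine_mass1 : hasint `](-1), 1[ (arcsine (-1) 1) 1.
Proof.
have pi0 := pi_gt0 R.
have S1 : sin (- (pi / 2)) = -1 :> R by rewrite sinN sin_pihalf.
have S2 : sin (pi / 2) = 1 :> R by exact: sin_pihalf.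
rewrite -[X in `]_, X[]S2 -S1.
apply/(@change_of_variables R (- (pi / 2)) (pi / 2) sin cos) => //.
- by lra.
- by move=> x _; exact: continuous_cos.
- by move=> x xp; rewrite cos_gt0_pihalf// mulNr.
- exact: meas_arcsine.
have H : hasint `](- (pi / 2)), (pi / 2)[ (fun=> pi^-1 : R) 1.
  have H2 : hasint `[(- (pi / 2)), (pi / 2)] (fun=> pi^-1 : R) (pi^-1 * (pi / 2) - pi^-1 * (- (pi / 2))).
    apply: (@hasint_FTC R _ _ (fun x => pi^-1 * x)) => [|x _|x _]; first lra.
      by der; rewrite /=; ring.
    exact: cst_continuous.
  have E : pi^-1 * (pi / 2) - pi^-1 * (- (pi / 2)) = 1 :> R.
    by rewrite mulrN opprK -mulrDr -splitr mulVf// gt_eqF.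
  by move: H2; rewrite E => H2; apply/(@hasint_oo _ _ _ _ _ true false).
apply: hasint_eq H => // x /=; rewrite in_itv/= => xp.
have c0 : 0 < cos x by rewrite cos_gt0_pihalf// mulNr.
rewrite S1 /arcsine opprK (_ : (1 - sin x) * (sin x + 1) = cos x ^+ 2).
  by have := cos2Dsin2 x; lra.
by rewrite sqrtr_sqr gtr0_norm// invfM -mulrA mulVf ?mulr1// gt_eqF.
Qed.

Lemma arcsine_log_density : exists m C, log_density (arcsine (-1) 1) m C.
Proof.
have pi1 : 1 < pi :> R by rewrite (lt_le_trans _ (pi_ge2 R))//; lra.
have out y : ~ (`](-1), 1[%classic y) -> arcsine (-1) 1 y = 0 by move=> h; apply: arcsine_out.
have mw : measurable_fun setT (arcsine (-1) 1) by exact: meas_arcsine.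
have w1 : hasint setT (arcsine (-1) 1) 1.
  by apply/(@hasintT_restrict _ `](-1), 1[) => //; exact: arcsine_mass1.
have [|||m [hm _]] := dominated_hasint _ _ w1 (f := fun y => `|y| * arcsine (-1) 1 y) => //.
- by meas.
- move=> y _; rewrite ger0_norm ?mulr_ge0 ?arcsine_ge0//.
  have [yi|/out->] := pselect (`](-1), 1[%classic y); last by rewrite mulr0.
  rewrite ler_piMl ?arcsine_ge0//; move: yi; rewrite /= in_itv/= => /andP[y1 y2].
  by rewrite ler_norml; lra.
have D := hasintD measurableT (@kap_int R 1) (@kap_int R (-1)).
have [|||M [hM _]] := dominated_hasint _ _ D (f := fun y => arcsine (-1) 1 y `^ (1 + 2^-1)) => //.
- by meas.
- move=> y _; rewrite ger0_norm ?powR_ge0//.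
  have [yi|/out->] := pselect (`](-1), 1[%classic y); last first.
    by rewrite powR0 ?addr_ge0 ?kap_ge0//; lra.
  (* Here [s] will be the distance from [y] to the nearer end, the other factor being at least 1.
     Dropping [pi > 1], the density is at most [s ^ (- 1 / 2)], whose power [3 / 2] is exactly
     [kap s]. *)
  have key (s : R) : 0 < s -> s < 16 -> s <= (1 - y) * (y - -1) ->
      arcsine (-1) 1 y `^ (1 + 2^-1) <= kap s.
    move=> s0 s16 hs.
    have z0 : 0 < Num.sqrt s by rewrite sqrtr_gt0.
    rewrite /kap gtr0_norm// (leNgt 16) s16/= invfM.
    have le1 : arcsine (-1) 1 y <= (Num.sqrt s)^-1.
      have le2 : Num.sqrt s <= Num.sqrt ((1 - y) * (y - -1)) by rewrite ler_sqrt// (le_trans _ hs)// ltW.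
      have p2 := lt_le_trans z0 le2.
      rewrite /arcsine lef_pV2 ?posrE ?mulr_gt0 ?pi_gt0//.
      by rewrite (le_trans le2)// ler_peMl ?ltW.
    have -> : (Num.sqrt s)^-1 / Num.sqrt (Num.sqrt s) = (Num.sqrt s)^-1 `^ (1 + 2^-1).
      rewrite powRD ?powRr1 ?invr_ge0 ?sqrtr_ge0//; first by rewrite invr_eq0 gt_eqF// implybT.
      by rewrite powR12_sqrt ?invr_ge0 ?sqrtr_ge0// sqrtrV// sqrtr_ge0.
    by apply: ge0_ler_powR => //; rewrite ?nnegrE ?arcsine_ge0 ?invr_ge0 ?sqrtr_ge0//; lra.
  move: yi; rewrite /= in_itv/= => /andP[y1 y2].
  have [y0|y0] := leP 0 y.
    rewrite (le_trans (key (1 - y) _ _ _)) ?lerDl ?kap_ge0//; [lra|lra|nra].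
  rewrite (le_trans (key (1 + y) _ _ _))//; [lra|lra|nra|].
  have -> : kap (-1 - y) = kap (1 + y) by rewrite -kapN; congr kap; ring.
  by rewrite lerDr kap_ge0.
exists m; apply: (log_densityI mw (arcsine_ge0 _ _) w1 hm _ hM); lra.
Qed.

End log_density.

(** * The equilibrium potential of [-1, 1] *)

Section arcsine_potential.
Context {R : realType}.
Local Notation mu := (@lebesgue_measure R).

(** The rule [ln (x y) = ln x + ln y] fails at the point where [|x - y|] vanishes, because
    [ln 0 = 0] there; one exceptional point is negligible. *)
Lemma hasint_off1 (D : set R) (f g : R -> R) (c v : R) : measurable D ->
  measurable_fun D g -> (forall x, D x -> x != c -> f x = g x) ->
  hasint D f v -> hasint D g v.
Proof.
move=> mD mg fg [fi fv].
have /integrableP[mf foo] := fi.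
have ae : ae_eq mu D (EFin \o f) (EFin \o g).
  exists [set c]; split; [exact: measurable_set1|exact: lebesgue_measure_set1|].
  move=> x /= h; apply: contrapT => xc; apply: h => Dx; rewrite fg//.
  exact/eqP.
have mg' : measurable_fun D (EFin \o g) by exact/measurable_EFinP.
split; last by rewrite -fv; apply/esym; apply: ae_eq_integral.
apply/integrableP; split => //.
rewrite -(@ae_eq_integral _ _ _ mu D (abse \o (EFin \o g)) (abse \o (EFin \o f)))//.
- exact: measurableT_comp.
- exact: measurableT_comp.
by apply: filterS ae => x h Dx; have [fgx] := h Dx; rewrite /= fgx.
Qed.

(** Iterating the functional equation [n] times gives [2 ^ n * |f x| <= K] for every [n]. Thus a
    potential is identified with its closed form once both obey the same equation and differ by a
    bounded function. *)
Lemma cheb_bounded_eq0 (f : R -> R) K : (forall x, `|f x| <= K) ->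
  (forall x, f (2 * x ^+ 2 - 1) = 2 * f x) -> forall x, f x = 0.
Proof.
move=> fK fT x.
have H n y : 2 ^+ n * `|f y| <= K.
  elim: n y => [|n ih] y; first by rewrite expr0 mul1r.
  by rewrite exprSr -mulrA -[2 in X in _ * X]ger0_norm// -normrM -fT.
apply/eqP/negPn/negP => fx0.
have f0 : 0 < `|f x| by rewrite normr_gt0.
have [n nK] : exists n : nat, K / `|f x| < n%:R.
  by exists (Num.truncn (K / `|f x|)).+1; exact: truncnS_gt.
have := H n x; rewrite leNgt => /negP; apply.
rewrite -ltr_pdivrMr// (lt_le_trans nK)// -natrX ler_nat ltnW//.
by rewrite ltn_expl.
Qed.

(* Green's function of the complement of [-1, 1], pole at infinity *)
Definition green (x : R) : R := ln (Num.max 1 (`|x| + Num.sqrt (x ^+ 2 - 1))).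

Lemma green_in x : `|x| <= 1 -> green x = 0.
Proof.
move=> x1; rewrite /green ler0_sqrtr; first by rewrite subr_le0 -real_normK ?num_real// expr_le1.
by rewrite addr0 max_l// ln1.
Qed.

Lemma green_out x : 1 <= `|x| -> green x = ln (`|x| + Num.sqrt (x ^+ 2 - 1)).
Proof. by move=> x1; rewrite /green max_r// (le_trans x1)// lerDl sqrtr_ge0. Qed.

(** For [x = (z + 1 / z) / 2] with [z >= 1], the function is [ln z], and [2 x ^ 2 - 1] has the
    parameter [z ^ 2]. *)
Lemma green_cheb x : green (2 * x ^+ 2 - 1) = 2 * green x.
Proof.
have x2 : x ^+ 2 = `|x| ^+ 2 by rewrite real_normK ?num_real.
have [x1|x1] := leP `|x| 1.
  rewrite !green_in ?mulr0// x2.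
  have : `|x| ^+ 2 <= 1 by rewrite expr_le1.
  by have := sqr_ge0 `|x|; rewrite ler_norml; lra.
have x21 : 1 < x ^+ 2 by rewrite x2 exprn_egt1.
rewrite [in RHS]green_out ?ltW// green_out; first by rewrite ger0_norm; lra.
rewrite ger0_norm; first lra.
have s0 := sqrtr_ge0 (x ^+ 2 - 1).
have -> : (2 * x ^+ 2 - 1) ^+ 2 - 1 = (2 * `|x| * Num.sqrt (x ^+ 2 - 1)) ^+ 2.
  by rewrite !exprMn sqr_sqrtr ?real_normK ?num_real//; [lra|ring].
rewrite sqrtr_sqr ger0_norm ?mulr_ge0// [RHS]mulr_natl -lnXn; first lra.
congr ln; rewrite sqrrD sqr_sqrtr; first lra.
by rewrite real_normK ?num_real// -mulr_natl; ring.
Qed.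

Lemma green_log x : `|green x - ln (1 + `|x|)| <= ln 2.
Proof.
have l2 : 0 < ln 2 :> R by rewrite ln_gt0// ltr1n.
have [x1|x1] := leP `|x| 1.
  rewrite green_in// sub0r normrN ger0_norm; first by rewrite ln_ge0// lerDl.
  by rewrite ler_ln ?posrE//; lra.
rewrite green_out; first exact: ltW.
have s0 := sqrtr_ge0 (x ^+ 2 - 1).
have s1 : Num.sqrt (x ^+ 2 - 1) <= `|x|.
  by rewrite -sqrtr_sqr ler_wsqrtr//; lra.
have h1 : ln (1 + `|x|) <= ln 2 + ln (`|x| + Num.sqrt (x ^+ 2 - 1)).
  by rewrite -lnM ?posrE ?ler_ln ?posrE; lra.
have h2 : ln (`|x| + Num.sqrt (x ^+ 2 - 1)) <= ln 2 + ln (1 + `|x|).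
  by rewrite -lnM ?posrE ?ler_ln ?posrE; lra.
by rewrite ler_norml; lra.
Qed.

Let w : R -> R := arcsine (-1) 1.
Let u : R -> R := pot w.

(** With [y = cos th] the map doubles the angle and preserves the uniform law. On []0, 1[] it is
    injective and carries only half of the mass, whence the factor 2. *)
Lemma arcsine_cheb (H : R -> R) v : measurable_fun setT H ->
  hasint `](-1), 1[ (fun z => w z * H z) v <->
  hasint `]0, 1[ (fun y => 2 * (w y * H (2 * y ^+ 2 - 1))) v.
Proof.
move=> mH; pose F (y : R) := 2 * (y * y) - 1.
have F0 : F 0 = -1 by rewrite /F; ring.
have F1 : F 1 = 1 by rewrite /F; ring.
have C := @change_of_variables R 0 1 F (fun y => 4 * y) ltr01 _ _ _ (fun z => w z * H z) v.
rewrite F0 F1 in C.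
have {}C : hasint `](-1), 1[ (fun z => w z * H z) v <->
    hasint `]0, 1[ (fun y => w (F y) * H (F y) * (4 * y)) v.
  apply: C; last by apply: meas_mul => //; exact: meas_arcsine.
  - by move=> y _; rewrite /F; der; rewrite /=; ring.
  - by move=> y _; apply: (der_continuous (df := 4)); der; rewrite /=; ring.
  - by move=> y /andP[y0 _]; rewrite mulr_gt0.
have E y : `]0, 1[%classic y -> w (F y) * H (F y) * (4 * y) = 2 * (w y * H (2 * y ^+ 2 - 1)).
  rewrite /= in_itv/= => /andP[y0 y1]; rewrite /F -expr2.
  suff K : w (2 * y ^+ 2 - 1) * (4 * y) = 2 * w y by rewrite mulrAC K mulrA.
  have -> : 4 * y = 2 * (2 * y) by ring.
  rewrite [LHS]mulrCA; congr (_ * _); rewrite /w /arcsine.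
  have -> : (1 - (2 * y ^+ 2 - 1)) * (2 * y ^+ 2 - 1 - -1) = (2 * y) ^+ 2 * ((1 - y) * (y - -1)) by ring.
  rewrite sqrtrM ?sqr_ge0// sqrtr_sqr gtr0_norm ?mulr_gt0//.
  set Q := Num.sqrt _; have y2 : 2 * y != 0 by rewrite gt_eqF// mulr_gt0.
  have -> : pi * (2 * y * Q) = (2 * y) * (pi * Q) by ring.
  by rewrite [in LHS]invfM [LHS]mulrC mulVKf.
by rewrite C; split; apply: hasint_eq => // y /E.
Qed.

Lemma arcsine_even (H : R -> R) v : measurable_fun setT H ->
  hasint `](-1), 1[ (fun z => w z * H z) v ->
  hasint `]0, 1[ (fun y => w y * (H y + H (- y))) v.
Proof.
move=> mH h; have mw : measurable_fun setT w by exact: meas_arcsine.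
have [hi hv] := h.
have sub1 : (`](-1), 0[ : set R) `<=` `](-1), 1[ by apply: subset_itvl; rewrite bnd_simp.
have sub2 : (`[0, 1[ : set R) `<=` `](-1), 1[ by apply: subset_itvr; rewrite bnd_simp.
have i1 : mu.-integrable `](-1), 0[ (EFin \o (fun z => w z * H z)) by exact: integrableS hi.
have i2 : mu.-integrable `[0, 1[ (EFin \o (fun z => w z * H z)) by exact: integrableS hi.
have h1 := integrable_hasint (measurable_itv _) i1.
have h2 := integrable_hasint (measurable_itv _) i2.
set v1 := Rintegral _ _ _ in h1; set v2 := Rintegral _ _ _ in h2.
have hU : hasint (`](-1), 0[ `|` `[0, 1[) (fun z => w z * H z) (v1 + v2).
  apply: hasint_setU => //; apply/disj_setPS => y /= []; rewrite !in_itv/= => /andP[_ y0] /andP[].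
  by rewrite leNgt y0.
have vE : v = v1 + v2.
  apply: (hasint_unique h); suff -> : `](-1), 1[%classic = `](-1), 0[ `|` `[0, 1[ :> set R by [].
  apply/seteqP; split=> y /=; rewrite !in_itv/=.
    by move=> /andP[y1 y2]; have [y0|y0] := ltP y 0; [left; rewrite y1|right].
  by move=> [/andP[-> y0]|/andP[y0 ->]]; rewrite ?andbT/=; lra.
have h1' : hasint `]0, 1[ (fun y => w y * H (- y)) v1.
  have : hasint `](- 1), (- 0)[ (fun z => w z * H z) v1 by rewrite oppr0.
  move/hasint_reflect => /(_ _) h1'; apply: hasint_eq (h1' _) => //; last by meas.
  by move=> y _; congr (_ * _); rewrite /w /arcsine; congr ((_ * Num.sqrt _)^-1); ring.
have h2' : hasint `]0, 1[ (fun y => w y * H y) v2 by apply/(@hasint_oo _ _ _ _ _ true true).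
rewrite vE addrC; apply: hasint_eq (hasintD _ h2' h1') => // y _.
by rewrite mulrDr.
Qed.

Lemma pot_arcsine1_hasint x : hasint `](-1), 1[ (fun y => w y * ln `|x - y|) (u x).
Proof.
have [m [C D]] := @arcsine_log_density R.
have [h _] := log_density_pot D x.
apply/(@hasintT_restrict R `](-1), 1[) => //.
by move=> y yi; rewrite /w arcsine_out ?mul0r//; lra.
Qed.

(** The difference of the images of [x] and [y] factors as [2 (x - y) (x + y)], and folding [y] with
    [- y] gathers the two logarithms on []0, 1[]. The only bad point there is [y = |x|]. *)
Lemma pot_arcsine1_cheb x : u (2 * x ^+ 2 - 1) = 2 * u x + ln 2.
Proof.
have mw : measurable_fun setT w by exact: meas_arcsine.
have mln (c : R) : measurable_fun setT (fun y : R => ln `|c - y|) by meas.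
have h1 : hasint `]0, 1[ (fun y => 2 * w y) 1.
  have : hasint `](-1), 1[ (fun z => w z * 1) 1.
    by apply: hasint_eq arcsine_mass1 => // z _; rewrite mulr1.
  by move/(arcsine_cheb _ (measurable_cst _)); apply: hasint_eq => // y _; rewrite mulr1.
have h2 := arcsine_even (mln x) (pot_arcsine1_hasint x).
have h3 := (arcsine_cheb _ (mln _)).1 (pot_arcsine1_hasint (2 * x ^+ 2 - 1)).
have h4 := hasintD (measurable_itv _) (hasintZ 2 (measurable_itv _) h2)
  (hasintZ (ln 2) (measurable_itv _) h1).
rewrite mulr1 in h4.
apply: (hasint_unique h3).
apply: (hasint_off1 (c := `|x|) _ _ _ h4) => //.
  by apply: measurable_funTS; meas.
move=> y; rewrite /= in_itv/= => /andP[y0 y1] yx.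
have xy1 : 0 < `|x - y|.
  rewrite normr_gt0 subr_eq0; apply: contra yx => /eqP ->; by rewrite gtr0_norm.
have xy2 : 0 < `|x + y|.
  rewrite normr_gt0 addr_eq0; apply: contra yx => /eqP ->; by rewrite normrN gtr0_norm.
rewrite opprK (_ : 2 * x ^+ 2 - 1 - (2 * y ^+ 2 - 1) = 2 * ((x - y) * (x + y))); first by ring.
rewrite !normrM lnM ?posrE ?mulr_gt0// ?normr_gt0// lnM ?posrE// [`|2|]ger0_norm//; ring.
Qed.

(** Both sides satisfy [f (2 x ^ 2 - 1) = 2 f x + ln 2] and stay within a bounded distance of
    [ln (1 + |x|)]; their difference is therefore 0. *)
Lemma pot_arcsine1 x : u x = green x - ln 2.
Proof.
have [m [C D]] := @arcsine_log_density R.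
have [mw w0 _ _ wL] := D.
suff H : exists K, forall x, `|u x - ln (1 + `|x|)| <= K.
  have [K HK] := H.
  suff : u x - (green x - ln 2) = 0 by move/eqP; rewrite subr_eq0 => /eqP.
  apply: (@cheb_bounded_eq0 (fun x => u x - (green x - ln 2)) (K + ln 2 + ln 2)).
    move=> y; rewrite (_ : u y - (green y - ln 2) =
      (u y - ln (1 + `|y|)) - (green y - ln (1 + `|y|)) + ln 2); first by ring.
    rewrite (le_trans (ler_normD _ _))// lerD//; last by rewrite ger0_norm// ln_ge0// ler1n.
    by rewrite (le_trans (ler_normB _ _))// lerD// green_log.
  by move=> y; rewrite pot_arcsine1_cheb green_cheb; ring.
exists (C + ln 3) => {}x.
have hx := pot_arcsine1_hasint x.
have m1 : hasint `](-1), 1[ w 1 by exact: arcsine_mass1.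
have C0 : 0 <= C.
  have [v hv vC] := wL 0; apply: le_trans vC; apply: hasint_ge0 hv _ => y _.
  by rewrite mulr_ge0 ?neglog_ge0.
have l3 : 0 <= ln 3 :> R by rewrite ln_ge0// ler1n.
have up : u x <= ln (1 + `|x|).
  rewrite -[leRHS]mulr1; apply: (hasint_le _ hx (hasintZ (ln (1 + `|x|)) _ m1)) => //.
  move=> y; rewrite /= in_itv/= => /andP[y1 y2]; rewrite mulrC ler_wpM2r//.
  have [->|xy] := eqVneq (x - y) 0; first by rewrite normr0 ln0// ln_ge0// lerDl.
  rewrite ler_ln ?posrE ?normr_gt0// ?ltr_wpDr//.
  by rewrite (le_trans (ler_normB _ _))// addrC lerD2r ler_norml; lra.
(* Pointwise [ln (1 + |x|) <= ln |x - y| + ln 3 + neglog (x - y)]: if [|x - y| >= 1] then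
   [1 + |x| <= 3 |x - y|]; otherwise [1 + |x| <= 3], and [neglog] offsets the negative logarithm. *)
have lo : ln (1 + `|x|) <= u x + (ln 3 + C).
  have [v hv vC] := wL x.
  have {}hv : hasint `](-1), 1[ (fun y => w y * neglog (x - y)) v.
    apply/(@hasintT_restrict R `](-1), 1[) => // y yi.
    by rewrite /w arcsine_out ?mul0r//; lra.
  apply: (@le_trans _ _ (u x + (ln 3 + v))); last by rewrite !lerD2l.
  rewrite -[leLHS]mulr1 -[ln 3]mulr1.
  apply: (hasint_le _ (hasintZ (ln (1 + `|x|)) _ m1)
    (hasintD _ hx (hasintD _ (hasintZ (ln 3) _ m1) hv))) => // y.
  rewrite /= in_itv/= => /andP[y1 y2].
  rewrite (mulrC _ (w y)) (mulrC (ln 3)) -!mulrDr ler_wpM2l//.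
  have yn : `|y| <= 1 by rewrite ler_norml; lra.
  have [xy|xy] := eqVneq (x - y) 0.
    rewrite xy normr0 (ln0 (lexx 0)) add0r (le_trans (_ : _ <= ln 3)) ?lerDl ?neglog_ge0//.
    by rewrite ler_ln ?posrE ?ltr_wpDr//; move/eqP: xy; rewrite subr_eq0 => /eqP ->; lra.
  have p : 0 < `|x - y| by rewrite normr_gt0.
  have xle : `|x| <= `|x - y| + 1.
    by rewrite -{1}(subrK y x) (le_trans (ler_normD _ _))// lerD2l.
  have [t1|t1] := leP 1 `|x - y|.
    rewrite addrA (le_trans (_ : _ <= ln `|x - y| + ln 3)) ?lerDl ?neglog_ge0//.
    by rewrite -lnM ?posrE// ler_ln ?posrE ?mulr_gt0 ?ltr_wpDr//; lra.
  rewrite /neglog max_r; first by rewrite oppr_ge0 ln_le0// ltW.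
  rewrite addrCA subrr addr0 ler_ln ?posrE ?ltr_wpDr//; lra.
by rewrite ler_norml; apply/andP; split; lra.
Qed.

End arcsine_potential.

(** * Arcsine measures on an arbitrary interval *)

Section arcsine_interval.
Context {R : realType}.
Local Notation mu := (@lebesgue_measure R).
Local Notation w := (arcsine (-1) 1 : R -> R).

Lemma greenN (x : R) : green (- x) = green x.
Proof. by rewrite /green normrN sqrrN. Qed.

Lemma green_joukowski (z : R) : 1 <= z -> green ((z + z^-1) / 2) = ln z.
Proof.
move=> z1; have z0 : 0 < z by lra.
have z2 : z^-1 <= 1 by rewrite invf_le1.
have zz : z * z^-1 = 1 by rewrite divff// gt_eqF.
have zi : 0 < z^-1 by rewrite invr_gt0.
have h1 : 1 <= (z + z^-1) / 2 by nra.
rewrite green_out ger0_norm//; [lra|lra|].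
have -> : ((z + z^-1) / 2) ^+ 2 - 1 = ((z - z^-1) / 2) ^+ 2 by nra.
by rewrite sqrtr_sqr ger0_norm; [lra|congr ln; lra].
Qed.

Lemma joukowskiP (x : R) : 1 <= x -> exists2 z : R, 1 <= z & x = (z + z^-1) / 2.
Proof.
move=> x1; have s0 := sqrtr_ge0 (x ^+ 2 - 1).
have ss : Num.sqrt (x ^+ 2 - 1) ^+ 2 = x ^+ 2 - 1 by rewrite sqr_sqrtr//; nra.
exists (x + Num.sqrt (x ^+ 2 - 1)); first lra.
have -> : (x + Num.sqrt (x ^+ 2 - 1))^-1 = x - Num.sqrt (x ^+ 2 - 1).
  apply: (mulfI (x := x + Num.sqrt (x ^+ 2 - 1))); first by rewrite gt_eqF//; lra.
  rewrite divff; first by rewrite gt_eqF//; lra.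
  by lra.
lra.
Qed.

Lemma arcsine_even_moment (H : R -> R) v : measurable_fun setT H ->
  hasint `](-1), 1[ (fun z => w z * H z) v -> (forall y, H (- y) = - H y) -> v = 0.
Proof.
move=> mH h Hodd; have h2 := arcsine_even mH h.
apply: (hasint_unique h2); have h0 : hasint `]0, 1[ (fun y => 0 * w y * (H y + H (- y))) (0 * v).
  by apply: hasint_eq (hasintZ 0 _ h2) => // y _; rewrite mulrA.
by rewrite mul0r in h0; apply: hasint_eq h0 => // y _; rewrite Hodd subrr !mulr0.
Qed.

Lemma arcsine_moment (H : R -> R) : measurable_fun setT H ->
  (forall y, `](-1), 1[%classic y -> `|H y| <= 1) ->
  exists v, hasint `](-1), 1[ (fun z => w z * H z) v.
Proof.
move=> mH H1; have m1 : hasint `](-1), 1[ w 1 by exact: arcsine_mass1.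
have mw : measurable_fun setT w by exact: meas_arcsine.
have [||v [hv _]] := dominated_hasint (measurable_itv _) _ m1 (f := fun y => w y * H y).
- by apply: measurable_funTS; meas.
- move=> y /H1 Hy; rewrite normrM ger0_norm ?arcsine_ge0// ler_piMr ?arcsine_ge0//.
by exists v.
Qed.

Lemma arcsine_mean1 : hasint `](-1), 1[ (fun z => w z * z) 0.
Proof.
have [||v hv] := @arcsine_moment id; first exact: measurable_id.
  by move=> y; rewrite /= in_itv/= => /andP[y1 y2]; rewrite ler_norml; lra.
by have -> : 0 = v; last exact: hv; apply/esym; apply: (arcsine_even_moment _ hv) => //; exact: measurable_id.
Qed.

(** By invariance of the arcsine law, [2 z ^ 2 - 1] has the same mean as [z], namely 0. *)
Lemma arcsine_square1 : hasint `](-1), 1[ (fun z => w z * z ^+ 2) 2^-1.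
Proof.
have mw : measurable_fun setT w by exact: meas_arcsine.
have msq : measurable_fun setT (fun z : R => z ^+ 2) by under eq_fun do rewrite expr2; meas.
have [||v hv] := @arcsine_moment (fun z => z ^+ 2) => //.
  move=> y; rewrite /= in_itv/= => /andP[y1 y2]; rewrite ger0_norm ?sqr_ge0//; nra.
have h1 := arcsine_even msq hv.
have h2 := (arcsine_cheb _ (@measurable_id _ _ setT)).1 arcsine_mean1.
have h3 : hasint `]0, 1[ (fun y => 2 * (w y * 1)) 1.
  apply/(arcsine_cheb 1 (measurable_cst (1 : R))).
  by apply: hasint_eq arcsine_mass1 => // y _; rewrite mulr1.
have h4 := hasintD (measurable_itv _) h2 h3.
have : 2 * v = 0 + 1.
  apply: (hasint_unique (hasintZ 2 (measurable_itv _) h1)); apply: hasint_eq h4 => // y _.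
  by rewrite sqrrN; ring.
by rewrite add0r => v2; have -> : 2^-1 = v by apply: (mulfI (x := 2)) => //; rewrite v2 divff.
Qed.

Section interval.
Variables a b : R.
Hypothesis ab : a < b.
Let m := (a + b) / 2.
Let e := (b - a) / 2.
Let e0 : 0 < e. Proof. by rewrite divr_gt0// subr_gt0. Qed.

Lemma arcsine_affine (G : R -> R) v : measurable_fun setT G ->
  hasint `]a, b[ (fun y => arcsine a b y * G y) v <->
  hasint `](-1), 1[ (fun t => w t * G (m + e * t)) v.
Proof.
move=> mG; have A := @hasint_affine R m e (-1) 1 (fun y => arcsine a b y * G y) v.
rewrite (_ : m + e * -1 = a) in A; first by rewrite /m /e; field.
rewrite (_ : m + e * 1 = b) in A; first by rewrite /m /e; field.
rewrite A//; first by apply: meas_mul => //; exact: meas_arcsine.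
have E t : arcsine a b (m + e * t) * G (m + e * t) * e = w t * G (m + e * t).
  rewrite mulrAC; congr (_ * _); rewrite /arcsine.
  have -> : (b - (m + e * t)) * (m + e * t - a) = e ^+ 2 * ((1 - t) * (t - -1)).
    by rewrite /m /e; field.
  rewrite sqrtrM ?sqr_ge0// sqrtr_sqr gtr0_norm//.
  set Q := Num.sqrt _; have e1 : e != 0 by rewrite gt_eqF.
  have -> : pi * (e * Q) = e * (pi * Q) by ring.
  by rewrite [in LHS]invfM [LHS]mulrC mulVKf.
by split; apply: hasint_eq => // t _.
Qed.

Lemma arcsine_mass : hasint `]a, b[ (arcsine a b) 1.
Proof.
have : hasint `]a, b[ (fun y => arcsine a b y * 1) 1.
  apply/arcsine_affine; first exact: measurable_cst.
  by apply: hasint_eq arcsine_mass1 => // y _; rewrite mulr1.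
by apply: hasint_eq => // y _; rewrite mulr1.
Qed.

Lemma arcsine_mean : hasint `]a, b[ (fun y => arcsine a b y * (y - m)) 0.
Proof.
apply/arcsine_affine; first by meas.
rewrite -(mulr0 e); apply: hasint_eq (hasintZ e _ arcsine_mean1) => // y _.
by ring.
Qed.

Lemma arcsine_variance :
  hasint `]a, b[ (fun y => arcsine a b y * (y - m) ^+ 2) ((b - a) ^+ 2 / 8).
Proof.
apply/arcsine_affine; first by under eq_fun do rewrite expr2; meas.
rewrite (_ : _ / 8 = e ^+ 2 * 2^-1); first by rewrite /e; field.
apply: hasint_eq (hasintZ (e ^+ 2) _ arcsine_square1) => // y _.
by ring.
Qed.

End interval.

(** Green's function of the complement of [[a, b]] with pole at infinity. *)
Definition green_itv (a b x : R) : R := green ((x - (a + b) / 2) / ((b - a) / 2)).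

Section interval_potential.
Variables a b : R.
Hypothesis ab : a < b.
Let m := (a + b) / 2.
Let e := (b - a) / 2.
Let e0 : 0 < e. Proof. by rewrite divr_gt0// subr_gt0. Qed.

Lemma pot_arcsine x :
  hasint `]a, b[ (fun y => arcsine a b y * ln `|x - y|) (ln ((b - a) / 4) + green_itv a b x).
Proof.
have mw : measurable_fun setT w by exact: meas_arcsine.
apply/(arcsine_affine ab); [by meas|rewrite -/m -/e].
have h1 := pot_arcsine1_hasint ((x - m) / e).
rewrite pot_arcsine1 in h1.
have h2 := hasintD (measurable_itv _) (hasintZ (ln e) (measurable_itv _) arcsine_mass1) h1.
have -> : ln ((b - a) / 4) + green_itv a b x = ln e * 1 + (green ((x - m) / e) - ln 2).
  have -> : ln ((b - a) / 4) = ln e - ln 2.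
    by rewrite -ln_div ?posrE//; congr ln; rewrite /e; field.
  by rewrite /green_itv; ring.
apply: (hasint_off1 (c := (x - m) / e) _ _ _ h2) => //.
  by apply: measurable_funTS; meas.
move=> y _ ye; rewrite (mulrC (ln e)) -mulrDr; congr (_ * _).
rewrite -lnM ?posrE// ?normr_gt0 ?subr_eq0 1?eq_sym//; congr ln.
rewrite -{1}(gtr0_norm e0) -normrM; congr `|_|.
by field; rewrite gt_eqF.
Qed.

End interval_potential.

(** * Balayage of a point charge *)

Section balayage.
Variables a b : R.
Hypothesis ab : a < b.
Variable s : R.
Hypothesis as0 : 0 < a + s.
Let bs0 : 0 < b + s. Proof. by rewrite (lt_trans as0)// ltrD2r. Qed.
Let A := - (a + s)^-1.
Let B := - (b + s)^-1.

(* Balayage onto [[a, b]] of the unit point charge at [- s] *)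
Definition bal (y : R) : R := Num.sqrt ((a + s) * (b + s)) / (y + s) * arcsine a b y.

Lemma meas_bal : measurable_fun setT bal.
Proof. by rewrite /bal; apply: meas_mul; [meas|exact: meas_arcsine]. Qed.

(** The map [y -> - 1 / (y + s)] sends the pole [- s] to infinity, and sweeping a charge from
    infinity produces the equilibrium measure. The balayage is thus the pull-back of the arcsine
    measure of [[A, B]]. *)
Lemma balE y : a < y < b -> arcsine A B (- (y + s)^-1) * (y + s) ^- 2 = bal y.
Proof.
move=> /andP[ay yb]; have ys : 0 < y + s by have := as0; lra.
rewrite /bal /arcsine.
have -> : (B - - (y + s)^-1) * (- (y + s)^-1 - A) =
    ((b - y) * (y - a)) / ((y + s) ^+ 2 * ((a + s) * (b + s))).
  by rewrite /A /B; field; rewrite !gt_eqF.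
have p1 : 0 < (b - y) * (y - a) by apply: mulr_gt0; lra.
have ab0 : 0 <= (a + s) * (b + s) by rewrite mulr_ge0 ?ltW.
have D : Num.sqrt ((y + s) ^+ 2 * ((a + s) * (b + s))) = (y + s) * Num.sqrt ((a + s) * (b + s)).
  by rewrite sqrtrM ?sqr_ge0// sqrtr_sqr gtr0_norm.
rewrite sqrtrM ?(ltW p1)// sqrtrV ?D; first by rewrite mulr_ge0 ?sqr_ge0.
have q1 : 0 < Num.sqrt ((b - y) * (y - a)) by rewrite sqrtr_gt0.
have q2 : 0 < Num.sqrt ((a + s) * (b + s)) by rewrite sqrtr_gt0 mulr_gt0.
set Q1 := Num.sqrt ((b - y) * _) in q1 *; set Q2 := Num.sqrt _ in q2 *.
have p0 := pi_gt0 R; move: (pi : R) p0 => P p0.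
by field; rewrite !gt_eqF.
Qed.

Lemma AB : A < B.
Proof. by rewrite /A /B ltrN2 ltf_pV2 ?posrE// ltrD2r. Qed.

Lemma bal_hasint (G : R -> R) v : measurable_fun setT G ->
  hasint `]A, B[ (fun z => arcsine A B z * G z) v <->
  hasint `]a, b[ (fun y => bal y * G (- (y + s)^-1)) v.
Proof.
move=> mG; have mA : measurable_fun setT (arcsine A B) by exact: meas_arcsine.
have C := @change_of_variables R a b (fun y => - (y + s)^-1) (fun y => (y + s) ^- 2) ab
  _ _ _ (fun z => arcsine A B z * G z) v.
rewrite -/A -/B in C.
have {}C : hasint `]A, B[ (fun z => arcsine A B z * G z) v <->
    hasint `]a, b[ (fun y => arcsine A B (- (y + s)^-1) * G (- (y + s)^-1) * (y + s) ^- 2) v.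
  apply: C; last by meas.
  - move=> y /andP[ay yb]; have ys : 0 < y + s by have := as0; lra.
    by der; rewrite ?gt_eqF//; ring.
  - move=> y /andP[ay yb]; have ys : 0 < y + s by have := as0; lra.
    have -> : (fun y : R => (y + s) ^- 2) = (fun y => ((y + s) * (y + s))^-1).
      by apply/funext => t; rewrite expr2.
    by apply: der_continuous; der_rec; rewrite gt_eqF// mulr_gt0.
  - by move=> y /andP[ay yb]; rewrite invr_gt0 exprn_gt0//; have := as0; lra.
rewrite C; split; apply: hasint_eq => // y; rewrite /= in_itv/= => /balE <-; ring.
Qed.

Lemma bal_mass : hasint `]a, b[ bal 1.
Proof.
have m1 : hasint `]A, B[ (fun z => arcsine A B z * 1) 1.
  by apply: hasint_eq (arcsine_mass AB) => // x _; rewrite mulr1.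
have h := (bal_hasint 1 (measurable_cst (1 : R))).1 m1.
by apply: hasint_eq h => // y _; rewrite mulr1.
Qed.

(** With [X = - 1 / (x + s)] and [Y = - 1 / (y + s)] one has [|x - y| = |X - Y| (x + s) (y + s)] and
    [ln (y + s) = - ln |0 - Y|]. The potential is [ln (x + s)] plus the difference of the arcsine
    potential of [[A, B]] at [X] and at 0, where the capacity constant cancels. *)
Lemma pot_bal x : 0 < x + s ->
  hasint `]a, b[ (fun y => bal y * ln `|x - y|)
    (ln (x + s) + green_itv A B (- (x + s)^-1) - green_itv A B 0).
Proof.
move=> xs; have mb := meas_bal.
have mA : measurable_fun setT (arcsine A B) by exact: meas_arcsine.
have h1 := (bal_hasint _ (_ : measurable_fun setT (fun z : R => ln `|- (x + s)^-1 - z|))).1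
  (pot_arcsine AB (- (x + s)^-1)).
have h2 := (bal_hasint _ (_ : measurable_fun setT (fun z : R => ln `|0 - z|))).1
  (pot_arcsine AB 0).
have {}h1 := h1 ltac:(meas).
have {}h2 := h2 ltac:(meas).
have h3 := hasintB (measurable_itv _) (hasintD (measurable_itv _)
  (hasintZ (ln (x + s)) (measurable_itv _) bal_mass) h1) h2.
have -> : ln (x + s) + green_itv A B (- (x + s)^-1) - green_itv A B 0 =
  ln (x + s) * 1 + (ln ((B - A) / 4) + green_itv A B (- (x + s)^-1)) -
  (ln ((B - A) / 4) + green_itv A B 0) by ring.
apply: (hasint_off1 (c := x) _ _ _ h3) => //.
  by apply: measurable_funTS; meas.
move=> y; rewrite /= in_itv/= => /andP[ay yb] yx.
have ys : 0 < y + s by have := as0; lra.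
rewrite (mulrC _ (bal y)) -mulrDr -mulrBr; congr (_ * _).
have -> : ln `|0 - - (y + s)^-1| = - ln (y + s).
  by rewrite sub0r opprK gtr0_norm ?invr_gt0// lnV ?posrE.
have -> : - (x + s)^-1 - - (y + s)^-1 = (x - y) / ((x + s) * (y + s)).
  by field; rewrite !gt_eqF.
have p : 0 < (x + s) * (y + s) by rewrite mulr_gt0.
have lnP : ln `|((x + s) * (y + s))^-1| = - (ln (x + s) + ln (y + s)).
  by rewrite gtr0_norm ?invr_gt0// lnV ?posrE// lnM.
have nx : `|x - y| \is Num.pos by rewrite posrE normr_gt0 subr_eq0 eq_sym.
have np : `|((x + s) * (y + s))^-1| \is Num.pos.
  by rewrite posrE normr_gt0 invr_eq0 gt_eqF.
by rewrite normrM lnM// lnP; ring.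
Qed.

End balayage.

(* The Joukowski coordinates of the point x and of the pole -s turn the Moebius
   image of x into an explicit Joukowski value. *)
Section green_moebius.
Variables a b s t : R.
Hypothesis ab : a < b.
Hypothesis as0 : 0 < a + s.
Hypothesis t1 : 1 < t.
Hypothesis tE : (a + b) / 2 + s = (b - a) / 2 * ((t + t^-1) / 2).
Let A := - (a + s)^-1.
Let B := - (b + s)^-1.

Let moebiusE x : 0 < x + s ->
  (- (x + s)^-1 - (A + B) / 2) / ((B - A) / 2) =
  (t + t^-1) / 2 - ((t - t^-1) / 2) ^+ 2 * (b - a) / 2 / (x + s).
Proof.
move=> xs; have := tE; have as1 := as0; have ab1 := ab; have t1' := t1 => tE'.
have bs0 : 0 < b + s by lra.
have Y2 : ((t - t^-1) / 2) ^+ 2 = ((t + t^-1) / 2) ^+ 2 - 1 by field; lra.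
rewrite Y2; move: ((t + t^-1) / 2) tE' => Y tE'.
have YE : Y = (a + b + 2 * s) / (b - a) by apply: (mulfI (x := (b - a) / 2)); [lra|rewrite -tE'; field; lra].
rewrite YE /A /B; field; lra.
Qed.

Lemma green_moebius0 : green_itv A B 0 = ln t.
Proof.
have := tE; have as1 := as0; have ab1 := ab; have t1' := t1 => tE'.
have bs0 : 0 < b + s by lra.
rewrite /green_itv -(green_joukowski (ltW t1)); congr green.
have -> : (t + t^-1) / 2 = (a + b + 2 * s) / (b - a).
  by apply: (mulfI (x := (b - a) / 2)); [lra|rewrite -tE'; field; lra].
by rewrite /A /B; field; lra.
Qed.

Lemma green_moebius_in x : a <= x <= b -> green_itv A B (- (x + s)^-1) = 0.
Proof.
move=> /andP[ax xb]; have as1 := as0; have ab1 := ab.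
have [bs0 xs] : 0 < b + s /\ 0 < x + s by lra.
have AB' : A < B by exact: AB.
rewrite /green_itv green_in// normrM normfV (gtr0_norm (_ : 0 < (B - A) / 2)); first lra.
rewrite ler_pdivrMr; first lra.
have h1 : A <= - (x + s)^-1 by rewrite lerN2 lef_pV2 ?posrE//; lra.
have h2 : - (x + s)^-1 <= B by rewrite lerN2 lef_pV2 ?posrE//; lra.
by rewrite ler_norml; lra.
Qed.

Lemma green_moebius_right x z : 1 <= z -> x + s = (b - a) / 2 * ((z + z^-1) / 2 + (t + t^-1) / 2) ->
  green_itv A B (- (x + s)^-1) = ln ((1 + z * t) / (z + t)).
Proof.
move=> z1 xE; have as1 := as0; have ab1 := ab; have t1' := t1.
have zi : 0 < z^-1 by rewrite invr_gt0; lra.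
have ti : 0 < t^-1 by rewrite invr_gt0; lra.
have xs : 0 < x + s by rewrite xE mulr_gt0//; lra.
rewrite -green_joukowski; first by rewrite ler_pdivlMr; nra.
rewrite /green_itv moebiusE// xE; congr green.
have zt : 0 < z * t by nra.
have D : 0 < z * t * (t + t^-1 + (z + z^-1)) by rewrite mulr_gt0//; lra.
field; do ?split; try lra; nra.
Qed.

Lemma green_moebius_left x z : 1 <= z -> z < t -> x + s = (b - a) / 2 * ((t + t^-1) / 2 - (z + z^-1) / 2) ->
  green_itv A B (- (x + s)^-1) = ln ((z * t - 1) / (t - z)).
Proof.
move=> z1 zt1 xE; have as1 := as0; have ab1 := ab; have t1' := t1.
have zi : 0 < z^-1 by rewrite invr_gt0; lra.
have ti : 0 < t^-1 by rewrite invr_gt0; lra.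
have zt : 0 < z * t by nra.
have XE : t + t^-1 - (z + z^-1) = (t - z) * (z * t - 1) / (z * t) by field; lra.
have X0 : 0 < t + t^-1 - (z + z^-1).
  by rewrite XE divr_gt0// mulr_gt0; nra.
have xs : 0 < x + s by rewrite xE mulr_gt0//; lra.
rewrite -green_joukowski; first by rewrite ler_pdivlMr; nra.
rewrite /green_itv moebiusE// xE -greenN; congr green.
have n1 : t - z != 0 by rewrite gt_eqF// subr_gt0.
have n2 : z * t - 1 != 0 by rewrite gt_eqF// subr_gt0; nra.
have F : (t * t + 1) * z + - (z * z + 1) * t = (t - z) * (z * t - 1) by ring.
field; rewrite F mulf_neq0// n1 n2 /=.
by apply/and3P; split; rewrite gt_eqF//; lra.
Qed.

End green_moebius.
End arcsine_interval.

(** * The logarithmic potential of y times the arcsine density *)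

Section moment_log.
Context {R : realType}.
Local Notation mu := (@lebesgue_measure R).
Local Notation w := (arcsine (-1) 1 : R -> R).

Lemma hasint_abs (D : set R) (f : R -> R) v : measurable D -> hasint D f v ->
  exists v', hasint D (fun x => `|f x|) v'.
Proof.
move=> mD [fi _]; exists (\int[mu]_(x in D) `|f x|).
by apply: integrable_hasint => //; exact: (@integrable_abse _ _ _ mu D _ fi).
Qed.

Lemma ln1D_bound (x : R) : `|x| <= 2^-1 -> `|ln (1 + x) - x| <= 2 * x ^+ 2.
Proof.
rewrite ler_norml => /andP[x1 x2].
have p : 0 < 1 + x by lra.
have up : ln (1 + x) <= x by apply: le_ln1Dx; lra.
have lo : x / (1 + x) <= ln (1 + x).
  have : ln (1 + (- (x / (1 + x)))) <= - (x / (1 + x)).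
    by apply: le_ln1Dx; rewrite ltrN2 ltr_pdivrMr//; lra.
  have -> : 1 + (- (x / (1 + x))) = (1 + x)^-1 by field; lra.
  by rewrite lnV ?posrE// lerN2.
have q : x - 2 * x ^+ 2 <= x / (1 + x) by rewrite ler_pdivlMr//; nra.
by rewrite ler_norml; have := sqr_ge0 x; lra.
Qed.

(** The branch of [sqrt (x ^ 2 - 1)] asymptotic to [x] at both infinities; it is 0 on [[-1, 1]]
    since square roots of negative numbers are 0. *)
Definition green_conj (x : R) : R := (if 0 <= x then 1 else -1) * Num.sqrt (x ^+ 2 - 1).

Lemma green_conj_in (x : R) : `|x| <= 1 -> green_conj x = 0.
Proof.
move=> x1; rewrite /green_conj ler0_sqrtr ?mulr0//.
by rewrite subr_le0 -real_normK ?num_real// expr_le1.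
Qed.

Lemma joukowski_sqrt (z : R) : 1 <= z -> Num.sqrt (((z + z^-1) / 2) ^+ 2 - 1) = (z - z^-1) / 2.
Proof.
move=> z1; have z0 : 0 < z by lra.
have zz : z * z^-1 = 1 by rewrite divff// gt_eqF.
have zi : z^-1 <= 1 by rewrite invf_le1.
have -> : ((z + z^-1) / 2) ^+ 2 - 1 = ((z - z^-1) / 2) ^+ 2 by nra.
by rewrite sqrtr_sqr ger0_norm; lra.
Qed.

Lemma green_conj_joukowski (z : R) : 1 <= z -> green_conj ((z + z^-1) / 2) = (z - z^-1) / 2.
Proof.
move=> z1; have zi : 0 < z^-1 by rewrite invr_gt0; lra.
rewrite /green_conj joukowski_sqrt//; case: ifPn; rewrite ?mul1r// -ltNge; lra.
Qed.

Lemma green_conjN (x : R) : 1 <= x -> green_conj (- x) = - green_conj x.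
Proof.
move=> x1; rewrite /green_conj sqrrN.
have -> : (0 <= x) = true by lra.
have -> : (0 <= - x) = false by lra.
by rewrite mul1r mulN1r.
Qed.

(* All three positions of x relative to [-1, 1] are covered by one expansion,
   in powers of 1/t, of the potential of the balayage of the pole -s. *)
Lemma pot_bal1_expansion (x t : R) : 6 <= t -> 2 * `|x| < t ->
  exists2 ka : R, 0 <= ka <= 1 &
  hasint `](-1), 1[ (fun y => bal (-1) 1 ((t + t^-1) / 2) y * ln `|x - y|)
    (green x - ln 2 + ln (1 + (2 * (x - green_conj x) / t + ka / t ^+ 2))).
Proof.
move=> t6 xt; pose s : R := (t + t^-1) / 2.
have t0 : 0 < t by lra.
have t1 : 1 < t by lra.
have ti : 0 < t^-1 by rewrite invr_gt0.
have tt : t * t^-1 = 1 by rewrite divff// gt_eqF.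
have s1 : 0 < -1 + s by rewrite /s; nra.
have xlt : `|x| < t / 2 by lra.
have xs : 0 < x + s by move: xlt; rewrite /s ltr_norml; lra.
have tE : (-1 + 1) / 2 + s = (1 - -1) / 2 * ((t + t^-1) / 2) by rewrite /s; field; lra.
have m11 : (-1 : R) < 1 by lra.
have P := pot_bal m11 s1 xs.
rewrite (green_moebius0 m11 s1 t1 tE) in P.
have [x1|x1] := leP `|x| 1.
  exists 1; first lra.
  rewrite green_in// green_conj_in//.
  rewrite (green_moebius_in m11 s1) in P; first by rewrite -ler_norml.
  have E : x + s = t / 2 * (1 + (2 * (x - 0) / t + 1 / t ^+ 2)) by rewrite /s; field; lra.
  have Q0 : 0 < 1 + (2 * (x - 0) / t + 1 / t ^+ 2).
    by rewrite -(pmulr_rgt0 _ (_ : 0 < t / 2)) -?E//; lra.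
  suff -> : 0 - ln 2 + ln (1 + (2 * (x - 0) / t + 1 / t ^+ 2)) = ln (x + s) + 0 - ln t by [].
  rewrite E lnM ?posrE//; first lra.
  by rewrite ln_div ?posrE//; ring.
have [z z1 zE] := joukowskiP (ltW x1).
have z0 : 0 < z by lra.
have zi : 0 < z^-1 by rewrite invr_gt0.
have zi1 : z^-1 <= 1 by rewrite invf_le1.
have zt : z < t by lra.
have zt0 : 0 < z * t by rewrite mulr_gt0.
have zt1 : 1 < z * t by nra.
have ln2E : ln z - ln 2 = ln (z / 2) by rewrite ln_div ?posrE.
(* Off [[-1, 1]] the argument of the last logarithm is a perfect square, [(1 + 1 / (z t)) ^ 2] on
   the right and [(1 - 1 / (z t)) ^ 2] on the left; its last term gives [ka = 1 / z ^ 2]. *)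
exists (z^-1 ^+ 2); first by apply/andP; split; [exact: sqr_ge0|rewrite expr_le1// ltW].
have [x0|x0] := leP 0 x.
  rewrite ger0_norm// in zE.
  rewrite zE green_joukowski// green_conj_joukowski// -zE.
  rewrite (green_moebius_right m11 s1 t1 tE z1) in P.
    by rewrite zE /s; field; lra.
  suff -> : ln z - ln 2 + ln (1 + (2 * (x - (z - z^-1) / 2) / t + z^-1 ^+ 2 / t ^+ 2)) =
    ln (x + s) + ln ((1 + z * t) / (z + t)) - ln t by [].
  have E : 1 + (2 * (x - (z - z^-1) / 2) / t + z^-1 ^+ 2 / t ^+ 2) = ((1 + z * t) / (z * t)) ^+ 2.
    by rewrite zE; field; lra.
  have p1 : 0 < (1 + z * t) / (z * t) by rewrite divr_gt0//; lra.
  have p2 : 0 < (1 + z * t) / (z + t) by rewrite divr_gt0//; lra.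
  rewrite E ln2E -lnM ?posrE ?divr_gt0// ?exprn_gt0//.
  have pp : 0 < (x + s) * ((1 + z * t) / (z + t)) by exact: mulr_gt0.
  rewrite -lnM ?posrE// -ln_div ?posrE//; congr ln.
  by rewrite zE /s; field; lra.
have xE : x = - ((z + z^-1) / 2) by rewrite -zE ltr0_norm// opprK.
have xneg : 1 <= (z + z^-1) / 2 by rewrite -zE ltW.
rewrite xE greenN green_joukowski// green_conjN// green_conj_joukowski// -xE.
rewrite (green_moebius_left m11 s1 t1 tE z1 zt) in P.
  by rewrite xE /s; field; lra.
suff -> : ln z - ln 2 + ln (1 + (2 * (x - - ((z - z^-1) / 2)) / t + z^-1 ^+ 2 / t ^+ 2)) =
  ln (x + s) + ln ((z * t - 1) / (t - z)) - ln t by [].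
have E : 1 + (2 * (x - - ((z - z^-1) / 2)) / t + z^-1 ^+ 2 / t ^+ 2) = ((z * t - 1) / (z * t)) ^+ 2.
  by rewrite xE; field; lra.
have p1 : 0 < (z * t - 1) / (z * t) by rewrite divr_gt0//; lra.
have p2 : 0 < (z * t - 1) / (t - z) by rewrite divr_gt0//; lra.
rewrite E ln2E -lnM ?posrE ?divr_gt0// ?exprn_gt0//.
have pp : 0 < (x + s) * ((z * t - 1) / (t - z)) by exact: mulr_gt0.
rewrite -lnM ?posrE// -ln_div ?posrE//; congr ln.
by rewrite xE /s; field; lra.
Qed.

Lemma small_eq0 (x K T : R) : (forall t, T <= t -> `|x| <= K / t) -> x = 0.
Proof.
move=> H; apply/eqP/negPn/negP => x0.
have xp : 0 < `|x| by rewrite normr_gt0.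
pose t := `|T| + 1 + `|K| / `|x| * 2.
have k0 : 0 <= `|K| / `|x| * 2 by rewrite !mulr_ge0// invr_ge0.
have t0 : 0 < t by rewrite /t; have := normr_ge0 T; lra.
have Tt : T <= t by rewrite /t; have := ler_norm T; lra.
have := H t Tt; rewrite ler_pdivlMr// => h.
have kx : `|K| / `|x| * `|x| = `|K| by rewrite divfK// gt_eqF.
have : `|x| * t = `|x| * (`|T| + 1) + `|K| * 2 by rewrite /t mulrDr; congr (_ + _); rewrite mulrA (mulrC _ (`|K| / _)) kx.
have := ler_norm K; have := normr_ge0 K; have : 0 < `|x| * (`|T| + 1) by rewrite mulr_gt0// ltr_wpDl.
lra.
Qed.

End moment_log.

Section moment_log_arcsine.
Context {R : realType}.
Local Notation mu := (@lebesgue_measure R).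
Local Notation w := (arcsine (-1) 1 : R -> R).

(** For a pole far away the balayage density is [w y (1 - y / s)] up to smaller terms, with [s]
    close to [t / 2]. The coefficient of [1 / t] in its potential is therefore [- 2] times the
    wanted integral, and the expansion shows it to be [2 (x - green_conj x)]. *)
Lemma moment_log1 x :
  hasint `](-1), 1[ (fun y => w y * (y * ln `|x - y|)) (green_conj x - x).
Proof.
have mw : measurable_fun setT w by exact: meas_arcsine.
have hu := pot_arcsine1_hasint x; rewrite pot_arcsine1 in hu.
set u := green x - ln 2 in hu.
have [L hL] := hasint_abs (measurable_itv _) hu.
have L0 : 0 <= L by apply: (hasint_ge0 hL).
have bnd (y : R) : `](-1), 1[%classic y -> `|y| <= 1.
  by rewrite /= in_itv/= => /andP[y1 y2]; rewrite ler_norml; lra.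
have [||A1 [hA _]] := dominated_hasint (measurable_itv _) _ hL (f := fun y => w y * (y * ln `|x - y|)).
- by apply: measurable_funTS; meas.
- move=> y /bnd y1; rewrite mulrCA normrM ler_piMl//.
suff -> : green_conj x - x = A1 by [].
set xi := x - green_conj x.
have xi1 : `|xi| <= 1.
  rewrite /xi; have [x1|x1] := leP `|x| 1; first by rewrite green_conj_in// subr0.
  have [z z1 zE] := joukowskiP (ltW x1).
  have z0 : 0 < z by lra.
  have zi : 0 < z^-1 by rewrite invr_gt0.
  have zi1 : z^-1 <= 1 by rewrite invf_le1.
  have [x0|x0] := leP 0 x.
    rewrite ger0_norm// in zE; rewrite zE green_conj_joukowski// ler_norml; lra.
  have xE : x = - ((z + z^-1) / 2) by rewrite -zE ltr0_norm// opprK.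
  rewrite xE green_conjN// ?green_conj_joukowski//; first lra.
  by rewrite ler_norml; lra.
apply/esym/eqP; rewrite -subr_eq0 opprB -/xi; apply/eqP.
(* The constant adds up the remainders bounded below: [3 |u|], 54, 3, 1 and [4 L]. The threshold
   ensures [6 <= t] and [2 |x| < t]. *)
apply: (@small_eq0 R _ (3 * `|u| + 58 + 4 * L) (6 + 2 * `|x|)) => t tT.
have nx := normr_ge0 x.
have t6 : 6 <= t by lra.
have [|ka /andP[ka0 ka1] hP] := @pot_bal1_expansion R x t t6; first lra.
rewrite -/xi -/u in hP.
set d := 2 * xi / t + ka / t ^+ 2 in hP.
have t0 : 0 < t by lra.
pose p := t^-1.
have tp : t * p = 1 by rewrite divff// gt_eqF.
have p0 : 0 < p by rewrite invr_gt0.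
have p6 : p <= 6^-1 by rewrite lef_pV2 ?posrE//; lra.
pose s := (t + p) / 2; pose r := (t - p) / 2.
have r0 : 0 < r by rewrite /r; nra.
have s1 : 0 < s - 1 by rewrite /s; nra.
have dE : d = 2 * xi * p + ka * p ^+ 2 by rewrite /d /p exprVn.
have d2 : `|d| <= 3 * p.
  rewrite dE (le_trans (ler_normD _ _))//.
  have -> : `|2 * xi * p| = 2 * `|xi| * p by rewrite !normrM (gtr0_norm p0) (@ger0_norm _ 2).
  have kp : 0 <= ka * p ^+ 2 by rewrite mulr_ge0 ?sqr_ge0.
  rewrite (ger0_norm kp).
  have h1 : `|xi| * p <= p by rewrite ler_piMl// ltW.
  have h2 : ka * p ^+ 2 <= p ^+ 2 by rewrite ler_piMl// sqr_ge0.
  have h3 : p ^+ 2 <= p by rewrite expr2 ler_piMl// ltW//; lra.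
  lra.
have lnd : `|ln (1 + d) - d| <= 18 * p ^+ 2.
  apply: (le_trans (ln1D_bound _)); first by lra.
  have : d ^+ 2 <= (3 * p) ^+ 2 by rewrite -(real_normK (num_real d)) lerXn2r// nnegrE//; lra.
  by rewrite exprMn; lra.
(* y = s - s^2 / (y + s) + y^2 / (y + s) *)
have [||E [hE EL]] := dominated_hasint (measurable_itv _) _ (hasintZ (s - 1)^-1 (measurable_itv _) hL)
    (f := fun y => y ^+ 2 / (y + s) * (w y * ln `|x - y|)).
- by apply: measurable_funTS; under eq_fun do rewrite expr2; meas.
- move=> y yi; have y1 := bnd _ yi; rewrite normrM ler_wpM2r//.
  move: yi; rewrite /= in_itv/= => /andP[y2 y3].
  have ys : 0 < y + s by lra.
  have yp : 0 <= y ^+ 2 / (y + s) by rewrite divr_ge0 ?sqr_ge0// ltW.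
  rewrite (ger0_norm yp) ler_pdivrMr//.
  rewrite mulrC ler_pdivlMr//.
  have y21 : y ^+ 2 <= 1 by nra.
  have : y ^+ 2 * (s - 1) <= 1 * (s - 1) by rewrite ler_wpM2r// ltW.
  lra.
have sqE : Num.sqrt ((-1 + s) * (1 + s)) = r.
  have -> : (-1 + s) * (1 + s) = r ^+ 2 by rewrite /s /r; nra.
  by rewrite sqrtr_sqr gtr0_norm.
have hsum := hasintD (measurable_itv _) (hasintB (measurable_itv _) (hasintZ s (measurable_itv _) hu)
  (hasintZ (s ^+ 2 / r) (measurable_itv _) hP)) hE.
have A1E : A1 = s * u - s ^+ 2 / r * (u + ln (1 + d)) + E.
  apply: (hasint_unique hA); apply: hasint_eq hsum => // y.
  rewrite /= in_itv/= => /andP[y2 y3].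
  have ys : 0 < y + s by lra.
  rewrite /bal -/p -/s sqE; field; rewrite !gt_eqF//.
have EL' : `|E| <= 4 * L * p.
  apply: (le_trans EL); rewrite mulrC -mulrA [leRHS]mulrCA ler_wpM2l// -[leLHS]mul1r ler_pdivrMr//.
  by rewrite /s; nra.
have -> : A1 + xi = - u * (s * p / r) - s ^+ 2 / r * (ln (1 + d) - d) - s ^+ 2 / r * ka * p ^+ 2
    - xi * (s ^+ 2 / r * 2 * p - 1) + E.
  have sr : s - r = p by rewrite /s /r; field.
  have -> : s * p = s * s - s * r by rewrite -sr; ring.
  by rewrite A1E dE; field; rewrite gt_eqF.
have s2 : s ^+ 2 / r <= 3 * t.
  by rewrite ler_pdivrMr// /s /r; nra.
have b1 : 0 <= s * p / r <= 3 * p.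
  have s0 : 0 < s by lra.
  have q0 : 0 <= s * p / r by apply: divr_ge0; [apply: mulr_ge0|]; exact: ltW.
  by rewrite q0/= ler_pdivrMr// /s /r; nra.
have b2 : 0 <= s ^+ 2 / r * 2 * p - 1 <= p.
  have -> : s ^+ 2 / r * 2 * p - 1 = (s ^+ 2 * 2 * p - r) / r by field; rewrite gt_eqF.
  have -> : s ^+ 2 * 2 * p - r = 3 / 2 * p + p ^+ 3 / 2.
    rewrite /s /r (_ : ((t + p) / 2) ^+ 2 * 2 * p = (t * (t * p) + 2 * p * (t * p) + p ^+ 3) / 2); first by field.
    by rewrite tp; field.
  have p3 : 0 <= p ^+ 3 by rewrite exprn_ge0// ltW.
  have q0 : 0 <= (3 / 2 * p + p ^+ 3 / 2) / r by apply: divr_ge0; [lra|exact: ltW].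
  rewrite q0/=.
  rewrite ler_pdivrMr// /r (_ : p * ((t - p) / 2) = (1 - p ^+ 2) / 2); first by lra.
  have : p ^+ 3 <= p ^+ 2 by rewrite (exprS p 2) ler_piMl ?sqr_ge0//; lra.
  nra.
have s20 : 0 <= s ^+ 2 / r by rewrite divr_ge0 ?sqr_ge0// ltW.
have n1 : `|- u * (s * p / r)| <= 3 * `|u| * p.
  have [b11 b12] := andP b1.
  have -> : 3 * `|u| * p = `|u| * (3 * p) by ring.
  by rewrite normrM normrN (ger0_norm b11) ler_wpM2l.
have tp2 : t * p ^+ 2 = p by rewrite expr2 mulrA tp mul1r.
have n2 : `|s ^+ 2 / r * (ln (1 + d) - d)| <= 54 * p.
  rewrite normrM (ger0_norm s20) (le_trans (ler_pM _ _ s2 lnd))//.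
  have -> : 3 * t * (18 * p ^+ 2) = 54 * (t * p ^+ 2) by ring.
  by rewrite tp2.
have n3 : `|s ^+ 2 / r * ka * p ^+ 2| <= 3 * p.
  have q0 : 0 <= s ^+ 2 / r * ka * p ^+ 2.
    by apply: mulr_ge0; [exact: mulr_ge0|exact: sqr_ge0].
  rewrite (ger0_norm q0).
  have h : s ^+ 2 / r * ka <= 3 * t by rewrite (le_trans _ s2)// ler_piMr.
  by rewrite (le_trans (ler_wpM2r (sqr_ge0 p) h))// -mulrA tp2.
have n4 : `|xi * (s ^+ 2 / r * 2 * p - 1)| <= p.
  have [b21 b22] := andP b2.
  by rewrite normrM (ger0_norm b21) -[leRHS]mul1r ler_pM.
have -> : (3 * `|u| + 58 + 4 * L) / t = 3 * `|u| * p + 54 * p + 3 * p + p + 4 * L * p.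
  by rewrite -/p; ring.
rewrite (le_trans (ler_normD _ _))// lerD//.
do 3 (rewrite (le_trans (ler_normB _ _))// lerD//).
Qed.

Lemma moment_log (a b x : R) : a < b ->
  let m := (a + b) / 2 in let e := (b - a) / 2 in
  hasint `]a, b[ (fun y => arcsine a b y * ((y - m) * ln `|x - y|))
    (e * green_conj ((x - m) / e) - (x - m)).
Proof.
move=> ab m e; have e0 : 0 < e by rewrite /e; lra.
have mw : measurable_fun setT w by exact: meas_arcsine.
apply/(arcsine_affine ab); [by meas|rewrite -/m -/e].
have h1 := hasintZ e (measurable_itv _) (moment_log1 ((x - m) / e)).
have h2 := hasintZ (e * ln e) (measurable_itv _) (@arcsine_mean1 R).
have h3 := hasintD (measurable_itv _) h1 h2.
have -> : e * green_conj ((x - m) / e) - (x - m) = e * (green_conj ((x - m) / e) - (x - m) / e) + e * ln e * 0.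
  by field; rewrite gt_eqF.
apply: (hasint_off1 (c := (x - m) / e) _ _ _ h3) => //.
  by apply: measurable_funTS; meas.
move=> y _ ye.
have yx : 0 < `|(x - m) / e - y| by rewrite normr_gt0 subr_eq0 eq_sym.
have -> : x - (m + e * y) = e * ((x - m) / e - y) by field; rewrite gt_eqF.
have lE : ln (e * `|(x - m) / e - y|) = ln e + ln `|(x - m) / e - y| by exact: lnM.
by rewrite normrM (gtr0_norm e0) lE; ring.
Qed.

End moment_log_arcsine.

(** * The Euler-Lagrange conditions *)

Section green_inequalities.
Context {R : realType}.
Implicit Types (z t : R).

Lemma der_ge0_le (F f : R -> R) (a b : R) : a <= b ->
  (forall x, a <= x <= b -> is_derive x 1 F (f x)) ->
  (forall x, a <= x <= b -> 0 <= f x) -> F a <= F b.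
Proof.
move=> ab Ff f0.
have [||c cab E] := @MVT_segment R F f a b ab.
- by move=> x /[!in_itv]/= /andP[ax xb]; apply: Ff; rewrite !ltW.
- by apply: for_within => x /=; rewrite in_itv/= => xab; exact: der_continuous (Ff _ xab).
rewrite -subr_ge0 E mulr_ge0 ?subr_ge0//.
by apply: f0; move: cab; rewrite in_itv.
Qed.

(* Put [m = (a + b) / 2], [d = (b - a) / 4], [x = m +- d (z + 1 / z)], and write
   a pole as [- s = m - d (t + 1 / t)].  Then [1 / d] times the excess of the
   Euler-Lagrange function over its constant is [c T t0 + (1 - c) T t1], where
   [t0] and [t1] belong to the poles [0] and [- 1 / rho], [c = gam / sqrt (a b)],
   and [T] is [Tright] or [Tleft] according to the side of [[a, b]] where [x]
   lies.  Since [c] may exceed 1, positivity of [T] is not enough: [T] has to be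
   monotone in [t]. *)
Definition Tright t z := (z - z^-1) - (t + t^-1) * ln z +
  (t - t^-1) * (ln (1 + z * t) - ln (z + t)).

Definition Tleft t z := - (z - z^-1) - (t + t^-1) * ln z +
  (t - t^-1) * (ln (z * t - 1) - ln (t - z)).

(** These are the derivatives in [z] of [Tright t] and [Tleft t]. The pole enters only through
    [t + 1 / t] in the denominator, which gives positivity and monotonicity in [t] together, from
    the common value 0 at [z = 1]. *)
Let dright t z := (z - z^-1) * (1 - (z * z)^-1) / (z + z^-1 + (t + t^-1)).
Let dleft t z := (z - z^-1) * (1 - (z * z)^-1) / (t + t^-1 - (z + z^-1)).

Lemma Tright1 t : Tright t 1 = 0.
Proof. by rewrite /Tright invr1 ln1 mul1r !subrr !mulr0 subrr addr0. Qed.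

Lemma Tleft1 t : Tleft t 1 = 0.
Proof. by rewrite /Tleft invr1 ln1 mul1r !subrr !mulr0 !oppr0 !addr0. Qed.

Lemma der_Tright t z : 1 < t -> 1 <= z -> is_derive z 1 (Tright t) (dright t z).
Proof.
move=> t1 z1; have zt : 0 < z * t by rewrite mulr_gt0; lra.
rewrite /Tright; der; rewrite ?gt_eqF//; try lra.
rewrite /dright; have zi : 0 < z^-1 by rewrite invr_gt0; lra.
have ti : 0 < t^-1 by rewrite invr_gt0; lra.
have z2 : 0 < z * z by rewrite mulr_gt0; lra.
have t2 : 0 < t * t by rewrite mulr_gt0; lra.
field; rewrite !gt_eqF//; try lra.
by rewrite addr_gt0// mulr_gt0; lra.
Qed.

Lemma der_Tleft t z : 1 < t -> 1 <= z -> z < t -> is_derive z 1 (Tleft t) (dleft t z).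
Proof.
move=> t1 z1 zlt; have zt : 1 < z * t by nra.
rewrite /Tleft; der; rewrite ?gt_eqF//; try lra.
rewrite /dleft.
have F : (t * t + 1) * z + - (z * z + 1) * t = (t - z) * (z * t - 1) by ring.
have n1 : 0 < t - z by lra.
have n2 : 0 < z * t - 1 by lra.
field; rewrite F !gt_eqF//; try lra.
by rewrite mulr_gt0.
Qed.

Let zpos z : 1 <= z -> 0 <= (z - z^-1) * (1 - (z * z)^-1).
Proof.
move=> z1; have z2 : 1 <= z * z by nra.
rewrite mulr_ge0// subr_ge0 ?invf_le1//; try lra.
by rewrite (le_trans _ z1)// invf_le1//; lra.
Qed.

Let dpos t z : 1 < t -> 1 <= z -> 0 < z + z^-1 + (t + t^-1).
Proof.
move=> t1 z1; have zi : 0 < z^-1 by rewrite invr_gt0; lra.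
have ti : 0 < t^-1 by rewrite invr_gt0; lra.
lra.
Qed.

Let dposl t z : 1 < t -> 1 <= z -> z < t -> 0 < t + t^-1 - (z + z^-1).
Proof.
move=> t1 z1 zt.
have -> : t + t^-1 - (z + z^-1) = (t - z) * (z * t - 1) / (z * t) by field; lra.
by rewrite divr_gt0// mulr_gt0//; nra.
Qed.

Lemma Tright_ge0 t z : 1 < t -> 1 <= z -> 0 <= Tright t z.
Proof.
move=> t1 z1; rewrite -(Tright1 t); apply: (der_ge0_le z1) => x /andP[x1 _].
  exact: der_Tright.
by apply: divr_ge0; [exact: zpos|exact/ltW/dpos].
Qed.

Lemma Tleft_ge0 t z : 1 < t -> 1 <= z -> z < t -> 0 <= Tleft t z.
Proof.
move=> t1 z1 zt; rewrite -(Tleft1 t); apply: (der_ge0_le z1) => x /andP[x1 xz].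
  exact: der_Tleft t1 x1 (le_lt_trans xz zt).
by apply: divr_ge0; [exact: zpos|exact: ltW (dposl t1 x1 (le_lt_trans xz zt))].
Qed.

Lemma joukowski_le t u : 1 < t -> t <= u -> t + t^-1 <= u + u^-1.
Proof.
move=> t1 tu; rewrite -subr_ge0.
have -> : u + u^-1 - (t + t^-1) = (u - t) * (u * t - 1) / (u * t) by field; lra.
by rewrite divr_ge0 ?mulr_ge0//; nra.
Qed.

Lemma Tright_le t u z : 1 < t -> t <= u -> 1 <= z -> Tright u z <= Tright t z.
Proof.
move=> t1 tu z1; have u1 : 1 < u by lra.
rewrite -subr_ge0.
have -> : 0 = Tright t 1 - Tright u 1 by rewrite !Tright1 subrr.
apply: (der_ge0_le (F := fun x => Tright t x - Tright u x)
  (f := fun x => dright t x - dright u x) z1) => x /andP[x1 _].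
  by apply: derB; exact: der_Tright.
rewrite subr_ge0 ler_wpM2l ?zpos// lef_pV2 ?posrE ?dpos// lerD2l.
exact: joukowski_le.
Qed.

Lemma Tleft_le t u z : 1 < t -> t <= u -> 1 <= z -> z < t -> Tleft u z <= Tleft t z.
Proof.
move=> t1 tu z1 zt; have u1 : 1 < u by lra.
rewrite -subr_ge0.
have -> : 0 = Tleft t 1 - Tleft u 1 by rewrite !Tleft1 subrr.
apply: (der_ge0_le (F := fun x => Tleft t x - Tleft u x)
  (f := fun x => dleft t x - dleft u x) z1) => x /andP[x1 xz].
  by apply: derB; apply: der_Tleft => //; lra.
have xt : x < t by lra.
have xu : x < u by lra.
rewrite subr_ge0 ler_wpM2l ?zpos// lef_pV2 ?posrE ?dposl// lerD2r.
exact: joukowski_le.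
Qed.

End green_inequalities.


(** * The optimal density as a combination of explicit measures *)

Section density_decomposition.
Context {R : realType}.
Local Notation mu := (@lebesgue_measure R).
Variables (gam rho k a b : R).
Local Notation S := (Num.sqrt ((1 + rho * a) * (1 + rho * b))).
Hypotheses (gam0 : 0 < gam) (rho0 : 0 < rho) (a0 : 0 < a) (ab : a < b).
Hypothesis eq1 : k * rho / S + gam / Num.sqrt (a * b) = 1.
Hypothesis eq2 : (a + b - 2 * k - 2 * gam) / 4 + k / (2 * S) = 1.
Local Notation p := (opt_density (gam + 1) rho a b).

Let S0 : 0 < S.
Proof.
have h1 := rho0; have h2 := a0; have h3 := ab.
have b0 : 0 < b by lra.
by rewrite sqrtr_gt0 mulr_gt0// addr_gt0// mulr_gt0.
Qed.

Let g0 : 0 < Num.sqrt (a * b).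
Proof. by rewrite sqrtr_gt0 mulr_gt0// (lt_trans a0). Qed.

Let sqrtab0 : Num.sqrt ((a + 0) * (b + 0)) = Num.sqrt (a * b).
Proof. by rewrite !addr0. Qed.

Let sqrtabr : Num.sqrt ((a + rho^-1) * (b + rho^-1)) = S / rho.
Proof.
have r0 := rho0.
have -> : (a + rho^-1) * (b + rho^-1) = (1 + rho * a) * (1 + rho * b) / rho ^+ 2.
  by field; rewrite gt_eqF.
rewrite sqrtrM; first by rewrite mulr_ge0// addr_ge0// mulr_ge0// ltW//; have := ab; have := a0; lra.
by rewrite sqrtrV ?sqr_ge0// sqrtr_sqr gtr0_norm.
Qed.

(** Multiplying and dividing by the square root leaves [(b - y) (y - a) (rho y + c) / (y (1 + rho
    y))], where [c = gam / sqrt (a b)], over the arcsine root. Its partial fractions have residue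
    [- gam * sqrt (a b)] at 0 and, by [eq1], [- k * S / rho] at [- 1 / rho]: the weights of the
    balayages. The polynomial part is affine of slope [- 1], with constant fixed by [eq2]. *)
Lemma opt_density_decomp y : `]a, b[%classic y ->
  2 * p y = arcsine a b y * (2 + gam + k) - arcsine a b y * (y - (a + b) / 2)
    - gam * bal a b 0 y - k * bal a b rho^-1 y.
Proof.
rewrite /= in_itv/= => /andP[ay yb].
have h1 := rho0; have h2 := a0; have h3 := ab; have h4 := gam0.
have y0 : 0 < y by lra.
have ry0 : 0 < 1 + rho * y by rewrite addr_gt0// mulr_gt0.
have ry1 : 0 < y * rho + 1 by rewrite mulrC addrC.
rewrite /opt_density !ltW//= addrK /bal sqrtab0 sqrtabr addr0 /arcsine.
have q0 : 0 < (b - y) * (y - a) by rewrite mulr_gt0//; lra.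
have qq : Num.sqrt ((b - y) * (y - a)) ^+ 2 = (b - y) * (y - a) by rewrite sqr_sqrtr// ltW.
have gg : Num.sqrt (a * b) ^+ 2 = a * b by rewrite sqr_sqrtr// mulr_ge0//; lra.
have SS : S ^+ 2 = (1 + rho * a) * (1 + rho * b).
  by rewrite sqr_sqrtr// mulr_ge0// addr_ge0// mulr_ge0//; lra.
have qs0 : 0 < Num.sqrt ((b - y) * (y - a)) by rewrite sqrtr_gt0.
move: S0 g0 eq1 eq2 gg SS qq qs0.
set s := Num.sqrt ((1 + rho * a) * _); set g := Num.sqrt (a * b); set q := Num.sqrt _.
move=> s0 g0' e1 e2 gg SS qq qs0.
pose c := gam / g.
have gE : gam = c * g by rewrite /c divfK// gt_eqF.
have kE : k = s * (1 - c) / rho by rewrite -e1 /c; field; rewrite !gt_eqF.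
have aE : 2 + gam + k = (a + b) / 2 + (1 - c) / rho.
  have : (1 - c) / rho = k / s by rewrite kE; field; rewrite !gt_eqF.
  move=> ->; have : 1 = (a + b - 2 * k - 2 * gam) / 4 + k / (2 * s) by [].
  have -> : k / (2 * s) = k / s / 2 by field; rewrite gt_eqF.
  lra.
rewrite aE -/c kE gE.
have pi0 := pi_gt0 R; move: (pi : R) pi0 => P pi0.
have -> : c * g * (g / y * (P * q)^-1) = c * g ^+ 2 / y * (P * q)^-1 by ring.
have -> : s * (1 - c) / rho * (s / rho / (y + rho^-1) / (P * q)) =
   s ^+ 2 * (1 - c) / rho ^+ 2 / (y + rho^-1) / (P * q).
  by field; rewrite !gt_eqF.
rewrite gg SS.
have -> : 2 * ((2 * P)^-1 * (q / (y * (1 + rho * y))) * (rho * y + c)) =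
  q ^+ 2 * (rho * y + c) / (y * (1 + rho * y)) / (P * q).
  by field; rewrite !gt_eqF.
by rewrite qq; field; rewrite !gt_eqF.
Qed.


Local Notation g := (Num.sqrt (a * b)).
Local Notation m := ((a + b) / 2).
Local Notation e := ((b - a) / 2).

Let a0' : 0 < a + 0. Proof. by rewrite addr0. Qed.
Let ar0 : 0 < a + rho^-1. Proof. by rewrite addr_gt0// invr_gt0. Qed.

Lemma meas_opt_density : measurable_fun setT p.
Proof.
have -> : p = fun x => if a <= x then if x <= b then
    (2 * pi)^-1 * (Num.sqrt ((b - x) * (x - a)) / (x * (1 + rho * x)))
    * (rho * x + (gam + 1 - 1) / g) else 0 else 0.
  by apply/funext => x; rewrite /opt_density; case: (a <= x).
by meas.
Qed.

Lemma opt_density_out y : ~ (`]a, b[%classic y) -> p y = 0.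
Proof.
move=> nab; rewrite /opt_density; case: ifPn => // /andP[ay yb].
have [E|E] : y = a \/ y = b.
- move/negP : nab; rewrite /= in_itv/= negb_and -!leNgt => /orP[ya|by_].
    by left; apply/le_anti; rewrite ya.
  by right; apply/le_anti; rewrite yb.
- by rewrite E subrr mulr0 sqrtr0 mul0r mulr0 mul0r.
- by rewrite E subrr mul0r sqrtr0 mul0r mulr0 mul0r.
Qed.

Lemma opt_density_ge0 y : 0 <= p y.
Proof.
have h1 := rho0; have h2 := a0; have h3 := ab; have h4 := gam0.
rewrite /opt_density; case: ifPn => // /andP[ay yb].
have y0 : 0 < y by lra.
have ry : 0 < rho * y by rewrite mulr_gt0.
rewrite addrK; apply: mulr_ge0; last by rewrite addr_ge0 ?divr_ge0 ?sqrtr_ge0// ltW.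
apply: mulr_ge0; first by rewrite invr_ge0 mulr_ge0// pi_ge0.
apply: divr_ge0; first exact: sqrtr_ge0.
by rewrite mulr_ge0// ?ltW// addr_gt0.
Qed.

Lemma opt_hasint (H : R -> R) v0 v1 v2 v3 :
  hasint `]a, b[ (fun y => arcsine a b y * H y) v0 ->
  hasint `]a, b[ (fun y => arcsine a b y * ((y - m) * H y)) v1 ->
  hasint `]a, b[ (fun y => bal a b 0 y * H y) v2 ->
  hasint `]a, b[ (fun y => bal a b rho^-1 y * H y) v3 ->
  hasint `]a, b[ (fun y => p y * H y) (2^-1 * ((2 + gam + k) * v0 - v1 - gam * v2 - k * v3)).
Proof.
move=> h0 h1 h2 h3; have mi := @measurable_itv R `]a, b[.
have h := hasintZ 2^-1 mi (hasintB mi (hasintB mi (hasintB mi (hasintZ (2 + gam + k) mi h0) h1)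
  (hasintZ gam mi h2)) (hasintZ k mi h3)).
apply: hasint_eq h => // y yi; have := opt_density_decomp yi => E.
have -> : p y = 2^-1 * (2 * p y) by field.
by rewrite E; ring.
Qed.

Lemma bal_mean s : 0 < a + s ->
  hasint `]a, b[ (fun y => bal a b s y * y) (Num.sqrt ((a + s) * (b + s)) - s).
Proof.
move=> as0; have mi := @measurable_itv R `]a, b[.
have h := hasintB mi (hasintZ (Num.sqrt ((a + s) * (b + s))) mi (arcsine_mass ab))
  (hasintZ s mi (bal_mass ab as0)).
rewrite !mulr1 in h; apply: hasint_eq h => // y; rewrite /= in_itv/= => /andP[ay yb].
have ys : 0 < y + s by lra.
by rewrite /bal; field; rewrite gt_eqF.
Qed.

(** The coefficients of the pieces of mass 1 add up to [(2 + gam + k) - gam - k = 2], and the affine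
    piece has mean 0: through the decomposition, [eq2] is the normalization. *)
Lemma opt_mass : hasint `]a, b[ p 1.
Proof.
have mi := @measurable_itv R `]a, b[.
have one (f : R -> R) v : hasint `]a, b[ f v -> hasint `]a, b[ (fun y => f y * 1) v.
  by apply: hasint_eq => // y _; rewrite mulr1.
have h1 : hasint `]a, b[ (fun y => arcsine a b y * ((y - m) * 1)) 0.
  by apply: hasint_eq (arcsine_mean ab) => // y _; rewrite mulr1.
have := opt_hasint (one _ _ (arcsine_mass ab)) h1 (one _ _ (bal_mass ab a0')) (one _ _ (bal_mass ab ar0)).
rewrite (_ : 2^-1 * _ = 1); first by field.
by apply: hasint_eq => // y _; rewrite mulr1.
Qed.

Lemma opt_mean : hasint `]a, b[ (fun y => p y * y)
  ((b - a) ^+ 2 / 16 + k / (2 * rho) * (1 - (1 + rho * m) / S)).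
Proof.
have mi := @measurable_itv R `]a, b[.
have h0 : hasint `]a, b[ (fun y => arcsine a b y * y) m.
  have h := hasintD mi (arcsine_mean ab) (hasintZ m mi (arcsine_mass ab)).
  by rewrite add0r mulr1 in h; apply: hasint_eq h => // y _; ring.
have h1 : hasint `]a, b[ (fun y => arcsine a b y * ((y - m) * y)) ((b - a) ^+ 2 / 8).
  have h := hasintD mi (arcsine_variance ab) (hasintZ m mi (arcsine_mean ab)).
  by rewrite mulr0 addr0 in h; apply: hasint_eq h => // y _; ring.
have H := opt_hasint h0 h1 (bal_mean a0') (bal_mean ar0).
rewrite sqrtab0 sqrtabr subr0 in H.
suff E : (b - a) ^+ 2 / 16 + k / (2 * rho) * (1 - (1 + rho * m) / S) =
  2^-1 * ((2 + gam + k) * m - (b - a) ^+ 2 / 8 - gam * g - k * (S / rho - rho^-1)).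
  by rewrite E.
have h1' := rho0; have h2 := a0; have h3 := ab.
have gg : g ^+ 2 = a * b by rewrite sqr_sqrtr// mulr_ge0//; lra.
have SS : S ^+ 2 = (1 + rho * a) * (1 + rho * b).
  by rewrite sqr_sqrtr// mulr_ge0// addr_ge0// mulr_ge0//; lra.
pose K := k / S.
have kE : k = K * S by rewrite /K divfK// gt_eqF.
have gamE : gam * g = (1 - K * rho) * (a * b).
  have -> : 1 - K * rho = gam / g by rewrite /K -[X in X - _]eq1; ring.
  have -> : gam * g = gam / g * g ^+ 2 by field; rewrite gt_eqF.
  by rewrite gg.
have alE : 2 + gam + k = m + K.
  have E2 := eq2; have := E2.
  have -> : k / (2 * S) = K / 2 by rewrite /K; field; rewrite gt_eqF.
  lra.
have kS : k * (S / rho - rho^-1) = K * ((1 + rho * a) * (1 + rho * b)) / rho - k / rho.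
  have -> : k * (S / rho - rho^-1) = K * S ^+ 2 / rho - k / rho.
    by rewrite kE; field; rewrite gt_eqF.
  by rewrite SS.
have kR : k / (2 * rho) * (1 - (1 + rho * m) / S) = k / rho / 2 - K * (1 + rho * m) / rho / 2.
  by rewrite /K; field; rewrite !gt_eqF.
rewrite alE gamE kS kR; field; rewrite gt_eqF//.
Qed.

Lemma opt_pot x : 0 < x ->
  hasint `]a, b[ (fun y => p y * ln `|x - y|)
   (2^-1 * ((2 + gam + k) * (ln ((b - a) / 4) + green_itv a b x)
     - (e * green_conj ((x - m) / e) - (x - m))
     - gam * (ln (x + 0) + green_itv (- (a + 0)^-1) (- (b + 0)^-1) (- (x + 0)^-1)
              - green_itv (- (a + 0)^-1) (- (b + 0)^-1) 0)
     - k * (ln (x + rho^-1) + green_itv (- (a + rho^-1)^-1) (- (b + rho^-1)^-1) (- (x + rho^-1)^-1)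
              - green_itv (- (a + rho^-1)^-1) (- (b + rho^-1)^-1) 0))).
Proof.
move=> x0; apply: opt_hasint.
- exact: pot_arcsine.
- exact: moment_log.
- by apply: pot_bal => //; rewrite addr0.
- by apply: pot_bal => //; rewrite addr_gt0// invr_gt0.
Qed.

Let Gp s x : R := green_itv (- (a + s)^-1) (- (b + s)^-1) (- (x + s)^-1).

Let Tx x : R := e * green_conj ((x - m) / e) - (2 + gam + k) * green_itv a b x
  + gam * Gp 0 x + k * Gp rho^-1 x.

Definition euler_lagrange_cst : R := m - (2 + gam + k) * ln ((b - a) / 4)
  - gam * green_itv (- (a + 0)^-1) (- (b + 0)^-1) 0
  - k * green_itv (- (a + rho^-1)^-1) (- (b + rho^-1)^-1) 0 - k * ln rho.

(** The terms [x], [ln x] and [ln (x + 1 / rho)] of the external field cancel against the elementary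
    parts of the four potentials. What remains in [Tx] consists of Green functions and [green_conj],
    all zero on [[a, b]]. *)
Let potE x : 0 < x -> x - gam * ln x - k * ln (1 + rho * x) - 2 * pot p x = euler_lagrange_cst + Tx x.
Proof.
move=> x0; have h := opt_pot x0; have r0 := rho0.
have hT : hasint setT (fun y => p y * ln `|x - y|) (pot p x).
  rewrite /pot (_ : (\int[mu]_y _) = 2^-1 * ((2 + gam + k) * (ln ((b - a) / 4) + green_itv a b x)
     - (e * green_conj ((x - m) / e) - (x - m))
     - gam * (ln (x + 0) + green_itv (- (a + 0)^-1) (- (b + 0)^-1) (- (x + 0)^-1)
              - green_itv (- (a + 0)^-1) (- (b + 0)^-1) 0)
     - k * (ln (x + rho^-1) + green_itv (- (a + rho^-1)^-1) (- (b + rho^-1)^-1) (- (x + rho^-1)^-1)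
              - green_itv (- (a + rho^-1)^-1) (- (b + rho^-1)^-1) 0))).
    apply: hasint_Rint; apply/(@hasintT_restrict R `]a, b[); [by []| |exact: h].
    by move=> y /opt_density_out ->; rewrite mul0r.
  apply/(@hasintT_restrict R `]a, b[); [by []| |exact: h].
  by move=> y /opt_density_out ->; rewrite mul0r.
have {}hT : hasint `]a, b[ (fun y => p y * ln `|x - y|) (pot p x).
  apply/(@hasintT_restrict R `]a, b[); [by []| |exact: hT].
  by move=> y /opt_density_out ->; rewrite mul0r.
rewrite (hasint_unique hT h).
have -> : ln (1 + rho * x) = ln rho + ln (x + rho^-1).
  by rewrite -lnM ?posrE ?addr_gt0 ?invr_gt0//; congr ln; field; rewrite gt_eqF.
by rewrite /euler_lagrange_cst /Tx /Gp !addr0; field.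
Qed.

Lemma euler_lagrange_eq x : a <= x <= b ->
  x - gam * ln x - k * ln (1 + rho * x) - 2 * pot p x = euler_lagrange_cst.
Proof.
move=> xab; have h2 := a0; have h3 := ab.
have x0 : 0 < x by case/andP: xab; lra.
have e0 : 0 < e by lra.
have xi : `|(x - m) / e| <= 1.
  by rewrite normrM normfV (gtr0_norm e0) ler_pdivrMr// mul1r ler_norml; case/andP: xab; lra.
rewrite potE// /Tx /Gp green_conj_in// /green_itv (green_in xi).
rewrite -/(green_itv _ _ _) -/(green_itv (- (a + rho^-1)^-1) _ _).
by rewrite !green_moebius_in//; ring.
Qed.

Let jouk s : 0 < a + s -> exists2 t, 1 < t & m + s = e * ((t + t^-1) / 2).
Proof.
move=> as0; have h3 := ab; have e0 : 0 < e by lra.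
have h : 1 < (m + s) / e by rewrite ltr_pdivlMr//; lra.
have [t t1 tE] := joukowskiP (ltW h).
exists t; last by rewrite -tE; field; lra.
rewrite lt_neqAle t1 andbT; apply/eqP => tt; move: h; rewrite tE -tt invr1; lra.
Qed.

Let sqrt_jouk s t : 0 < a + s -> 1 < t -> m + s = e * ((t + t^-1) / 2) ->
  Num.sqrt ((a + s) * (b + s)) = e * ((t - t^-1) / 2).
Proof.
move=> as0 t1 tE; have h3 := ab.
have tt : t * t^-1 = 1 by rewrite divff// gt_eqF//; lra.
have ti : t^-1 < 1 by rewrite invf_lt1//; lra.
have -> : (a + s) * (b + s) = (e * ((t - t^-1) / 2)) ^+ 2.
  have -> : (a + s) * (b + s) = (m + s) ^+ 2 - e ^+ 2 by field.
  by rewrite tE; field; lra.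
by rewrite sqrtr_sqr ger0_norm// mulr_ge0//; lra.
Qed.

Lemma euler_lagrange_ge x : 0 < x ->
  euler_lagrange_cst <= x - gam * ln x - k * ln (1 + rho * x) - 2 * pot p x.
Proof.
move=> x0; have h1 := rho0; have h2 := a0; have h3 := ab; have h4 := gam0.
have [xab|xab] := boolP (a <= x <= b); first by rewrite euler_lagrange_eq.
rewrite potE// lerDl.
have e0 : 0 < e by lra.
have [t0 t01 t0E] := jouk a0'; have [t1 t11 t1E] := jouk ar0.
have ri : 0 < rho^-1 by rewrite invr_gt0.
(* The pole 0 lies nearer to [[a, b]] than [- 1 / rho], and [t + 1 / t] increases for [t > 1]. *)
have t01le : t0 <= t1.
  rewrite leNgt; apply/negP => tl; have := joukowski_le t11 (ltW tl).
  suff : t0 + t0^-1 < t1 + t1^-1 by lra.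
  have : e * (t0 + t0^-1) < e * (t1 + t1^-1) by lra.
  by rewrite ltr_pM2l.
have gE := sqrt_jouk a0' t01 t0E; have SE := sqrt_jouk ar0 t11 t1E.
rewrite sqrtab0 in gE; rewrite sqrtabr in SE.
pose c := gam / g.
have c0 : 0 < c by rewrite divr_gt0.
have gamE : gam = c * (e * ((t0 - t0^-1) / 2)) by rewrite -gE /c divfK// gt_eqF.
have cE : 1 - c = k * rho / S by rewrite -[X in X - c]eq1 /c; ring.
have kE : k = (1 - c) * (e * ((t1 - t1^-1) / 2)).
  by rewrite -SE cE; field; rewrite !gt_eqF.
have alE : 2 + gam + k = c * (e * ((t0 + t0^-1) / 2)) + (1 - c) * (e * ((t1 + t1^-1) / 2)).
  have -> : c * (e * ((t0 + t0^-1) / 2)) + (1 - c) * (e * ((t1 + t1^-1) / 2)) = m + (1 - c) / rho.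
    by rewrite -t0E -t1E; ring.
  have -> : (1 - c) / rho = k / S by rewrite cE; field; rewrite !gt_eqF.
  have E2 := eq2; have := E2; have -> : k / (2 * S) = k / S / 2 by field; rewrite gt_eqF.
  lra.
have [xa|ax] := ltP x a.
  have xi : 1 <= (m - x) / e by rewrite ler_pdivlMr//; lra.
  have [z z1 zE] := joukowskiP xi.
  have xE : x = m - e * ((z + z^-1) / 2) by rewrite -zE; field; lra.
  (* This encodes [x > 0]: the point lies between the pole 0 and [a]. *)
  have zt0 : z < t0.
    rewrite ltNge; apply/negP => tl; have := joukowski_le t01 tl.
    suff : z + z^-1 < t0 + t0^-1 by lra.
    have : e * (z + z^-1) < e * (t0 + t0^-1) by lra.
    by rewrite ltr_pM2l.
  have zt1 : z < t1 by lra.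
  have zz : 1 < z * t0 by nra.
  have zz1 : 1 < z * t1 by nra.
  rewrite /Tx /Gp.
  rewrite (green_moebius_left h3 a0' t01 _ z1 zt0) //; first by rewrite xE; lra.
  rewrite (green_moebius_left h3 ar0 t11 _ z1 zt1) //; first by rewrite xE; lra.
  rewrite /green_itv.
  have -> : (x - m) / e = - ((z + z^-1) / 2) by rewrite -zE; field; lra.
  rewrite greenN green_joukowski// green_conjN -?zE// zE green_conj_joukowski//.
  rewrite !ln_div ?posrE; [lra|lra|lra|lra|].
  have T0 : 0 <= e / 2 * (c * (Tleft t0 z - Tleft t1 z) + Tleft t1 z).
    rewrite mulr_ge0//; first lra.
    by rewrite addr_ge0 ?Tleft_ge0// mulr_ge0 ?(ltW c0)// subr_ge0 Tleft_le.
  apply: (le_trans T0); rewrite le_eqVlt; apply/orP; left; apply/eqP.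
  by rewrite alE gamE kE /Tleft; ring.
have xb : b < x by rewrite ltNge; apply: contra xab; rewrite ax.
have xi : 1 <= (x - m) / e by rewrite ler_pdivlMr//; lra.
have [z z1 zE] := joukowskiP xi.
have xE : x = m + e * ((z + z^-1) / 2) by rewrite -zE; field; lra.
have z0 : 0 < z by lra.
have zz : 0 < z * t0 by rewrite mulr_gt0//; lra.
have zz1 : 0 < z * t1 by rewrite mulr_gt0//; lra.
rewrite /Tx /Gp.
rewrite (green_moebius_right h3 a0' t01 _ z1) //; first by rewrite xE; lra.
rewrite (green_moebius_right h3 ar0 t11 _ z1) //; first by rewrite xE; lra.
rewrite /green_itv zE green_joukowski// green_conj_joukowski//.
rewrite !ln_div ?posrE; [lra|lra|lra|lra|].
have T0 : 0 <= e / 2 * (c * (Tright t0 z - Tright t1 z) + Tright t1 z).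
  rewrite mulr_ge0//; first lra.
  by rewrite addr_ge0 ?Tright_ge0// mulr_ge0 ?(ltW c0)// subr_ge0 Tright_le.
apply: (le_trans T0); rewrite le_eqVlt; apply/orP; left; apply/eqP.
by rewrite alE gamE kE /Tright; ring.
Qed.

End density_decomposition.

(** * Definiteness of the logarithmic energy *)

Section triangle_kernel.
Context {R : realType}.
Local Notation mu := (@lebesgue_measure R).

(* Integrating [window M th x * window M th y] over all [th = (h, z)] gives a
   logarithmic kernel truncated at distance [M]. *)
Definition window (M : R) (th : R * R) (x : R) : R :=
  if 0 <= th.1 then if th.1 <= M then if th.2 <= x then if x <= th.2 + th.1
  then th.1^-1 else 0 else 0 else 0 else 0.

Definition logker (M u : R) : R :=
  if `|u| <= M then ln M - ln `|u| - 1 + `|u| / M else 0.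

Lemma window_ge0 M th x : 0 <= window M th x.
Proof.
rewrite /window; case: ifPn => // h0; case: ifPn => // _; case: ifPn => // _; case: ifPn => // _.
by rewrite invr_ge0.
Qed.

Lemma meas_window M d (T : measurableType d) (f : T -> R * R) (g : T -> R) :
  measurable_fun setT (fun t => (f t).1) -> measurable_fun setT (fun t => (f t).2) ->
  measurable_fun setT g -> measurable_fun setT (fun t => window M (f t) (g t)).
Proof. by move=> m1 m2 mg; rewrite /window; meas. Qed.

Lemma meas_logker M d (T : measurableType d) (f : T -> R) :
  measurable_fun setT f -> measurable_fun setT (fun t => logker M (f t)).
Proof. by move=> mf; rewrite /logker; meas. Qed.

(** For [|u| <= M] this is an equality; beyond, it is [ln v <= v - 1] at [v = |u| / M]. The error is
    linear in [|u|], so first moments make it of order [1 / M] after integration. *)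
Lemma logker_approx M u : 1 <= M -> `|ln `|u| - ln M + 1 + logker M u| <= `|u| / M.
Proof.
move=> M1; have M0 : 0 < M by lra.
rewrite /logker; case: ifPn => uM.
  rewrite (_ : _ + _ = `|u| / M); first by ring.
  by rewrite ger0_norm// divr_ge0// ltW.
rewrite -ltNge in uM; have u0 : 0 < `|u| by lra.
rewrite addr0 -ln_div ?posrE//.
have h : 1 < `|u| / M by rewrite ltr_pdivlMr// mul1r.
have l0 : 0 <= ln (`|u| / M) by rewrite ln_ge0// ltW.
rewrite ger0_norm; first lra.
have := @le_ln1Dx _ (`|u| / M - 1); rewrite (addrC 1) subrK; lra.
Qed.

Lemma window_z_integral M h x y : 0 < h -> h <= M ->
  (\int[mu]_z (window M (h, z) x * window M (h, z) y)%:E =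
   (Num.max 0 (h - `|x - y|) / h ^+ 2)%:E)%E.
Proof.
move=> h0 hM.
have E z : window M (h, z) x * window M (h, z) y =
    h ^- 2 * \1_(`[Num.max x y - h, Num.min x y]) z.
  rewrite /window /= (ltW h0) hM indicE.
  have -> : (z \in `[Num.max x y - h, Num.min x y]%classic) =
      [&& z <= x, x <= z + h, z <= y & y <= z + h].
    rewrite mem_setE in_itv/= le_min lerBlDr ge_max.
    by case: (z <= x); case: (z <= y); case: (x <= z + h); case: (y <= z + h).
  by case: (z <= x); case: (z <= y); case: (x <= z + h); case: (y <= z + h);
    rewrite /= ?mulr1 ?mulr0 ?mul0r// expr2 invfM.
under eq_integral do rewrite E EFinM.
rewrite ge0_integralZl//.
- by apply/measurable_EFinP; exact: measurable_indic.
- by rewrite lee_fin invr_ge0 sqr_ge0.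
rewrite integral_indic//= setIT lebesgue_measure_itv/= mulrC EFinM; congr (_ * _)%E.
have mm : Num.min x y - (Num.max x y - h) = h - `|x - y|.
  case: (leP x y) => xy; first by rewrite ler0_norm ?subr_le0//; ring.
  by rewrite gtr0_norm ?subr_gt0//; ring.
rewrite lte_fin -subr_gt0 mm; case: ltP => hh.
  by rewrite -EFinB mm.
by [].
Qed.

(** Windows of length [h] containing both points have left ends filling an interval of length
    [h - |x - y|]. Integrating [(h - u) / h ^ 2] from [u = |x - y|] to [M], with primitive
    [ln h + u / h], produces [logker]. *)
Lemma window_integral M x y : 1 <= M -> x != y ->
  (\int[mu \x mu]_th (window M th x * window M th y)%:E = (logker M (x - y))%:E)%E.
Proof.
move=> M1 xy; have M0 : 0 < M by lra.
pose f (th : R * R) := (window M th x * window M th y)%:E.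
have mf : measurable_fun setT f.
  by apply/measurable_EFinP; apply: meas_mul; apply: meas_window; meas.
have f0 th : (0 <= f th)%E by rewrite lee_fin mulr_ge0// window_ge0.
transitivity (\int[mu]_h \int[mu]_z f (h, z))%E.
  exact: (@fubini_tonelli1 _ _ _ _ _ mu mu f mf f0).
rewrite /f.
set u := `|x - y|.
have u0 : 0 < u by rewrite normr_gt0 subr_eq0.
pose G h : R := if u <= h then if h <= M then (h - u) / h ^+ 2 else 0 else 0.
have GE h : (\int[mu]_z (window M (h, z) x * window M (h, z) y)%:E = (G h)%:E)%E.
  have out : (forall z, window M (h, z) x = 0) -> G h = 0 ->
      (\int[mu]_z (window M (h, z) x * window M (h, z) y)%:E = (G h)%:E)%E.
    move=> P0 ->; rewrite integral0_eq// => z _; by rewrite P0 mul0r.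
  have [h0|h0] := leP h 0.
    apply: out; last by rewrite /G leNgt (le_lt_trans h0 u0).
    move=> z; rewrite /window /=; case: ifPn => // h0'; have -> : h = 0 by apply/le_anti; rewrite h0.
    by rewrite invr0; do ?case: ifP.
  have [hM|hM] := leP h M; last first.
    apply: out; last by rewrite /G (leNgt h) hM/=; case: ifP.
    by move=> z; rewrite /window /= (leNgt h M) hM /=; case: ifP.
  rewrite window_z_integral//; congr EFin; rewrite /G hM -/u; case: leP => uh.
    by rewrite max_r// subr_ge0.
  by rewrite max_l ?mul0r// subr_le0 ltW.
under eq_integral do rewrite GE.
have [uM|uM] := leP u M; last first.
  rewrite integral0_eq ?/logker -?/u ?(leNgt _ M) ?uM// => h _.
  by rewrite /G; case: ifPn => // uh; case: ifPn => // hM; move: (le_trans uh hM); rewrite leNgt uM.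
have H : hasint `[u, M] (fun h => (h - u) / h ^+ 2) (ln M + u / M - (ln u + u / u)).
  apply: (@hasint_FTC R u M (fun h => ln h + u / h)) => // h /andP[uh hM]; have h0 : 0 < h by lra.
    by der; rewrite ?gt_eqF//=; field; rewrite gt_eqF.
  have -> : (fun h : R => (h - u) / h ^+ 2) = (fun h => (h - u) / (h * h)) by apply/funext => t; rewrite expr2.
  have : {for h, continuous (fun h => (h - u) / (h * h))}.
    by apply: der_continuous; der_rec; rewrite gt_eqF// mulr_gt0.
  by [].
have HT : hasint setT G (ln M + u / M - (ln u + u / u)).
  apply/(@hasintT_restrict R `[u, M]) => //.
    move=> h /= /negP; rewrite in_itv/= negb_and -!ltNge /G => /orP[hu|hM].
      by rewrite leNgt hu.
    by rewrite (leNgt h) hM/=; case: ifP.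
  apply: hasint_eq H => // h; rewrite /= in_itv/= => /andP[uh hM].
  by rewrite /G uh hM.
rewrite (hasint_int HT) /logker -/u uM; congr EFin; rewrite divff ?gt_eqF//; ring.
Qed.

End triangle_kernel.

Section lebesgue_square.
Context {R : realType}.
Let mu : {sigma_finite_measure set (measurableTypeR R) -> \bar R} := @lebesgue_measure R.
Local Open Scope ereal_scope.
Let mm : {measure set (measurableTypeR R * measurableTypeR R)%type -> \bar R} := mu \x mu.

Let mm_sigma_finite : sigma_finite setT mm.
Proof.
have /sigma_finiteP[F [TF ndF Foo]] := sigma_finiteT mu.
exists (fun n => F n `*` F n).
  rewrite -setXTT TF predeqE => -[x y]; split.
    move=> [/= [n _ Fnx] [k _ Gky]]; exists (maxn n k) => //; split.
    - by move: x Fnx; exact/subsetPset/ndF/leq_maxl.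
    - by move: y Gky; exact/subsetPset/ndF/leq_maxr.
  by move=> [n _ []/= ? ?]; split; exists n.
move=> k; have [? ?] := Foo k.
split; first exact: measurableX.
by rewrite /mm/= product_measure1E// lte_mul_pinfty// ge0_fin_numE.
Qed.

(* A named copy of the product measure, on which the instance making it
   sigma-finite can be declared. *)
Definition lebesgue_square :
  set (measurableTypeR R * measurableTypeR R)%type -> \bar R := mm.
HB.instance Definition _ := Measure.on lebesgue_square.
HB.instance Definition _ := Measure_isSigmaFinite.Build _ _ _ lebesgue_square mm_sigma_finite.

End lebesgue_square.


(** * Energies as integrals of products of window masses *)

Section tonelli_square.
Context {R : realType}.
Local Notation mu := (@lebesgue_measure R).
Local Open Scope ereal_scope.

(** Every factor is nonnegative, so the four-fold integral may be reordered before anything is known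
    to be finite. *)
Lemma tonelli_square M (q p : R -> R) (Q P : R * R -> R) :
  measurable_fun setT q -> measurable_fun setT p ->
  (forall x, 0 <= q x)%R -> (forall x, 0 <= p x)%R ->
  (forall th, \int[mu]_x (q x * window M th x)%:E = (Q th)%:E) ->
  (forall th, \int[mu]_x (p x * window M th x)%:E = (P th)%:E) ->
  \int[mu]_x \int[mu]_y ((q x * p y)%:E * \int[mu \x mu]_th (window M th x * window M th y)%:E) =
  \int[mu \x mu]_th (Q th * P th)%:E.
Proof.
move=> mq mp q0 p0 QE PE.
have PP0 (x y : R) (th : R * R) : 0 <= (window M th x * window M th y)%:E.
  by rewrite lee_fin; exact: mulr_ge0 (window_ge0 _ _ _) (window_ge0 _ _ _).
have PPm (x y : R) : measurable_fun setT (fun th : R * R => (window M th x * window M th y)%:E).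
  by apply/measurable_EFinP; apply: meas_mul; apply: meas_window; meas.
have fP0 (g : R -> R) (x : R) (th : R * R) : (forall x, 0 <= g x)%R -> 0 <= (g x * window M th x)%:E.
  by move=> g0; rewrite lee_fin; exact: mulr_ge0 (g0 x) (window_ge0 _ _ _).
have fPm (g : R -> R) (th : R * R) : measurable_fun setT g -> measurable_fun setT (fun x => (g x * window M th x)%:E).
  by move=> mg; apply/measurable_EFinP; apply: (meas_mul mg); apply: meas_window; meas.
pose f (w : (R * R) * (R * R)) :=
  (q w.1.1 * p w.1.2 * (window M w.2 w.1.1 * window M w.2 w.1.2))%:E.
have m11 : measurable_fun setT (fun w : (R * R) * (R * R) => w.1.1) by apply: measurableT_comp.
have m12 : measurable_fun setT (fun w : (R * R) * (R * R) => w.1.2) by apply: measurableT_comp.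
have m21 : measurable_fun setT (fun w : (R * R) * (R * R) => w.2.1) by apply: measurableT_comp.
have m22 : measurable_fun setT (fun w : (R * R) * (R * R) => w.2.2) by apply: measurableT_comp.
have mf : measurable_fun setT f.
  apply/measurable_EFinP; apply: meas_mul; first by meas.
  by apply: meas_mul; apply: meas_window.
have f0 w : 0 <= f w by rewrite lee_fin !mulr_ge0 ?window_ge0.
have FT := @fubini_tonelli _ _ _ _ _ (@lebesgue_square R) (@lebesgue_square R) f mf f0.
have fE xy : \int[mu \x mu]_th f (xy, th) =
    (q xy.1 * p xy.2)%:E * \int[mu \x mu]_th (window M th xy.1 * window M th xy.2)%:E.
  rewrite /f /=; under eq_integral do rewrite EFinM.
  apply: (@ge0_integralZl_EFin _ _ R (@lebesgue_square R) setT measurableT).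
  - by move=> th _; exact: PP0.
  - exact: PPm.
  - exact: mulr_ge0.
pose F (xy : R * R) := \int[mu \x mu]_th f (xy, th).
have mF : measurable_fun setT F by exact: (@measurable_fun_fubini_tonelli_F _ _ _ _ _ (@lebesgue_square R) f).
have F0 xy : 0 <= F xy by apply: integral_ge0.
have -> : \int[mu]_x \int[mu]_y ((q x * p y)%:E * \int[mu \x mu]_th (window M th x * window M th y)%:E) =
    \int[mu \x mu]_xy F xy.
  rewrite [RHS](@fubini_tonelli1 _ _ _ _ _ mu mu F mF F0).
  apply: eq_integral => x _; apply: eq_integral => y _.
  by rewrite /F fE.
transitivity (\int[mu \x mu]_th \int[mu \x mu]_xy f (xy, th)); first exact: FT.
apply: eq_integral => th _.
pose g (xy : R * R) := f (xy, th).
have mg : measurable_fun setT g.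
  apply/measurable_EFinP; apply: meas_mul; first by meas.
  by apply: meas_mul; apply: meas_window; meas.
transitivity (\int[mu]_x \int[mu]_y g (x, y)).
  by apply: (@fubini_tonelli1 _ _ _ _ _ mu mu g mg) => xy; exact: f0.
rewrite /g /f /=.
transitivity (\int[mu]_x ((P th)%:E * (q x * window M th x)%:E)).
  apply: eq_integral => x _; rewrite muleC -PE -(@ge0_integralZl_EFin _ _ R mu setT measurableT).
  - by move=> y _; exact: fP0.
  - exact: fPm.
  - exact: mulr_ge0 (q0 x) (window_ge0 _ _ _).
  by apply: eq_integral => y _; rewrite -EFinM; congr EFin; ring.
rewrite (@ge0_integralZl_EFin _ _ R mu setT measurableT).
- by move=> y _; exact: fP0.
- exact: fPm.
- by rewrite -lee_fin -PE; apply: integral_ge0 => y _; exact: fP0.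
by rewrite QE -EFinM mulrC.
Qed.

End tonelli_square.

Section windows.
Context {R : realType}.
Local Notation mu := (@lebesgue_measure R).
Local Notation mu2 := (@lebesgue_square R).
Implicit Types (q p : R -> R) (m C M : R).

Lemma meas_param_integral d (T : measurableType d) (f : T -> R -> R) (v : T -> R) :
  measurable_fun setT (fun w : T * R => f w.1 w.2) -> (forall t x, 0 <= f t x) ->
  (forall t, hasint setT (f t) (v t)) -> measurable_fun setT v.
Proof.
move=> mf f0 fv; apply/measurable_EFinP.
pose F (w : T * R) := (f w.1 w.2)%:E.
have mF : measurable_fun setT F by apply/measurable_EFinP.
have F0 w : (0 <= F w)%E by rewrite lee_fin.
have -> : EFin \o v = fun t => (\int[mu]_x F (t, x))%E.
  by apply/funext => t; rewrite /F/= (hasint_int (fv t)).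
exact: (@measurable_fun_fubini_tonelli_F _ _ _ _ _ mu F mF F0).
Qed.

Definition window_mass M q (th : R * R) : R := \int[mu]_x (q x * window M th x).

Lemma window_le M th x : window M th x <= `|th.1^-1|.
Proof. by rewrite /window; do 4 (case: ifPn => // _); rewrite ler_norm. Qed.

Lemma window_mass_hasint q m C M th : log_density q m C ->
  hasint setT (fun x => q x * window M th x) (window_mass M q th).
Proof.
move=> [mq q0 q1 _ _].
have [|||w [hw _]] := dominated_hasint _ _ (hasintZ `|th.1^-1| measurableT q1)
  (f := fun x => q x * window M th x) => //.
- by apply: (meas_mul mq); apply: meas_window; meas.
- move=> x _; rewrite normrM (ger0_norm (q0 x)) (ger0_norm (window_ge0 _ _ _)) mulrC.
  exact: ler_wpM2r (q0 x) _ _ (window_le _ _ _).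
by rewrite /window_mass (hasint_Rint hw).
Qed.

Lemma window_mass_ge0 q m C M th : log_density q m C -> 0 <= window_mass M q th.
Proof.
move=> /[dup] -[_ q0 _ _ _] ld; apply: (hasint_ge0 (window_mass_hasint M th ld)) => x _.
exact: mulr_ge0 (q0 x) (window_ge0 _ _ _).
Qed.

Lemma meas_window_mass q m C M : log_density q m C -> measurable_fun setT (window_mass M q).
Proof.
move=> /[dup] -[mq q0 _ _ _] ld.
apply: (meas_param_integral (f := fun th x => q x * window M th x)).
- apply: meas_mul; first exact: (measurableT_comp mq measurable_snd).
  apply: meas_window; last exact: measurable_snd.
  + exact: (measurableT_comp measurable_fst measurable_fst).
  + exact: (measurableT_comp measurable_snd measurable_fst).
- move=> th x; exact: mulr_ge0 (q0 x) (window_ge0 _ _ _).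
- by move=> th; exact: window_mass_hasint ld.
Qed.

(** Away from 0 this is [ln v <= v - 1] with [v = |u| / M]. At [u = 0] the convention [ln 0 = 0]
    leaves [ln M - 1], which explains the bound [expR 1]. *)
Lemma logker_ge0 M u : expR 1 <= M -> 0 <= logker M u.
Proof.
move=> Me; have M0 : 0 < M by apply: lt_le_trans Me; exact: expR_gt0.
have lM : 1 <= ln M by rewrite -ler_expR lnK ?posrE.
rewrite /logker; case: ifPn => // uM.
have [->|u0] := eqVneq `|u| 0; first by rewrite (ln0 (lexx 0)) mul0r; lra.
have up : 0 < `|u| by rewrite lt_def u0 normr_ge0.
have := @le_ln1Dx _ (`|u| / M - 1); rewrite (addrC 1) subrK ln_div ?posrE// => h.
have t0 : 0 < `|u| / M by rewrite divr_gt0.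
by have := h ltac:(lra); lra.
Qed.

Lemma e_ge1 M : expR 1 <= M -> 1 <= M.
Proof. by apply: le_trans; rewrite -[leLHS]expR0 ler_expR. Qed.

Lemma meas_pot q m C : log_density q m C -> measurable_fun setT (pot q).
Proof.
move=> ld; case: (ld) => mq q0 q1 qm qL.
(* Measurability in the parameter comes from Tonelli, hence for nonnegative integrands; the
   logarithm is split into its two parts. *)
pose P x y := q y * Num.max 0 (ln `|x - y|).
pose N x y := q y * neglog (x - y).
have HN x : exists v, hasint setT (N x) v by have [v h _] := qL x; exists v.
have HP x : exists v, hasint setT (P x) v.
  have [v hv] := HN x; have [hp _] := log_density_pot ld x.
  exists (pot q x + v); apply: hasint_eq (hasintD measurableT hp hv) => // y _.
  rewrite /N /P /neglog -mulrDr; congr (_ * _).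
  by case: (leP 0 (ln `|x - y|)) => h; [rewrite max_l ?oppr_le0// addr0|rewrite max_r ?subrr// oppr_ge0 ltW].
have mm : measurable_fun setT (fun w : R * R => q w.2) by exact: (measurableT_comp mq measurable_snd).
have [fP hP] := choice HP; have [fN hN] := choice HN.
have mfP : measurable_fun setT fP.
  apply: (meas_param_integral (f := P)) => //.
  - by apply: (meas_mul mm); meas.
  - by move=> x y; apply: mulr_ge0; rewrite ?q0// le_max lexx.
have mfN : measurable_fun setT fN.
  apply: (meas_param_integral (f := N)) => //.
  - by apply: (meas_mul mm); apply: meas_neglog; meas.
  - by move=> x y; apply: mulr_ge0; rewrite ?q0 ?neglog_ge0.
have -> : pot q = (fun x => fP x - fN x); last exact: meas_sub.
apply/funext => x; have [hp _] := log_density_pot ld x.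
apply: (hasint_unique hp); apply: hasint_eq (hasintB measurableT (hP x) (hN x)) => // y _.
rewrite /N /P /neglog -mulrBr; congr (_ * _).
by case: (leP 0 (ln `|x - y|)) => h; [rewrite max_l ?oppr_le0// subr0|rewrite max_r ?opprK ?add0r// oppr_ge0 ltW].
Qed.

Definition mutual q p : R := \int[mu]_x (q x * pot p x).

Lemma mutual_hasint q p m1 C1 m2 C2 : log_density q m1 C1 -> log_density p m2 C2 ->
  hasint setT (fun x => q x * pot p x) (mutual q p).
Proof.
move=> [mq q0 q1 qm qL] ld.
have D := hasintD measurableT (hasintZ (C2 + m2) measurableT q1) qm.
have [|||w [hw _]] := dominated_hasint _ _ D (f := fun x => q x * pot p x) => //.
- by apply: (meas_mul mq); exact: meas_pot ld.
- move=> x _; rewrite normrM (ger0_norm (q0 x)).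
  have [_ h] := log_density_pot ld x.
  have := ler_wpM2l (q0 x) h; lra.
by rewrite /mutual (hasint_Rint hw).
Qed.

Definition logpot M p x : R := \int[mu]_y (p y * logker M (x - y)).

Lemma logpot_hasint p m C M x : expR 1 <= M -> log_density p m C ->
  hasint setT (fun y => p y * logker M (x - y)) (logpot M p x) /\
  `|logpot M p x - (ln M - 1 - pot p x)| <= (`|x| + m) / M.
Proof.
move=> Me ld; have M1 := e_ge1 Me; have M0 : 0 < M by lra.
case: (ld) => mp p0 p1 pm pL; have [hp _] := log_density_pot ld x.
have D := hasintZ M^-1 measurableT (hasintD measurableT (hasintZ `|x| measurableT p1) pm).
have [|||w [hw wm]] := dominated_hasint _ _ D
  (f := fun y => p y * (ln `|x - y| - ln M + 1 + logker M (x - y))) => //.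
- by apply: (meas_mul mp); apply: meas_add; [meas|apply: meas_logker; meas].
- move=> y _; rewrite normrM (ger0_norm (p0 y)).
  have h := logker_approx (x - y) M1.
  have h2 : `|x - y| / M <= M^-1 * (`|x| + `|y|).
    by rewrite mulrC ler_wpM2l ?invr_ge0 ?(ltW M0)// ler_normB.
  have := ler_wpM2l (p0 y) (le_trans h h2); lra.
have H := hasintD measurableT (hasintB measurableT (hasintZ (ln M - 1) measurableT p1) hp) hw.
have {}H : hasint setT (fun y => p y * logker M (x - y)) ((ln M - 1) * 1 - pot p x + w).
  by apply: hasint_eq H => // y _; ring.
rewrite /logpot (hasint_Rint H); split => //.
rewrite (_ : _ - _ = w); first by ring.
by move: wm; rewrite mulr1 mulrC.
Qed.

Lemma meas_logpot p m C M : expR 1 <= M -> log_density p m C -> measurable_fun setT (logpot M p).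
Proof.
move=> Me ld; case: (ld) => mp p0 p1 pm pL.
apply: (@meas_param_integral _ (measurableTypeR R) (fun x y => p y * logker M (x - y))).
- apply: meas_mul; first exact: (measurableT_comp mp measurable_snd).
  by apply: meas_logker; meas.
- by move=> x y; apply: mulr_ge0; rewrite ?p0 ?logker_ge0.
- by move=> x; have [] := logpot_hasint x Me ld.
Qed.

Lemma logmutual_hasint q p m1 C1 m2 C2 M : expR 1 <= M ->
  log_density q m1 C1 -> log_density p m2 C2 ->
  exists2 K, hasint setT (fun x => q x * logpot M p x) K &
    `|K - (ln M - 1 - mutual q p)| <= (m1 + m2) / M.
Proof.
move=> Me lq lp; have M1 := e_ge1 Me; have M0 : 0 < M by lra.
case: (lq) => mq q0 q1 qm _; have hm := mutual_hasint lq lp.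
have D := hasintZ M^-1 measurableT (hasintD measurableT qm (hasintZ m2 measurableT q1)).
have [|||w [hw wm]] := dominated_hasint _ _ D
  (f := fun x => q x * (logpot M p x - (ln M - 1 - pot p x))) => //.
- apply: (meas_mul mq); apply: meas_sub; first exact: meas_logpot Me lp.
  by apply: meas_sub; [meas|exact: meas_pot lp].
- move=> x _; rewrite normrM (ger0_norm (q0 x)).
  have [_ h] := logpot_hasint x Me lp.
  have := ler_wpM2l (q0 x) h; lra.
have H := hasintD measurableT (hasintB measurableT (hasintZ (ln M - 1) measurableT q1) hm) hw.
exists ((ln M - 1) * 1 - mutual q p + w).
  by apply: hasint_eq H => // y _; ring.
rewrite (_ : _ - _ = w); first by ring.
by move: wm; rewrite mulr1 mulrC.
Qed.

Lemma window_mass_product q p m1 C1 m2 C2 M K : expR 1 <= M ->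
  log_density q m1 C1 -> log_density p m2 C2 ->
  hasint setT (fun x => q x * logpot M p x) K ->
  (\int[mu2]_th (window_mass M q th * window_mass M p th)%:E = K%:E)%E.
Proof.
move=> Me lq lp hK; have M1 := e_ge1 Me.
case: (lq) => mq q0 q1 qm _; case: (lp) => mp p0 p1 pm _.
have T := @tonelli_square R M q p (window_mass M q) (window_mass M p) mq mp q0 p0
  (fun th => hasint_int (window_mass_hasint M th lq)) (fun th => hasint_int (window_mass_hasint M th lp)).
apply: etrans; first by apply/esym; exact: T.
rewrite -(hasint_int hK); apply: eq_integral => x _.
have [hx _] := logpot_hasint x Me lp.
have hx2 := hasintZ (q x) measurableT hx.
rewrite -(hasint_int hx2).
pose F y := (\int[mu2]_th (window M th x * window M th y)%:E)%E.
have mF : measurable_fun setT F.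
  apply: (@measurable_fun_fubini_tonelli_F _ _ _ _ _ mu2
    (fun w : R * (R * R) => (window M w.2 x * window M w.2 w.1)%:E)).
    have m21 : measurable_fun setT (fun w : R * (R * R) => w.2.1).
      exact: (measurableT_comp measurable_fst measurable_snd).
    have m22 : measurable_fun setT (fun w : R * (R * R) => w.2.2).
      exact: (measurableT_comp measurable_snd measurable_snd).
    by apply/measurable_EFinP; apply: meas_mul; apply: meas_window => //; meas.
  by move=> w; rewrite lee_fin; exact: mulr_ge0 (window_ge0 _ _ _) (window_ge0 _ _ _).
apply: (@ae_eq_integral _ _ _ mu setT _ (fun y => ((q x * p y)%:E * F y)%E)) => //.
- apply: emeasurable_funM => //; apply/measurable_EFinP.
  by apply: meas_mul; meas.
- by have /integrableP[] := hasint_integrable hx2.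
(* On the diagonal [y = x] the integral over windows diverges while [logker] takes a default value;
   this is one point for each [x]. *)
exists [set x]; split; [exact: measurable_set1|exact: lebesgue_measure_set1|].
move=> y /= h; apply: contrapT => yx; apply: h => _.
have nxy : x != y by apply/eqP => /esym.
have -> : F y = (logker M (x - y))%:E by exact: (window_integral M1 nxy).
by rewrite -EFinM mulrA.
Qed.

(** Expanding the square gives three energies of the truncated kernel. As both masses are 1, the
    constants [ln M - 1] enter with coefficients 1, 1 and [- 2] and cancel; the errors are at most
    [2 m1], [2 m2] and twice [m1 + m2], all over [M]. *)
Lemma window_mass_square q p m1 C1 m2 C2 M : expR 1 <= M ->
  log_density q m1 C1 -> log_density p m2 C2 ->
  exists2 e : R, (\int[mu2]_th ((window_mass M q th - window_mass M p th) ^+ 2)%:E =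
    (2 * mutual q p - mutual q q - mutual p p + e)%:E)%E &
  `|e| <= 4 * (m1 + m2) / M.
Proof.
move=> Me lq lp.
have [Kqq hqq eqq] := logmutual_hasint Me lq lq.
have [Kpp hpp epp] := logmutual_hasint Me lp lp.
have [Kqp hqp eqp] := logmutual_hasint Me lq lp.
have Iqq := window_mass_product Me lq lq hqq.
have Ipp := window_mass_product Me lp lp hpp.
have Iqp := window_mass_product Me lq lp hqp.
have mwq := meas_window_mass M lq; have mwp := meas_window_mass M lp.
pose I := (\int[mu2]_th ((window_mass M q th - window_mass M p th) ^+ 2)%:E)%E.
have mfg (f g : R * R -> R) : measurable_fun setT f -> measurable_fun setT g ->
    measurable_fun setT (fun th => (f th * g th)%:E).
  by move=> mf mg; apply/measurable_EFinP; exact: meas_mul.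
have z2 (a b : R) : 0 <= a -> 0 <= b -> (0 <= (a * b)%:E)%E by move=> ? ?; rewrite lee_fin mulr_ge0.
have wq th := window_mass_ge0 M th lq; have wp th := window_mass_ge0 M th lp.
have mI : measurable_fun setT (fun th => ((window_mass M q th - window_mass M p th) ^+ 2)%:E).
  by apply/measurable_EFinP; under eq_fun do rewrite expr2; apply: meas_mul; exact: meas_sub.
have E : (I + (Kqp%:E + Kqp%:E) = Kqq%:E + Kpp%:E)%E.
  rewrite -Iqq -Ipp -Iqp /I.
  rewrite -(@ge0_integralD _ _ R mu2 setT measurableT _ _ (fun th _ => z2 _ _ (wq th) (wp th)) (mfg _ _ mwq mwp) (fun th _ => z2 _ _ (wq th) (wp th)) (mfg _ _ mwq mwp)).
  rewrite -(@ge0_integralD _ _ R mu2 setT measurableT _ _ (fun th _ => z2 _ _ (wq th) (wq th)) (mfg _ _ mwq mwq) (fun th _ => z2 _ _ (wp th) (wp th)) (mfg _ _ mwp mwp)).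
  rewrite -(@ge0_integralD _ _ R mu2 setT measurableT).
  - by move=> th _; rewrite lee_fin sqr_ge0.
  - exact: mI.
  - by move=> th _; apply: adde_ge0; exact: z2.
  - by apply: emeasurable_funD; exact: mfg.
  by apply: eq_integral => th _; rewrite -!EFinD; congr EFin; ring.
move: (mutual q p) (mutual q q) (mutual p p) eqq epp eqp => Dqp Dqq Dpp eqq epp eqp.
have {}E : I = (Kqq + Kpp - 2 * Kqp)%:E.
  case: {mI}I E => [i||] //; rewrite -!EFinD => -[E].
  by rewrite (_ : i = Kqq + Kpp - 2 * Kqp) //; clear -E; lra.
exists (Kqq + Kpp - 2 * Kqp - (2 * Dqp - Dqq - Dpp)).
  by rewrite -/I E (addrC (2 * Dqp - Dqq - Dpp)) subrK.
clear -eqq epp eqp; move: eqq epp eqp; rewrite !ler_norml.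
rewrite (_ : 4 * _ / M = (m1 + m1) / M + (m2 + m2) / M + 2 * ((m1 + m2) / M)); first by ring.
lra.
Qed.

End windows.

(** * Sign of the quadratic form and the case of equality *)

Section strict_concavity.
Context {R : realType}.
Local Notation mu := (@lebesgue_measure R).
Local Notation mu2 := (@lebesgue_square R).
Implicit Types (q p : R -> R) (m C M : R).

Lemma window_mass_mono q M M' th : M <= M' ->
  window_mass M q th = if th.1 <= M then window_mass M' q th else 0.
Proof.
move=> MM; case: ifPn => h.
  rewrite /window_mass; apply: eq_Rintegral => x _; congr (_ * _).
  by rewrite /window h (le_trans h MM).
rewrite /window_mass (_ : (fun x => _) = fun=> 0); last by rewrite Rintegral_cst// mul0r.
by apply/funext => x; rewrite /window (negbTE h); case: ifP; rewrite mulr0.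
Qed.

(** Raising [M] only adds windows longer than before, so the integral at level [e] is at most the
    one at level [M], whose distance to the right-hand side tends to 0. *)
Lemma window_mass_square_le q p m1 C1 m2 C2 :
  log_density q m1 C1 -> log_density p m2 C2 ->
  (0 <= \int[mu2]_th ((window_mass (expR 1) q th - window_mass (expR 1) p th) ^+ 2)%:E <=
    (2 * mutual q p - mutual q q - mutual p p)%:E)%E.
Proof.
move=> lq lp; apply/andP; split.
  by apply: integral_ge0 => th _; rewrite lee_fin sqr_ge0.
have mono M : expR 1 <= M ->
  (\int[mu2]_th ((window_mass (expR 1) q th - window_mass (expR 1) p th) ^+ 2)%:E <=
   \int[mu2]_th ((window_mass M q th - window_mass M p th) ^+ 2)%:E)%E.
  move=> Me.
  have ms M' : measurable_fun setT (fun th => ((window_mass M' q th - window_mass M' p th) ^+ 2)%:E).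
    apply/measurable_EFinP; under eq_fun do rewrite expr2.
    by apply: meas_mul; apply: meas_sub; [exact: meas_window_mass lq|exact: meas_window_mass lp|exact: meas_window_mass lq|exact: meas_window_mass lp].
  apply: (@ge0_le_integral _ _ _ mu2 setT measurableT).
  - by move=> th _; rewrite lee_fin sqr_ge0.
  - exact: ms.
  - exact: ms.
  - move=> th _; rewrite lee_fin !(window_mass_mono _ _ Me); case: ifP => _ //.
    by rewrite subrr expr0n sqr_ge0.
suff key (N : R) : (forall M, expR 1 <= M -> exists2 e : R,
    (\int[mu2]_th ((window_mass M q th - window_mass M p th) ^+ 2)%:E = (N + e)%:E)%E &
    `|e| <= 4 * (m1 + m2) / M) ->
  (\int[mu2]_th ((window_mass (expR 1) q th - window_mass (expR 1) p th) ^+ 2)%:E <= N%:E)%E.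
  by apply: key => M Me; exact: window_mass_square Me lq lp.
move=> ws; have [e0 I0 _] := ws _ (lexx (expR 1)).
rewrite I0 lee_fin.
rewrite leNgt; apply/negP => lt.
have d0 : 0 < e0 by lra.
pose c := 4 * (m1 + m2).
(* Chosen so that the error at level [M] is at most [e0 / 2], contradicting the excess [e0] already
   present at level [e]. *)
pose M := Num.max (expR 1) (2 * c / e0).
have Me : expR 1 <= M by rewrite le_max lexx.
have M0 : 0 < M by apply: lt_le_trans Me; exact: expR_gt0.
have Mc : 2 * c / e0 <= M by rewrite le_max lexx orbT.
have [e I1 he] := ws _ Me.
have := mono M Me; rewrite I0 I1 lee_fin lerD2l => le.
have e2 : e <= c / M by rewrite (le_trans (ler_norm _)).
move: Mc; rewrite ler_pdivrMr// mulrC => Mc.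
have : c / M <= e0 / 2 by rewrite ler_pdivrMr// mulrAC ler_pdivlMr//; lra.
lra.
Qed.

(** Window masses become difference quotients of a primitive, the form needed for Lebesgue
    differentiation. *)
Lemma window_mass_primitive q p m1 C1 m2 C2 M h z :
  log_density q m1 C1 -> log_density p m2 C2 -> 0 < h -> h <= M ->
  let F x := \int[mu]_(t in `]-oo, x]) (q t - p t) in
  window_mass M q (h, z) - window_mass M p (h, z) = h^-1 * (F (z + h) - F z).
Proof.
move=> lq lp h0 hM F.
have [_ _ q1 _ _] := lq; have [_ _ p1 _ _] := lp.
have fT := hasintB measurableT q1 p1.
have iF x : hasint `]-oo, x] (fun t => q t - p t) (F x).
  by apply: integrable_hasint => //; apply: integrableS (hasint_integrable fT).
have iz : hasint `]z, (z + h)] (fun t => q t - p t) (\int[mu]_(t in `]z, (z + h)]) (q t - p t)).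
  by apply: integrable_hasint => //; apply: integrableS (hasint_integrable fT).
set v := (X in hasint _ _ X) in iz.
have U := hasint_setU (measurable_itv `]-oo, z]) (measurable_itv `]z, (z + h)]) _ (iF z) iz.
have Fv : F (z + h) = F z + v.
  apply: (hasint_unique (iF _)).
  have -> : `]-oo, (z + h)]%classic = `]-oo, z]%classic `|` `]z, (z + h)]%classic.
    by rewrite -itv_bndbnd_setU// bnd_simp lerDl ltW.
  apply: U; apply/disj_set2P; rewrite -subset0 => t [/=]; rewrite !in_itv/= => tz /andP[zt _].
  by move: tz; rewrite leNgt zt.
rewrite Fv addrAC subrr add0r.
have W := hasintB measurableT (window_mass_hasint M (h, z) lq) (window_mass_hasint M (h, z) lp).
have {}W : hasint setT (fun t => (q t - p t) * window M (h, z) t) (window_mass M q (h, z) - window_mass M p (h, z)).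
  by apply: hasint_eq W => // t _; ring.
have PE t : window M (h, z) t = if (z <= t) && (t <= z + h) then h^-1 else 0.
  by rewrite /window/= (ltW h0) hM; case: ifP.
have {}W : hasint `[z, z + h] (fun t => (q t - p t) * window M (h, z) t) (window_mass M q (h, z) - window_mass M p (h, z)).
  apply/hasintT_restrict => // t /= /negP; rewrite in_itv/= PE => /negbTE ->.
  by rewrite mulr0.
have {}W : hasint `]z, z + h] (fun t => (q t - p t) * window M (h, z) t) (window_mass M q (h, z) - window_mass M p (h, z)).
  by apply/hasint_oo; move/hasint_oo : W.
apply: (hasint_unique W); apply: hasint_eq (hasintZ h^-1 _ iz) => // t /=.
by rewrite in_itv/= PE => /andP[/ltW -> ->]/=; rewrite mulrC.
Qed.

Lemma mutual_le q p m1 C1 m2 C2 :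
  log_density q m1 C1 -> log_density p m2 C2 ->
  mutual q q - 2 * mutual q p + mutual p p <= 0.
Proof.
move=> lq lp; have /andP[h1 h2] := window_mass_square_le lq lp.
move: (mutual q q) (mutual q p) (mutual p p) (le_trans h1 h2) => x y z.
by rewrite lee_fin; lra.
Qed.

(** The squared difference of window masses has integral 0. By Tonelli, for almost every [z] the
    difference quotients of the primitive of [q - p] at [z] vanish for almost every small [h], and
    for almost every [z] they converge to [q z - p z]. *)
Lemma mutual_eq q p m1 C1 m2 C2 :
  log_density q m1 C1 -> log_density p m2 C2 ->
  0 <= mutual q q - 2 * mutual q p + mutual p p -> ae_eq mu setT q p.
Proof.
move=> lq lp m0; have e0 := expR_gt0 (1 : R).
have [mq q0 q1 _ _] := lq; have [mp p0 p1 _ _] := lp.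
have /andP[h1 h2] := window_mass_square_le lq lp.
pose f (th : R * R) := ((window_mass (expR 1) q th - window_mass (expR 1) p th) ^+ 2)%:E.
have I0 : (\int[mu2]_th f th = 0)%E.
  apply/le_anti; rewrite h1 andbT (le_trans h2)// lee_fin.
  by move: (mutual q q) (mutual q p) (mutual p p) m0 => x y z; lra.
have mf : measurable_fun setT f.
  apply/measurable_EFinP; under eq_fun do rewrite expr2.
  by apply: meas_mul; apply: meas_sub; [exact: meas_window_mass lq|exact: meas_window_mass lp|exact: meas_window_mass lq|exact: meas_window_mass lp].
have f0 th : (0 <= f th)%E by rewrite lee_fin sqr_ge0.
pose g z := (\int[mu]_h f (h, z))%E.
have I1 : (\int[mu]_z g z = 0)%E.
  by rewrite -I0; apply/esym; exact: (@fubini_tonelli2 _ _ _ _ _ mu mu f mf f0).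
have mg : measurable_fun setT g by exact: (@measurable_fun_fubini_tonelli_G _ _ _ _ _ mu f mf f0).
have g0 z : (0 <= g z)%E by exact: integral_ge0.
have ag : ae_eq mu setT g (cst 0%E).
  apply/(@ae_eq_integral_abs _ _ _ mu setT measurableT) => //.
  by under eq_integral do rewrite gee0_abs//.
pose d x := q x - p x.
have dT : hasint setT d (1 - 1) by exact: hasintB.
have iN (y : R) : mu.-integrable `]-oo, y] (EFin \o d).
  by apply: integrableS (hasint_integrable dT).
have loc : locally_integrable [set: R] d.
  apply: (@open_integrable_locally _ [set: R]) => //; first exact: openT.
  exact: hasint_integrable dT.
pose F (x : R) : R := \int[mu]_(t in `]-oo, x]) d t.
have aF : {ae mu, forall x, derivable F x 1 /\ derive1 F x = d x} := FTC1Ny iN loc.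
move: aF ag; apply: (@filterS2 _ _ (ae_filter_ringOfSetsType mu)) => z [dF F'] gz _.
apply/eqP; rewrite -subr_eq0; apply/negP => /negP dz0.
have gz0 : (\int[mu]_h f (h, z) = 0)%E by exact: gz.
have mfz : measurable_fun setT (fun h => f (h, z)) by apply: measurableT_comp.
have [N [mN N0 sub]] : ae_eq mu setT (fun h => f (h, z)) (cst 0%E).
  apply/(@ae_eq_integral_abs _ _ _ mu setT measurableT) => //.
  by under eq_integral do rewrite gee0_abs//.
have dpos : 0 < `|d z| by rewrite normr_gt0.
have /cvgrPdist_lt/(_ _ dpos) : (h^-1 *: (F (h *: 1 + z) - F z) @[h --> 0^']) --> d z.
  by rewrite -F' derive1E.
move=> /nbhs_ballP[del /= del0 H].
pose u := Num.min del (expR 1).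
have u0 : 0 < u by rewrite lt_min del0.
pose J : set R := `]0, u[%classic.
(* If [d z] were not 0, every quotient with [0 < h < u] would be nonzero, and the interval [J] would
   lie in the null set [N]. *)
have : (mu J <= mu N)%E.
  apply: le_measure; rewrite ?inE; [exact: measurable_itv|exact: mN|] => h; rewrite /J /= in_itv/= => /andP[h0 hu].
  apply: sub => /= /(_ I) []; move: hu; rewrite lt_min => /andP[hdel he].
  move/eqP; rewrite sqrf_eq0 (window_mass_primitive _ lq lp h0 (ltW he)) => /eqP E.
  have := H h; rewrite /ball/= sub0r normrN gtr0_norm// => /(_ hdel).
  rewrite /GRing.scale/= mulr1 (addrC h) E subr0 ltxx => k.
  by have := k (lt0r_neq0 h0).
by rewrite N0 /J lebesgue_measure_itv/= lte_fin u0 lee_fin leNgt subr0 u0.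
Qed.

End strict_concavity.

(** * Solvability of the equations for the endpoints *)

Section pointwise_continuity.
Context {R : realType}.
Implicit Types (f g : R -> R) (x : R).

Lemma cts_cst (c : R) x : {for x, continuous (fun=> c)}.
Proof. exact: cst_continuous. Qed.

Lemma cts_id x : {for x, continuous (fun y : R => y)}.
Proof. exact: cvg_id. Qed.

Lemma cts_add f g x : {for x, continuous f} -> {for x, continuous g} ->
  {for x, continuous (fun y => f y + g y)}.
Proof. by move=> cf cg; exact: cvgD. Qed.

Lemma cts_sub f g x : {for x, continuous f} -> {for x, continuous g} ->
  {for x, continuous (fun y => f y - g y)}.
Proof. by move=> cf cg; exact: cvgB. Qed.

Lemma cts_mul f g x : {for x, continuous f} -> {for x, continuous g} ->
  {for x, continuous (fun y => f y * g y)}.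
Proof. by move=> cf cg; exact: cvgM. Qed.

Lemma cts_inv f x : f x != 0 -> {for x, continuous f} ->
  {for x, continuous (fun y => (f y)^-1)}.
Proof. by move=> f0 cf; exact: cvgV. Qed.

Lemma cts_sqrt f x : {for x, continuous f} -> {for x, continuous (fun y => Num.sqrt (f y))}.
Proof. by move=> cf; apply: (continuous_comp cf); exact: sqrt_continuous. Qed.

Lemma cts_ln f x : 0 < f x -> {for x, continuous f} -> {for x, continuous (fun y => ln (f y))}.
Proof. by move=> f0 cf; apply: (continuous_comp cf); exact: continuous_ln. Qed.

End pointwise_continuity.

Section endpoints.
Context {R : realType}.
Local Notation mu := (@lebesgue_measure R).
Variables gam rho : R.
Hypotheses (gam0 : 0 < gam) (rho0 : 0 < rho).
Implicit Types g : R.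

(* Eliminating [k] from the two equations for the endpoints determines
   [S = sqrt ((1 + rho a) (1 + rho b))] as a function of [g = sqrt (a b)], and
   [S ^ 2 = 1 + 2 rho s + rho ^ 2 g ^ 2] then gives [s = (a + b) / 2]. *)
Definition sol_S g : R := 1 - gam / g +
  Num.sqrt ((gam / g) * (gam / g) + rho * rho * (g * g) + 2 * rho * (gam + 2)).
Definition sol_s g : R := (sol_S g * sol_S g - 1 - rho * rho * (g * g)) / (2 * rho).
Definition sol_d g : R := Num.sqrt (sol_s g * sol_s g - g * g).
Definition sol_a g : R := sol_s g - sol_d g.
Definition sol_b g : R := sol_s g + sol_d g.
Definition sol_k g : R := sol_S g * (1 - gam / g) / rho.

Let rhon0 : rho != 0. Proof. by rewrite gt_eqF. Qed.

(** This says [sqrt (a b) < (a + b) / 2], that is [a < b]. The radicand exceeds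
    [(gam / g + rho g) ^ 2] by exactly [4 rho]. *)
Lemma sol_S_gt g : 0 < g -> 1 + rho * g < sol_S g.
Proof.
move=> g0; have r0 := rho0; have ga0 := gam0.
have c0 : 0 < gam / g by rewrite divr_gt0.
have cg : gam / g * g = gam by rewrite divfK// gt_eqF.
have rg : 0 < rho * g by rewrite mulr_gt0.
rewrite /sol_S; move: (gam / g) c0 cg => c c0 cg.
suff : c + rho * g < Num.sqrt (c * c + rho * rho * (g * g) + 2 * rho * (gam + 2)) by lra.
rewrite -(@ltr_pXn2r _ 2) ?nnegrE ?sqrtr_ge0//; first lra.
rewrite sqr_sqrtr; first by rewrite -cg !addr_ge0 ?mulr_ge0 ?addr_ge0 ?mulr_ge0// ?ltW.
rewrite -cg -subr_gt0 (_ : _ - _ = 4 * rho); first by ring.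
lra.
Qed.

Lemma sol_s_gt g : 0 < g -> g < sol_s g.
Proof.
move=> g0; have r0 := rho0; have := sol_S_gt g0; rewrite /sol_s; move: (sol_S g) => S S1.
rewrite ltr_pdivlMr; first lra.
have rg : 0 < rho * g by rewrite mulr_gt0.
have : (1 + rho * g) * (1 + rho * g) < S * S by rewrite ltr_pM//; lra.
rewrite (_ : rho * rho * (g * g) = rho * g * (rho * g)); first by ring.
lra.
Qed.

Lemma sol_facts g : 0 < g ->
  [/\ 0 < sol_a g, sol_a g < sol_b g, sol_a g * sol_b g = g ^+ 2,
    (1 + rho * sol_a g) * (1 + rho * sol_b g) = sol_S g ^+ 2 & 0 < sol_S g].
Proof.
move=> g0; have r0 := rho0; have sg := sol_s_gt g0; have S1 := sol_S_gt g0.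
have rg : 0 < rho * g by rewrite mulr_gt0.
have d2 : sol_d g * sol_d g = sol_s g * sol_s g - g * g.
  by rewrite -expr2 sqr_sqrtr// subr_ge0 ler_pM// ltW.
have d0 : 0 < sol_d g by rewrite sqrtr_gt0 subr_gt0 ltr_pM// ltW.
have ab : sol_a g * sol_b g = g ^+ 2 by rewrite /sol_a /sol_b expr2; lra.
have b0 : 0 < sol_b g by rewrite /sol_b; lra.
have rs : 2 * rho * sol_s g = sol_S g * sol_S g - 1 - rho * rho * (g * g).
  by rewrite /sol_s mulrC divfK// mulf_neq0// pnatr_eq0.
split => //.
- by rewrite -(pmulr_lgt0 _ b0) ab exprn_gt0.
- by rewrite /sol_a /sol_b; lra.
- rewrite (_ : _ * _ = 1 + rho * (sol_a g + sol_b g) + rho * rho * (sol_a g * sol_b g)); first by ring.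
  rewrite ab (_ : sol_a g + sol_b g = 2 * sol_s g); first by rewrite /sol_a /sol_b; ring.
  by rewrite !expr2; lra.
- by lra.
Qed.

Lemma sol_eqs g : 0 < g ->
  let S := Num.sqrt ((1 + rho * sol_a g) * (1 + rho * sol_b g)) in
  [/\ Num.sqrt (sol_a g * sol_b g) = g,
    sol_k g * rho / S + gam / Num.sqrt (sol_a g * sol_b g) = 1 &
    (sol_a g + sol_b g - 2 * sol_k g - 2 * gam) / 4 + sol_k g / (2 * S) = 1].
Proof.
move=> g0 S; have [a0 ab abE SE S0] := sol_facts g0.
have gE : Num.sqrt (sol_a g * sol_b g) = g by rewrite abE sqrtr_sqr gtr0_norm.
have SS : S = sol_S g by rewrite /S SE sqrtr_sqr gtr0_norm.
rewrite gE SS; split => //.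
  rewrite /sol_k; move: (sol_S g) S0 => S' S'0; move: rho0 g0 => r0 g0'.
  by field; rewrite !gt_eqF.
rewrite (_ : sol_a g + sol_b g = 2 * sol_s g); first by rewrite /sol_a /sol_b; ring.
have E : sol_k g / (2 * sol_S g) = (1 - gam / g) / (2 * rho).
  rewrite /sol_k; move: (sol_S g) S0 => S' S'0; move: rho0 g0 => r0 g0'.
  by field; rewrite !gt_eqF.
rewrite E /sol_k /sol_s.
(* This is the second endpoint equation with [k] and [s] eliminated, after completing the square in
   [S]; [sol_S] is its larger root. *)
have Q : (sol_S g - (1 - gam / g)) * (sol_S g - (1 - gam / g)) =
    (gam / g) * (gam / g) + rho * rho * (g * g) + 2 * rho * (gam + 2).
  rewrite /sol_S (addrC (1 - _)) addrK -expr2 sqr_sqrtr//.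
  have r0 := rho0; have ga0 := gam0.
  by rewrite !addr_ge0 ?mulr_ge0 ?addr_ge0 ?invr_ge0// ltW.
move: (gam / g) (sol_S g) Q => c S' Q.
have Q2 : S' * S' = 2 * S' * (1 - c) - (1 - c) * (1 - c) + (c * c + rho * rho * (g * g) + 2 * rho * (gam + 2)).
  by rewrite -Q; ring.
by rewrite Q2; move: rhon0 => r0; field.
Qed.

Lemma sol_cts g : 0 < g ->
  {for g, continuous sol_a} /\ {for g, continuous sol_b}.
Proof.
move=> g0; have gn : g != 0 by rewrite gt_eqF.
have ci := @cts_id R g; have c2 := cts_mul ci ci.
have cc := cts_mul (@cts_cst R gam g) (@cts_inv R id g gn ci).
have cr := cts_mul (@cts_cst R (rho * rho) g) c2.
have cS : {for g, continuous sol_S} := cts_add (cts_sub (@cts_cst R 1 g) cc)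
  (cts_sqrt (cts_add (cts_add (cts_mul cc cc) cr) (@cts_cst R (2 * rho * (gam + 2)) g))).
have cs : {for g, continuous sol_s} :=
  cts_mul (cts_sub (cts_sub (cts_mul cS cS) (@cts_cst R 1 g)) cr) (@cts_cst R (2 * rho)^-1 g).
have cd : {for g, continuous sol_d} := cts_sqrt (cts_sub (cts_mul cs cs) c2).
by split; [exact: cts_sub cs cd|exact: cts_add cs cd].
Qed.

Lemma sol_b_le g : 0 < g -> rho * sol_b g <= sol_S g * sol_S g - 1 - rho * rho * (g * g).
Proof.
move=> g0; have [a0 ab _ _ _] := sol_facts g0.
have : rho * sol_b g <= 2 * rho * sol_s g.
  by rewrite -mulrA mulrCA ler_pM2l ?rho0//; move: a0; rewrite /sol_a /sol_b; lra.
by move/le_trans; apply; rewrite /sol_s mulrC divfK// mulf_neq0// pnatr_eq0.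
Qed.

(** As [g] tends to 0, [gam / g] dominates the root: [sqrt (c ^ 2 + X) <= c + X / (2 c)] with
    [c = gam / g] gives [S <= 1 + X g / (2 gam)], where [X] uses [g <= 1]. The choice of [g] makes
    [S <= exp (y / 2)], and [1 + rho b <= S ^ 2]. *)
Lemma sol_small (y : R) : 0 < y -> exists2 g, 0 < g & ln (1 + rho * sol_b g) <= y.
Proof.
move=> y0; have r0 := rho0; have ga0 := gam0.
pose X := rho * rho + 2 * rho * (gam + 2).
have X0 : 0 < X by rewrite /X addr_gt0 ?mulr_gt0//; lra.
have E0 : 1 < expR (y / 2) by rewrite expR_gt1; lra.
pose g := Num.min 1 (2 * gam * (expR (y / 2) - 1) / X).
have g0 : 0 < g by rewrite lt_min ltr01 !mulr_gt0 ?invr_gt0//; lra.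
exists g => //.
have g1 : g <= 1 by rewrite ge_min lexx.
have gX : X * g <= 2 * gam * (expR (y / 2) - 1).
  by rewrite -ler_pdivlMl// mulrC ge_min lexx orbT.
have c0 : 0 < gam / g by rewrite divr_gt0.
have cg : gam / g * g = gam by rewrite divfK// gt_eqF.
have S_le : sol_S g <= expR (y / 2).
  rewrite /sol_S.
  have H : X * g / (2 * gam) <= expR (y / 2) - 1.
    by rewrite ler_pdivrMr ?mulr_gt0// [leRHS]mulrC.
  suff : Num.sqrt (gam / g * (gam / g) + rho * rho * (g * g) + 2 * rho * (gam + 2)) <=
      gam / g + X * g / (2 * gam) by lra.
  have Y0 : 0 <= X * g / (2 * gam) by rewrite divr_ge0 ?mulr_ge0// ltW.
  rewrite -(@ler_pXn2r _ 2) ?nnegrE ?sqrtr_ge0//; first by rewrite addr_ge0// ltW.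
  rewrite sqr_sqrtr; first by rewrite !addr_ge0 ?mulr_ge0 ?addr_ge0 ?invr_ge0// ltW.
  rewrite sqrrD -!expr2.
  have -> : gam / g * (X * g / (2 * gam)) *+ 2 = X.
    by rewrite -mulr_natr; field; rewrite !gt_eqF.
  rewrite /X; have : rho ^+ 2 * g ^+ 2 <= rho ^+ 2.
    by rewrite ler_piMr ?sqr_ge0// expr_le1// ltW.
  have := sqr_ge0 (X * g / (2 * gam)); rewrite /X !expr2; lra.
rewrite -ler_expR lnK; first by rewrite posrE; have [a0 ab _ _ _] := sol_facts g0; rewrite addr_gt0// mulr_gt0//; lra.
have -> : expR y = expR (y / 2) * expR (y / 2) by rewrite -expRD -splitr.
have [_ _ _ _ S0] := sol_facts g0.
have : sol_S g * sol_S g <= expR (y / 2) * expR (y / 2) by rewrite ler_pM// ltW.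
have := sol_b_le g0; have : 0 <= rho * rho * (g * g) by rewrite !mulr_ge0// ltW.
lra.
Qed.

(** For [g >= 1] one has [S <= rho g + K], hence [rho b <= g L]: [b] grows at most linearly. Since
    [a b = g ^ 2], [rho a] is at least [rho ^ 2 g / L], which is unbounded. *)
Lemma sol_large (y : R) : exists2 g, 0 < g & y <= ln (1 + rho * sol_a g).
Proof.
have r0 := rho0; have ga0 := gam0.
pose K := gam + 3; pose L := 2 * rho * K + K * K.
have K0 : 0 < K by rewrite /K; lra.
have L0 : 0 < L by rewrite /L addr_gt0 ?mulr_gt0//; lra.
pose g := Num.max 1 (expR y * L / (rho * rho)).
have g1 : 1 <= g by rewrite le_max lexx.
have gL : expR y * L <= g * (rho * rho) by rewrite -ler_pdivrMr ?mulr_gt0// le_max lexx orbT.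
have g0 : 0 < g by lra.
exists g => //; have [a0 ab abE _ S0] := sol_facts g0.
rewrite -ler_expR lnK; first by rewrite posrE addr_gt0// mulr_gt0.
have c0 : 0 < gam / g by rewrite divr_gt0.
have S_le : sol_S g <= rho * g + K.
  rewrite /sol_S /K.
  have H : (gam + 2) / g <= gam + 2 by rewrite ler_pdivrMr// ler_peMr//; lra.
  have H0 : 0 < (gam + 2) / g by rewrite divr_gt0//; lra.
  have rg : 0 < rho * g by rewrite mulr_gt0.
  suff : Num.sqrt (gam / g * (gam / g) + rho * rho * (g * g) + 2 * rho * (gam + 2)) <=
      gam / g + rho * g + (gam + 2) / g by lra.
  rewrite -(@ler_pXn2r _ 2) ?nnegrE ?sqrtr_ge0//; first lra.
  rewrite sqr_sqrtr; first by rewrite !addr_ge0 ?mulr_ge0 ?addr_ge0 ?invr_ge0// ltW.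
  have -> : 2 * rho * (gam + 2) = 2 * ((rho * g) * ((gam + 2) / g)) by field; rewrite gt_eqF.
  move: (gam / g) c0 => c c0; move: ((gam + 2) / g) H0 => e e0.
  have -> : rho * rho * (g * g) = (rho * g) * (rho * g) by ring.
  have h1 : 0 <= c * (rho * g) by rewrite mulr_ge0 ?ltW.
  have h2 : 0 <= c * e by rewrite mulr_ge0 ?ltW.
  have h3 : 0 <= e * e by rewrite mulr_ge0 ?ltW.
  by rewrite expr2; lra.
have bL : rho * sol_b g <= g * L.
  apply: (le_trans (sol_b_le g0)).
  have : sol_S g * sol_S g <= (rho * g + K) * (rho * g + K) by rewrite ler_pM// ltW.
  have : K * K * 1 <= K * K * g by rewrite ler_wpM2l// mulr_ge0// ltW.
  by rewrite /L; lra.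
have b0 : 0 < sol_b g by lra.
have h : expR y * (rho * sol_b g) <= rho * sol_a g * (rho * sol_b g).
  have -> : rho * sol_a g * (rho * sol_b g) = g * (g * (rho * rho)).
    by transitivity (rho * rho * (sol_a g * sol_b g)); [ring|rewrite abE expr2; ring].
  apply: (@le_trans _ _ (expR y * (g * L))); first by rewrite ler_wpM2l// expR_ge0.
  by rewrite mulrCA ler_wpM2l// ltW.
move: h; rewrite ler_pM2r ?mulr_gt0//; lra.
Qed.

End endpoints.

(** * Continuity of the constraint and the intermediate value argument *)

Section existence.
Context {R : realType}.
Local Notation mu := (@lebesgue_measure R).
Variables gam rho : R.
Hypotheses (gam0 : 0 < gam) (rho0 : 0 < rho).

Local Notation A := (sol_a gam rho).
Local Notation B := (sol_b gam rho).

(** The substitution [x = a + (b - a) t] moves the dependence on [g] from the interval into the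
    integrand, as dominated convergence requires. The factors are grouped so that each is bounded by
    itself; in particular [ln (1 + rho x) / x <= rho] avoids a lower bound on [a]. *)
Definition scaled_entropy (g t : R) : R :=
  let x := A g + (B g - A g) * t in
  (2 * pi)^-1 * Num.sqrt ((B g - x) * (x - A g)) *
  ((rho * x + gam / Num.sqrt (A g * B g)) / (1 + rho * x)) *
  (ln (1 + rho * x) / x) * (B g - A g).

Lemma opt_log_integrable g : 0 < g -> exists w,
  [/\ hasint `]A g, B g[ (fun x => opt_density (gam + 1) rho (A g) (B g) x * ln (1 + rho * x)) w,
    ln (1 + rho * A g) <= w <= ln (1 + rho * B g) &
    hasint `]0, 1[ (scaled_entropy g) w].
Proof.
move=> g0; have r0 := rho0; have ga0 := gam0.
have [a0 ab _ _ _] := sol_facts gam0 rho0 g0.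
have [_ e1 e2] := sol_eqs gam0 rho0 g0.
have mi := @measurable_itv R `]A g, B g[.
have mass := opt_mass gam0 rho0 a0 ab e1 e2.
have p0 y := opt_density_ge0 gam0 rho0 a0 ab y.
set p := opt_density _ _ _ _ in mass p0 *.
have mp : measurable_fun setT p by exact: meas_opt_density.
have mpl : measurable_fun setT (fun x => p x * ln (1 + rho * x)) by meas.
have lnle (x y : R) : 0 < x -> x <= y -> ln (1 + rho * x) <= ln (1 + rho * y).
  move=> x0 xy; have rx : 0 < rho * x by rewrite mulr_gt0.
  have rxy : rho * x <= rho * y by rewrite ler_pM2l.
  by rewrite ler_ln ?posrE; lra.
have l0 (x : R) : 0 < x -> 0 <= ln (1 + rho * x).
  by move=> x0; rewrite ln_ge0// lerDl mulr_ge0// ltW.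
have [|||w [hw _]] := dominated_hasint _ _ (hasintZ (ln (1 + rho * B g)) mi mass)
  (f := fun x => p x * ln (1 + rho * x)) => //.
- exact: measurable_funTS.
- move=> x /=; rewrite in_itv/= => /andP[ax xb]; have x0 : 0 < x by lra.
  rewrite ger0_norm; first by rewrite mulr_ge0 ?p0// l0.
  by rewrite mulrC ler_wpM2r ?p0// lnle// ltW.
exists w; split => //.
- apply/andP; split.
    have := hasint_le mi (hasintZ (ln (1 + rho * A g)) mi mass) hw; rewrite mulr1; apply.
    move=> x /=; rewrite in_itv/= => /andP[ax xb].
    by rewrite mulrC ler_wpM2l ?p0// lnle// ltW.
  have := hasint_le mi hw (hasintZ (ln (1 + rho * B g)) mi mass); rewrite mulr1; apply.
  move=> x /=; rewrite in_itv/= => /andP[ax xb]; have x0 : 0 < x by lra.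
  by rewrite mulrC ler_wpM2r ?p0// lnle// ltW.
have D0 : 0 < B g - A g by lra.
have := @hasint_affine R (A g) (B g - A g) 0 1 _ w mpl D0 ltr01.
rewrite mulr0 mulr1 addr0 addrC subrK => -[/(_ hw) + _].
apply: hasint_eq => // t /=; rewrite in_itv/= => /andP[t0 t1].
rewrite /scaled_entropy /p /opt_density addrK.
set x := A g + _.
have aDt : 0 < (B g - A g) * t by rewrite mulr_gt0.
have Dt1 : (B g - A g) * t <= B g - A g by rewrite ler_piMr// ltW.
have -> : (A g <= x <= B g) = true by rewrite /x; apply/andP; split; lra.
have x0 : 0 < x by rewrite /x; lra.
have rx : 0 < rho * x by rewrite mulr_gt0.
move: x x0 rx (A g) (B g) => x x0 rx a b.
by rewrite !invfM; ring.
Qed.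

Lemma sol_S_le u v g : 0 < u -> u < g -> g < v ->
  sol_S gam rho g <= 1 + Num.sqrt (gam / u * (gam / u) + rho * rho * (v * v) + 2 * rho * (gam + 2)).
Proof.
move=> u0 ug gv; have r0 := rho0; have ga0 := gam0.
have g0 : 0 < g by lra.
have c0 : 0 < gam / g by rewrite divr_gt0.
have cu : gam / g <= gam / u by rewrite ler_pM2l// lef_pV2 ?posrE// ltW.
apply: lerD; first lra.
rewrite ler_sqrt.
  by rewrite !addr_ge0 ?mulr_ge0 ?addr_ge0 ?invr_ge0// ltW//; lra.
have h1 : gam / g * (gam / g) <= gam / u * (gam / u) by rewrite ler_pM// ltW.
have h2 : rho * rho * (g * g) <= rho * rho * (v * v).
  by rewrite ler_pM2l ?mulr_gt0// ler_pM// ltW.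
lra.
Qed.

Lemma scaled_entropy_le u v g t : 0 < u -> u < g -> g < v -> 0 < t < 1 ->
  forall C, C = (1 + Num.sqrt (gam / u * (gam / u) + rho * rho * (v * v) + 2 * rho * (gam + 2))) ^+ 2 / rho ->
  `|scaled_entropy g t| <= C * (1 + gam / u) * rho * C.
Proof.
move=> u0 ug gv t01; move: (t01) => /andP[t0 t1]; move=> C CE; have r0 := rho0; have ga0 := gam0.
have g0 : 0 < g by lra.
have [a0 ab _ _ S0] := sol_facts gam0 rho0 g0.
have [gE _ _] := sol_eqs gam0 rho0 g0.
have BC : B g <= C.
  rewrite CE ler_pdivlMr// mulrC; apply: (le_trans (sol_b_le gam0 rho0 g0)).
  have := sol_S_le u0 ug gv => SL.
  have := ler_pM (ltW S0) (ltW S0) SL SL.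
  have : 0 <= rho * rho * (g * g) by rewrite !mulr_ge0// ltW.
  by rewrite expr2; lra.
have cu : gam / g <= gam / u by rewrite ler_pM2l// lef_pV2 ?posrE// ltW.
have c0 : 0 < gam / g by rewrite divr_gt0.
rewrite /scaled_entropy gE.
have aDt : 0 < (B g - A g) * t by rewrite mulr_gt0// subr_gt0.
have Dt1 : (B g - A g) * t < B g - A g by rewrite gtr_pMr// subr_gt0.
set x := A g + _.
have ax : A g < x by rewrite /x; lra.
have xb : x < B g by rewrite /x; lra.
clearbody x; have x0 : 0 < x by lra.
have rx : 0 < rho * x by rewrite mulr_gt0.
have F1 : 0 <= (2 * (pi : R))^-1 <= 1.
  have pi2 := pi_ge2 R; have h : 1 <= 2 * (pi : R) by lra.
  by rewrite invr_ge0 (le_trans ler01 h)/= invf_le1// (lt_le_trans ltr01).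
have F2 : 0 <= Num.sqrt ((B g - x) * (x - A g)) <= C.
  rewrite sqrtr_ge0/= -(@ler_pXn2r _ 2) ?nnegrE ?sqrtr_ge0//; first lra.
  rewrite sqr_sqrtr; first by rewrite mulr_ge0//; lra.
  by rewrite expr2 ler_pM//; lra.
have F3 : 0 <= (rho * x + gam / g) / (1 + rho * x) <= 1 + gam / u.
  rewrite divr_ge0/=; [lra|lra|].
  rewrite ler_pdivrMr; first lra.
  have : 0 <= gam / u * (rho * x) by rewrite mulr_ge0//; lra.
  lra.
have F4 : 0 <= ln (1 + rho * x) / x <= rho.
  rewrite divr_ge0 ?ln_ge0/=; [lra|lra|lra|].
  by rewrite ler_pdivrMr// le_ln1Dx//; lra.
have F5 : 0 <= B g - A g <= C by apply/andP; split; lra.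
move: F1 F2 F3 F4 F5 => /andP[p1 q1] /andP[p2 q2] /andP[p3 q3] /andP[p4 q4] /andP[p5 q5].
have h2 := ler_pM p1 p2 q1 q2; have h3 := ler_pM (mulr_ge0 p1 p2) p3 h2 q3.
have h4 := ler_pM (mulr_ge0 (mulr_ge0 p1 p2) p3) p4 h3 q4.
have h5 := ler_pM (mulr_ge0 (mulr_ge0 (mulr_ge0 p1 p2) p3) p4) p5 h4 q5.
have p := mulr_ge0 (mulr_ge0 (mulr_ge0 (mulr_ge0 p1 p2) p3) p4) p5.
by rewrite mul1r in h5; rewrite (ger0_norm p).
Qed.

Lemma scaled_entropy_cts g t : 0 < g -> 0 < t < 1 -> {for g, continuous (scaled_entropy ^~ t)}.
Proof.
move=> g0 /andP[t0 t1]; have r0 := rho0; have ga0 := gam0.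
have [cA cB] := sol_cts gam rho g0.
have [a0 ab _ _ S0] := sol_facts gam0 rho0 g0.
have [gE _ _] := sol_eqs gam0 rho0 g0.
have aDt : 0 < (B g - A g) * t by rewrite mulr_gt0// subr_gt0.
have x0 : 0 < A g + (B g - A g) * t by lra.
have rx : 0 < rho * (A g + (B g - A g) * t) by rewrite mulr_gt0.
have s0 : Num.sqrt (A g * B g) != 0 by rewrite gE gt_eqF.
have rx0 : 0 < 1 + rho * (A g + (B g - A g) * t) by lra.
pose X y := A y + (B y - A y) * t; pose X1 y := 1 + rho * X y.
have cx := cts_add cA (cts_mul (cts_sub cB cA) (@cts_cst R t g)).
have crx := cts_mul (@cts_cst R rho g) cx.
have c1 := cts_add (@cts_cst R 1 g) crx.
have cc := cts_mul (@cts_cst R gam g) (@cts_inv R (fun y => Num.sqrt (A y * B y)) g s0 (cts_sqrt (cts_mul cA cB))).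
have f1 := cts_mul (@cts_cst R (2 * pi)^-1 g) (cts_sqrt (cts_mul (cts_sub cB cx) (cts_sub cx cA))).
have f2 := cts_mul (cts_add crx cc) (@cts_inv R X1 g (lt0r_neq0 rx0) c1).
have f3 := cts_mul (@cts_ln R X1 g rx0 c1) (@cts_inv R X g (lt0r_neq0 x0) cx).
exact: cts_mul (cts_mul (cts_mul f1 f2) f3) (cts_sub cB cA).
Qed.

Lemma scaled_entropy_integral_cts g : 0 < g ->
  {for g, continuous (fun g => \int[mu]_(t in `]0, 1[) scaled_entropy g t)}.
Proof.
move=> g0; pose u := g / 2; pose v := g * 2.
have u0 : 0 < u by rewrite /u; lra.
pose C := (1 + Num.sqrt (gam / u * (gam / u) + rho * rho * (v * v) + 2 * rho * (gam + 2))) ^+ 2 / rho.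
have cint : hasint `]0, 1[ (fun=> C * (1 + gam / u) * rho * C) (C * (1 + gam / u) * rho * C * 1 - C * (1 + gam / u) * rho * C * 0).
  apply/(@hasint_oo _ _ _ _ _ true false).
  apply: (@hasint_FTC R _ _ (fun x => C * (1 + gam / u) * rho * C * x)) => [|x _|x _]; first lra.
    by der; rewrite /=; ring.
  exact: cst_continuous.
have := @continuity_under_integral R _ _ mu scaled_entropy `]0, 1[ (measurable_itv _) u v.
move=> /(_ _ _ _ (hasint_integrable cint)); apply.
- move=> y; rewrite /= in_itv/= => /andP[uy yv].
  have y0 : 0 < y by lra.
  have [w [_ _ h]] := opt_log_integrable y0; exact: hasint_integrable h.
- apply: aeW => t; rewrite /= in_itv/= => t01 y; rewrite inE/= in_itv/= => /andP[uy yv].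
  apply: scaled_entropy_cts => //; lra.
- move=> y; rewrite /= in_itv/= => /andP[uy yv].
  by apply: aeW => t; rewrite /= in_itv/= => t01; exact: (scaled_entropy_le u0 uy yv t01 erefl).
- by rewrite inE/= in_itv/= /u /v; apply/andP; split; lra.
Qed.

Lemma exists_solution (r : R) : 0 < r -> exists k a b,
  let S := Num.sqrt ((1 + rho * a) * (1 + rho * b)) in
  [/\ 0 < a, a < b, k * rho / S + gam / Num.sqrt (a * b) = 1,
    (a + b - 2 * k - 2 * gam) / 4 + k / (2 * S) = 1 &
    hasint `]a, b[ (fun x => opt_density (gam + 1) rho a b x * ln (1 + rho * x)) r].
Proof.
move=> r_gt0; have [g1 g10 h1] := sol_small gam0 rho0 r_gt0.
have [g2 g20 h2] := sol_large gam0 rho0 r.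
pose F g := \int[mu]_(t in `]0, 1[) scaled_entropy g t.
have FE g : 0 < g -> hasint `]A g, B g[
    (fun x => opt_density (gam + 1) rho (A g) (B g) x * ln (1 + rho * x)) (F g) /\
    ln (1 + rho * A g) <= F g <= ln (1 + rho * B g).
  by move=> g0; have [w [hw wb hF]] := opt_log_integrable g0; rewrite /F (hasint_Rint hF).
have F1 : F g1 <= r by have [_ /andP[_ h]] := FE _ g10; exact: le_trans h1.
have F2 : r <= F g2 by have [_ /andP[h _]] := FE _ g20; exact: le_trans h.
have cF (x y : R) : 0 < x -> {within `[x, y], continuous F}.
  move=> x0; apply: for_within => z /=; rewrite in_itv/= => /andP[xz _].
  by apply: scaled_entropy_integral_cts; lra.
have [g g0 Fg] : exists2 g, 0 < g & F g = r.
  (* Nothing orders [g1] and [g2], so the intermediate value theorem is applied on whichever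
     interval they span. *)
  have [le|/ltW le] := leP g1 g2.
    have [|g] := IVT le (cF _ _ g10) (v := r).
      by rewrite ge_min F1 le_max F2 orbT.
    by rewrite in_itv/= => /andP[h _] Fg; exists g => //; lra.
  have [|g] := IVT le (cF _ _ g20) (v := r).
    by rewrite ge_min F1 orbT le_max F2.
  by rewrite in_itv/= => /andP[h _] Fg; exists g => //; lra.
have [a0 ab _ _ _] := sol_facts gam0 rho0 g0.
have [_ e1 e2] := sol_eqs gam0 rho0 g0.
exists (sol_k gam rho g), (A g), (B g); split => //.
by rewrite -Fg; have [] := FE _ g0.
Qed.

End existence.

(** * Value of the minimum *)

Section reference_integral.
Context {R : realType}.
Local Notation mu := (@lebesgue_measure R).

(** The singularity at [t = 0], present when [x0 = 0], is absorbed by the root: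
    [- ln (sqrt t) <= 1 / sqrt t] gives [sqrt t * (- ln t) <= 2]. *)
Lemma sqrt_ln_le (x0 t : R) : 0 <= x0 -> 0 < t < 1 ->
  `|Num.sqrt (t * (1 - t)) * ln (t + x0)| <= 3 + x0.
Proof.
move=> x00 /andP[t0 t1]; have s0 : 0 < Num.sqrt t by rewrite sqrtr_gt0.
have s1 : Num.sqrt t <= 1 by rewrite -sqrtr1 ler_sqrt// ltW.
have w1 : Num.sqrt (1 - t) <= 1 by rewrite -[leRHS]sqrtr1 ler_sqrt//; lra.
have w0 := sqrtr_ge0 (1 - t).
have ss : Num.sqrt t ^+ 2 = t by rewrite sqr_sqrtr// ltW.
have l1 : ln t <= ln (t + x0) by rewrite ler_ln ?posrE; lra.
have l2 : ln (t + x0) <= 1 + x0 by apply: (le_trans (ln_le_id _)); lra.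
have lt : ln t = 2 * ln (Num.sqrt t) by rewrite -{1}ss lnXn// mulr_natl.
have l3 : - ln (Num.sqrt t) <= (Num.sqrt t)^-1.
  by rewrite -lnV ?posrE// ln_le_id// invr_gt0.
have sl : Num.sqrt t * - ln (Num.sqrt t) <= 1.
  have := ler_wpM2l (ltW s0) l3; by rewrite divff// gt_eqF.
rewrite sqrtrM; first exact: ltW.
rewrite -mulrA mulrCA normrM (ger0_norm w0) -[leRHS]mul1r; apply: ler_pM => //.
rewrite ler_norml; apply/andP; split.
  have := ler_wpM2l (ltW s0) l1; rewrite lt; lra.
have := ler_wpM2l (ltW s0) l2.
have : Num.sqrt t * (1 + x0) <= 1 * (1 + x0) by rewrite ler_wpM2r//; lra.
lra.
Qed.

Lemma G_hasint (x0 y : R) : 0 <= x0 -> 0 < y ->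
  hasint `]0, 1[ (fun t => Num.sqrt (t * (1 - t)) * (ln (t + x0) / (t + y))) (pi * G x0 y).
Proof.
move=> x00 y0; pose c := (3 + x0) / y.
have mi := @measurable_itv R `]0, 1[.
have cint : hasint `]0, 1[ (fun=> c) (c * 1 - c * 0).
  apply/(@hasint_oo _ _ _ _ _ true false).
  apply: (@hasint_FTC R _ _ (fun x => c * x)) => [|x _|x _]; first lra.
    by der; rewrite /=; ring.
  exact: cst_continuous.
have [|||w [hw _]] := dominated_hasint _ _ cint
  (f := fun t => Num.sqrt (t * (1 - t)) * (ln (t + x0) / (t + y))) => //.
- by apply: measurable_funTS; meas.
- move=> t; rewrite /= in_itv/= => t01; rewrite mulrA normrM.
  apply: ler_pM => //; first exact: sqrt_ln_le.
  case/andP: t01 => t0 t1; rewrite ger0_norm; first by rewrite invr_ge0; lra.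
  by rewrite lef_pV2 ?posrE; lra.
rewrite /G mulrA divff ?mul1r; first by rewrite gt_eqF// pi_gt0.
have h : hasint `[0, 1] (fun t => Num.sqrt (t * (1 - t)) * (ln (t + x0) / (t + y))) w.
  exact/(@hasint_oo _ _ _ _ _ true false).
by rewrite (hasint_Rint h).
Qed.

End reference_integral.

Section optimal_value.
Context {R : realType}.
Local Notation mu := (@lebesgue_measure R).
Variables (gam rho k a b : R).
Local Notation S := (Num.sqrt ((1 + rho * a) * (1 + rho * b))).
Hypotheses (gam0 : 0 < gam) (rho0 : 0 < rho) (a0 : 0 < a) (ab : a < b).
Hypothesis eq1 : k * rho / S + gam / Num.sqrt (a * b) = 1.
Hypothesis eq2 : (a + b - 2 * k - 2 * gam) / 4 + k / (2 * S) = 1.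
Local Notation p := (opt_density (gam + 1) rho a b).
Local Notation D := (b - a).

(** This is where [G] comes from. With [c = gam / sqrt (a b)], the rational factor is
    [c / y + (1 - c) rho / (1 + rho y)], and [y = a + D t] turns the denominators into multiples of
    [t + a / D] and [t + (1 + rho a) / (D rho)]. The value [x0 = 0] serves the potential at [a], and
    [x0 = a / D] the mean of [ln y]. *)
Lemma opt_log_moment x0 : 0 <= x0 ->
  hasint `]a, b[ (fun y => p y * ln ((y - a) / D + x0))
    (D / 2 * ((1 - k * rho / S) * G x0 (a / D) + k * rho / S * G x0 ((1 + rho * a) / (D * rho)))).
Proof.
move=> x00; have r0 := rho0; have a0' := a0; have D0 : 0 < D by rewrite subr_gt0.
have Y0 : 0 < (1 + rho * a) / (D * rho) by rewrite divr_gt0 ?mulr_gt0// addr_gt0// mulr_gt0.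
have X0 : 0 < a / D by rewrite divr_gt0.
have mp : measurable_fun setT p by exact: meas_opt_density.
have mpl : measurable_fun setT (fun y => p y * ln ((y - a) / D + x0)) by meas.
have := hasint_affine a _ mpl D0 ltr01; rewrite mulr0 mulr1 addr0 addrC subrK => E.
apply/E; have mi := @measurable_itv R `]0, 1[.
have c0E : gam / Num.sqrt (a * b) = 1 - k * rho / S by have := eq1; lra.
have h1 := hasintZ (1 - k * rho / S) mi (G_hasint x00 X0).
have h2 := hasintZ (k * rho / S) mi (G_hasint x00 Y0).
have h := hasintZ (D / (2 * pi)) mi (hasintD mi h1 h2).
have pi0 := pi_gt0 R.
rewrite (_ : D / 2 * _ = D / (2 * pi) * ((1 - k * rho / S) * (pi * G x0 (a / D)) +
    k * rho / S * (pi * G x0 ((1 + rho * a) / (D * rho))))).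
  by move: (G x0 _) (G x0 _) (k * rho / S) (pi : R) pi0 => G1 G2 c P P0; field; rewrite gt_eqF.
apply: hasint_eq h => // t /=; rewrite in_itv/= => /andP[t0 t1].
rewrite /opt_density addrK c0E; set c := k * rho / S.
have Dt0 : 0 < D * t by rewrite mulr_gt0.
have Dt1 : D * t < D by rewrite gtr_pMr.
have -> : (a <= a + D * t <= b) = true by apply/andP; split; lra.
have -> : (a + D * t - a) / D = t.
  by rewrite (addrC a) addrK mulrAC divff ?mul1r// gt_eqF.
have -> : (b - (a + D * t)) * (a + D * t - a) = D ^+ 2 * (t * (1 - t)) by ring.
have -> : Num.sqrt (D ^+ 2 * (t * (1 - t))) = D * Num.sqrt (t * (1 - t)).
  by rewrite (sqrtrM _ (sqr_ge0 D)) sqrtr_sqr gtr0_norm.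
have xr : 0 < 1 + rho * (a + D * t) by rewrite addr_gt0// mulr_gt0//; lra.
have xp : 0 < a + D * t by lra.
have -> : t + a / D = (a + D * t) / D by field; rewrite gt_eqF.
have -> : t + (1 + rho * a) / (D * rho) = (1 + rho * (a + D * t)) / (D * rho).
  by field; rewrite !gt_eqF.
move: (a + D * t) xr xp => X xr xp; move: D D0 (Num.sqrt _) (ln _) => d d0 s l.
clearbody c; move: (pi : R) pi0 r0 => P P0 r0.
by field; rewrite !gt_eqF.
Qed.

Lemma opt_bounded : exists2 B, 0 <= B & forall y, p y <= B.
Proof.
have r0 := rho0; have a0' := a0; have ab' := ab; have ga0 := gam0.
have b0 : 0 < b by lra.
have g0 : 0 < Num.sqrt (a * b) by rewrite sqrtr_gt0 mulr_gt0.
have c0 : 0 < gam / Num.sqrt (a * b) by rewrite divr_gt0.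
have rb : 0 < rho * b by rewrite mulr_gt0.
exists (b / a * (rho * b + gam / Num.sqrt (a * b))).
  by rewrite mulr_ge0 ?divr_ge0//; lra.
move=> y; rewrite /opt_density; case: ifPn => [/andP[ay yb]|_]; last first.
  by rewrite mulr_ge0 ?divr_ge0//; lra.
have y0 : 0 < y by lra.
have ry : 0 < rho * y by rewrite mulr_gt0.
have ryb : rho * y <= rho * b by rewrite ler_pM2l.
have P1 : 0 <= (2 * (pi : R))^-1 <= 1.
  have pi2 := pi_ge2 R; have h : 1 <= 2 * (pi : R) by lra.
  by rewrite invr_ge0 (le_trans ler01 h)/= invf_le1// (lt_le_trans ltr01).
have P2 : 0 <= Num.sqrt ((b - y) * (y - a)) <= b.
  rewrite sqrtr_ge0/= -(@ler_pXn2r _ 2) ?nnegrE ?sqrtr_ge0//; first lra.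
  rewrite sqr_sqrtr; first by rewrite mulr_ge0//; lra.
  by rewrite expr2 ler_pM//; lra.
have P3 : 0 <= (y * (1 + rho * y))^-1 <= a^-1.
  have h : a <= y * (1 + rho * y) by rewrite mulrDr mulr1 -[leLHS]addr0 lerD// mulr_ge0; lra.
  rewrite invr_ge0 lef_pV2 ?posrE// ?h ?andbT; lra.
move: P1 P2 P3 => /andP[p1 q1] /andP[p2 q2] /andP[p3 q3].
have h1 := ler_pM p2 p3 q2 q3.
have h2 := ler_pM p1 (mulr_ge0 p2 p3) q1 h1; rewrite mul1r in h2.
have p4 : 0 <= rho * y + (gam + 1 - 1) / Num.sqrt (a * b) by rewrite addrK; lra.
apply: (ler_pM (mulr_ge0 p1 (mulr_ge0 p2 p3)) p4 h2).
by rewrite addrK; lra.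
Qed.

Lemma opt_whole H v : hasint `]a, b[ (fun y => p y * H y) v ->
  hasint setT (fun y => p y * H y) v.
Proof.
move=> h; apply/(@hasintT_restrict _ `]a, b[) => //.
by move=> y yo; rewrite opt_density_out// mul0r.
Qed.

Lemma opt_mass_whole : hasint setT p 1.
Proof.
have h : hasint `]a, b[ (fun y => p y * 1) 1.
  by apply: hasint_eq (opt_mass gam0 rho0 a0 ab eq1 eq2) => // y _; rewrite mulr1.
by apply: hasint_eq (opt_whole h) => // y _; rewrite mulr1.
Qed.

Lemma opt_square : exists M, hasint setT (fun y => p y `^ (1 + 1)) M.
Proof.
have [B B0 pB] := opt_bounded; have p0 y := opt_density_ge0 gam0 rho0 a0 ab y.
have mp : measurable_fun setT p by exact: meas_opt_density.
have [|||M [hM _]] := dominated_hasint _ _ (hasintZ B measurableT opt_mass_whole)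
  (f := fun y => p y `^ (1 + 1)) => //; last by exists M.
- exact: meas_powR.
- move=> y _; rewrite ger0_norm ?powR_ge0// -[1 + 1]/(2%:R) powR_mulrn// expr2.
  by rewrite ler_wpM2r.
Qed.

Lemma opt_mean_whole : hasint setT (fun y => p y * y)
  ((b - a) ^+ 2 / 16 + k / (2 * rho) * (1 - (1 + rho * ((a + b) / 2)) / S)).
Proof. by apply: opt_whole; exact: opt_mean. Qed.

Lemma opt_log_density : exists m C, log_density p m C.
Proof.
have [M hM] := opt_square; have p0 y := opt_density_ge0 gam0 rho0 a0 ab y.
exists ((b - a) ^+ 2 / 16 + k / (2 * rho) * (1 - (1 + rho * ((a + b) / 2)) / S)).
apply: (log_densityI _ p0 opt_mass_whole _ ltr01 hM); first exact: meas_opt_density.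
apply: hasint_eq opt_mean_whole => // y _.
have [yi|/opt_density_out->] := pselect (`]a, b[%classic y); last by rewrite mul0r mulr0.
move: yi; rewrite /= in_itv/= => /andP[ay _]; rewrite gtr0_norm ?(lt_trans _ ay)// mulrC//.
Qed.

Lemma opt_pot_left : pot p a = ln D +
  D / 2 * ((1 - k * rho / S) * G 0 (a / D) + k * rho / S * G 0 ((1 + rho * a) / (D * rho))).
Proof.
have D0 : 0 < D by rewrite subr_gt0.
have mi := @measurable_itv R `]a, b[.
have h := hasintD mi (hasintZ (ln D) mi (opt_mass gam0 rho0 a0 ab eq1 eq2)) (opt_log_moment (lexx 0)).
rewrite mulr1 in h; apply: hasint_Rint; apply: opt_whole; apply: hasint_eq h => // y.
rewrite /= in_itv/= => /andP[ay yb]; have ya : 0 < y - a by rewrite subr_gt0.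
by rewrite addr0 ln_div ?posrE// distrC gtr0_norm//; ring.
Qed.

Lemma opt_ln : hasint setT (fun y => p y * ln y) (ln D +
  D / 2 * ((1 - k * rho / S) * G (a / D) (a / D) + k * rho / S * G (a / D) ((1 + rho * a) / (D * rho)))).
Proof.
have D0 : 0 < D by rewrite subr_gt0.
have X0 : 0 < a / D by rewrite divr_gt0.
have mi := @measurable_itv R `]a, b[.
have h := hasintD mi (hasintZ (ln D) mi (opt_mass gam0 rho0 a0 ab eq1 eq2)) (opt_log_moment (ltW X0)).
rewrite mulr1 in h; apply: opt_whole; apply: hasint_eq h => // y.
rewrite /= in_itv/= => /andP[ay yb]; have y0 : 0 < y by rewrite (lt_trans _ ay).
by rewrite -mulrDl subrK ln_div ?posrE//; ring.
Qed.

(** The Euler-Lagrange constant is computed twice: by integrating the identity against [p], which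
    brings in [mutual p p], and by evaluating it at [x = a], which brings in only single integrals.
    Equating the two gives the double integral. *)
Lemma opt_energy r : hasint setT (fun y => p y * ln (1 + rho * y)) r ->
  let X := D ^+ 2 / 16 + k / (2 * rho) * (1 - (1 + rho * ((a + b) / 2)) / S) in
  let L := ln D + D / 2 * ((1 - k * rho / S) * G (a / D) (a / D) +
    k * rho / S * G (a / D) ((1 + rho * a) / (D * rho))) in
  X - gam * L - mutual p p =
      D ^+ 2 / 32 + a / 2 - ln D - gam / 2 * ln (a * D)
       + k / 2 * (r - ln (1 + rho * a)
                  - (Num.sqrt (1 + rho * b) - Num.sqrt (1 + rho * a)) ^+ 2
                    / (4 * rho * S))
       - D * k * rho / (2 * S)
         * (G 0 ((1 + rho * a) / (D * rho))
            + gam / 2 * G (a / D) ((1 + rho * a) / (D * rho)))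
       - D / 2 * (1 - k * rho / S)
         * (G 0 (a / D) + gam / 2 * G (a / D) (a / D)).
Proof.
move=> hr X L.
have r0 := rho0; have a0' := a0; have ab' := ab.
have D0 : 0 < D by rewrite subr_gt0.
have [m [C ld]] := opt_log_density.
have hm := mutual_hasint ld ld.
have h := hasintB measurableT (hasintB measurableT (hasintB measurableT opt_mean_whole (hasintZ gam measurableT opt_ln))
  (hasintZ k measurableT hr)) (hasintZ 2 measurableT hm).
have hc := hasintZ (euler_lagrange_cst gam rho k a b) measurableT opt_mass_whole.
rewrite mulr1 in hc.
have EL : X - gam * L - k * r - 2 * mutual p p = euler_lagrange_cst gam rho k a b.
  apply: hasint_unique hc; apply: hasint_eq h => // y _.
  have [yi|/opt_density_out->] := pselect (`]a, b[%classic y); last by rewrite !(mul0r, mulr0, subr0).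
  move: yi; rewrite /= in_itv/= => /andP[ay yb].
  rewrite -(euler_lagrange_eq gam0 rho0 a0 ab eq1 eq2 (x := y)); first by rewrite !ltW.
  ring.
have ELa : euler_lagrange_cst gam rho k a b = a - gam * ln a - k * ln (1 + rho * a) - 2 * pot p a.
  by rewrite (euler_lagrange_eq gam0 rho0 a0 ab eq1 eq2 (x := a))// lexx ltW.
rewrite opt_pot_left in ELa.
have xa : 0 < 1 + rho * a by rewrite addr_gt0// mulr_gt0.
have xb : 0 < 1 + rho * b by rewrite addr_gt0// mulr_gt0//; lra.
have sq : (Num.sqrt (1 + rho * b) - Num.sqrt (1 + rho * a)) ^+ 2 =
    (1 + rho * b) + (1 + rho * a) - 2 * S.
  have sb : Num.sqrt (1 + rho * b) ^+ 2 = 1 + rho * b by rewrite sqr_sqrtr// ltW.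
  have sa : Num.sqrt (1 + rho * a) ^+ 2 = 1 + rho * a by rewrite sqr_sqrtr// ltW.
  by rewrite (sqrtrM _ (ltW xa)) -[X in X + _ - _]sb -[X in _ + X - _]sa; ring.
have SP : 0 < S by rewrite sqrtr_gt0 mulr_gt0.
have laD : ln (a * D) = ln a + ln D by rewrite lnM ?posrE.
rewrite sq laD.
have -> : mutual p p = (X - gam * L - k * r - (a - gam * ln a - k * ln (1 + rho * a) - 2 * (ln D +
  D / 2 * ((1 - k * rho / S) * G 0 (a / D) + k * rho / S * G 0 ((1 + rho * a) / (D * rho)))))) / 2.
  by rewrite -ELa -EL; field.
rewrite /X /L.
move: S SP => s s0; move: (G _ _) (G _ _) (G _ _) (G _ _) (ln _) (ln _) (ln _) => G1 G2 G3 G4 l1 l2 l3.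
by field; rewrite !gt_eqF.
Qed.

End optimal_value.

(** * From competitors on the half-line to densities on the line *)

Section half_line_densities.
Context {R : realType}.
Local Notation mu := (@lebesgue_measure R).
Implicit Types (q : R -> R).

(* The value at [x = 0] is set to 0 because the Euler-Lagrange inequality is
   available only for [0 < x]. *)
Definition hpart q (x : R) : R := if x <= 0 then 0 else Num.max 0 (q x).

Lemma hpart_ge0 q x : 0 <= hpart q x.
Proof. by rewrite /hpart; case: ifP => // _; rewrite le_max lexx. Qed.

Lemma hpart_out q x : x <= 0 -> hpart q x = 0.
Proof. by rewrite /hpart => ->. Qed.

Let mRp : measurable (@Rplus R). Proof. exact: measurable_itv. Qed.

Lemma meas_hpart q : measurable_fun (@Rplus R) q -> measurable_fun setT (hpart q).
Proof.
move=> mq; have mr : measurable_fun setT (q \_ (@Rplus R)).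
  by apply/measurable_restrict => //; rewrite setTI.
have -> : hpart q = fun x => if x <= 0 then 0 else Num.max 0 ((q \_ (@Rplus R)) x).
  apply/funext => x; rewrite /hpart; case: ifPn => //; rewrite -ltNge => x0.
  by rewrite patchE mem_set//; rewrite /Rplus /= in_itv/= andbT ltW.
by apply: meas_ifle; meas.
Qed.

Lemma hpart_ae q : {ae mu, forall x, (@Rplus R) x -> 0 <= q x} -> ae_eq mu (@Rplus R) q (hpart q).
Proof.
have n0 : {ae mu, forall x : R, x != 0}.
  exists [set 0]; split; [exact: measurable_set1|exact: lebesgue_measure_set1|].
  by move=> x /=; apply: contra_notP => /eqP.
apply: (@filterS2 _ _ (ae_filter_ringOfSetsType mu)) n0 => x x0 q0 xp.
rewrite /hpart leNgt lt_def x0 /= max_r ?q0//.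
by move: xp; rewrite /Rplus /= in_itv/= andbT => ->.
Qed.

Lemma hpart_integral q (F : R -> R -> R) :
  {ae mu, forall x, (@Rplus R) x -> 0 <= q x} ->
  measurable_fun (@Rplus R) (fun x => F (q x) x) ->
  measurable_fun setT (fun x => F (hpart q x) x) -> (forall x, F 0 x = 0) ->
  (\int[mu]_(x in (@Rplus R)) (F (q x) x)%:E = \int[mu]_x (F (hpart q x) x)%:E)%E.
Proof.
move=> q0 m1 m2 F0.
transitivity (\int[mu]_(x in (@Rplus R)) (F (hpart q x) x)%:E)%E.
  apply: (@ae_eq_integral _ _ _ mu _ _ _ mRp).
  - exact/measurable_EFinP.
  - by apply/measurable_EFinP; exact: measurable_funTS.
  move: (hpart_ae q0); apply: (@filterS _ _ (ae_filter_ringOfSetsType mu)) => x h xp.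
  by rewrite /= -h.
rewrite integral_mkcond; apply: eq_integral => x _; rewrite patchE; case: ifPn => // /negP.
rewrite inE /Rplus /= in_itv/= andbT => /negP; rewrite -ltNge => x0.
by rewrite hpart_out ?F0// ltW.
Qed.

Lemma ge0_finite_hasint (f : R -> R) : measurable_fun setT f -> (forall x, 0 <= f x) ->
  (\int[mu]_x (f x)%:E < +oo)%E -> exists v, hasint setT f v.
Proof.
move=> mf f0 foo; exists (fine (\int[mu]_x (f x)%:E)); apply: ge0_hasint => //.
by rewrite fineK// ge0_fin_numE// integral_ge0// => x _; rewrite lee_fin.
Qed.

Lemma pdf_log_density q : pdf_space q -> exists m C, log_density (hpart q) m C.
Proof.
move=> [[iq q1oo [eps eps0 qeps]] q0 q1].
have mq : measurable_fun (@Rplus R) q by apply/measurable_EFinP; have /integrableP[] := iq.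
have mh := meas_hpart mq; have h0 := hpart_ge0 q.
have mid : measurable_fun (@Rplus R) (fun x : R => x) by apply: measurable_funTS; exact: measurable_id.
have H1 : hasint setT (hpart q) 1.
  apply: ge0_hasint => //; rewrite -q1.
  by rewrite -(@hpart_integral q (fun v _ => v)).
have [|||m Hm] := @ge0_finite_hasint (fun y => `|y| * hpart q y).
- by meas.
- by move=> y; rewrite mulr_ge0.
- suff <- : (\int[mu]_(x in (@Rplus R)) (x * `|q x|)%:E = \int[mu]_x (`|x| * hpart q x)%:E)%E by [].
  rewrite (@hpart_integral q (fun v x => x * `|v|) q0).
  + by apply: meas_mul => //; exact: meas_norm.
  + by meas.
  + by move=> x; rewrite normr0 mulr0.
  apply: eq_integral => x _; have [x0|x0] := leP x 0.
    by rewrite hpart_out// normr0 !mulr0.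
  by rewrite (gtr0_norm x0) ger0_norm.
have [|||M HM] := @ge0_finite_hasint (fun y => hpart q y `^ (1 + eps)).
- exact: meas_powR.
- by move=> y; exact: powR_ge0.
- suff <- : (\int[mu]_(x in (@Rplus R)) (`|q x| `^ (1 + eps))%:E = \int[mu]_x (hpart q x `^ (1 + eps))%:E)%E by [].
  rewrite (@hpart_integral q (fun v x => `|v| `^ (1 + eps)) q0).
  + by apply: meas_powR; exact: meas_norm.
  + by apply: meas_powR; exact: meas_norm.
  + by move=> x; rewrite normr0 powR0// gt_eqF// addr_gt0.
  by apply: eq_integral => x _; rewrite ger0_norm.
have [C ld] := log_densityI mh h0 H1 Hm eps0 HM.
by exists m, C.
Qed.

(** For a density vanishing on [x <= 0] the mean of [ln x] is the potential at the origin, so all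
    three terms are finite and [energy] is a real number. *)
Lemma energyE beta q m C : pdf_space q -> log_density (hpart q) m C ->
  energy beta q = (m - (beta - 1) * pot (hpart q) 0 - mutual (hpart q) (hpart q))%:E.
Proof.
move=> [[iq _ _] q0 _] ld; case: (ld) => mh h0 _ Hm _.
have mq : measurable_fun (@Rplus R) q by apply/measurable_EFinP; have /integrableP[] := iq.
have mln : measurable_fun (@Rplus R) (@ln R) by apply: measurable_funTS; exact: measurable_ln.
have mid : measurable_fun (@Rplus R) (fun x : R => x) by apply: measurable_funTS; exact: measurable_id.
have mpot := meas_pot ld.
have potP := log_density_pot ld.
rewrite /energy (@hpart_integral q (fun v x => x * v))//.
- exact: meas_mul.
- by meas.
- by move=> x; rewrite mulr0.
rewrite (@hpart_integral q (fun v x => v * ln x))//.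
- exact: meas_mul.
- by meas.
- by move=> x; rewrite mul0r.
have -> : (\int[mu]_(y in (@Rplus R)) \int[mu]_(x in (@Rplus R)) (q x * q y * ln `|x - y|)%:E =
    \int[mu]_(y in (@Rplus R)) (q y * pot (hpart q) y)%:E)%E.
  apply: eq_integral => y _.
  rewrite (@hpart_integral q (fun v x => v * q y * ln `|x - y|))//.
  - apply: meas_mul; first by apply: meas_mul => //; exact: meas_cst.
    by apply: measurable_funTS; meas.
  - by meas.
  - by move=> x; rewrite !mul0r.
  have [h _] := potP y.
  rewrite -(hasint_int (hasintZ (q y) measurableT h)); apply: eq_integral => x _.
  by rewrite distrC; congr EFin; ring.
rewrite (@hpart_integral q (fun v x => v * pot (hpart q) x))//.
- by apply: meas_mul => //; exact: measurable_funTS.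
- exact: meas_mul.
- by move=> x; rewrite mul0r.
rewrite (hasint_int (mutual_hasint ld ld)).
have [h _] := potP 0.
have -> : (\int[mu]_x (hpart q x * ln x)%:E = (pot (hpart q) 0)%:E)%E.
  rewrite -(hasint_int h); apply: eq_integral => x _; rewrite sub0r normrN.
  by have [x0|x0] := leP x 0; [rewrite hpart_out// !mul0r|rewrite gtr0_norm].
have -> : (\int[mu]_x (x * hpart q x)%:E = m%:E)%E.
  rewrite -(hasint_int Hm); apply: eq_integral => x _.
  by have [x0|x0] := leP x 0; [rewrite hpart_out// !mulr0|rewrite gtr0_norm].
by rewrite -EFinM -!EFinB.
Qed.

Lemma hpart_constraint rho r q : 0 < rho -> constrained_space rho r q ->
  hasint setT (fun x => hpart q x * ln (1 + rho * x)) r.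
Proof.
move=> rho0 [[[iq _ _] q0 _] qr].
have mq : measurable_fun (@Rplus R) q by apply/measurable_EFinP; have /integrableP[] := iq.
have mh := meas_hpart mq.
apply: ge0_hasint.
- by meas.
- move=> x _; have [x0|x0] := leP x 0; first by rewrite hpart_out// mul0r.
  by rewrite mulr_ge0 ?hpart_ge0// ln_ge0// lerDl mulr_ge0// ltW.
rewrite -qr (@hpart_integral q (fun v x => v * ln (1 + rho * x)))//.
- by apply: meas_mul => //; apply: measurable_funTS; meas.
- by meas.
- by move=> x; rewrite mul0r.
Qed.

End half_line_densities.

(** * Comparison with an arbitrary competitor *)

Section minimization.
Context {R : realType}.
Local Notation mu := (@lebesgue_measure R).
Variables (gam rho k a b r : R).
Local Notation S := (Num.sqrt ((1 + rho * a) * (1 + rho * b))).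
Hypotheses (gam0 : 0 < gam) (rho0 : 0 < rho) (a0 : 0 < a) (ab : a < b).
Hypothesis eq1 : k * rho / S + gam / Num.sqrt (a * b) = 1.
Hypothesis eq2 : (a + b - 2 * k - 2 * gam) / 4 + k / (2 * S) = 1.
Local Notation p := (opt_density (gam + 1) rho a b).
Hypothesis hr : hasint `]a, b[ (fun x => p x * ln (1 + rho * x)) r.

Lemma opt_hpart : hpart p = p.
Proof.
apply/funext => x; rewrite /hpart; case: ifPn => x0.
  by rewrite opt_density_out//= in_itv/= => /andP[ax _]; have := lt_trans a0 ax; rewrite ltNge x0.
by rewrite max_r// (opt_density_ge0 gam0 rho0).
Qed.

Lemma opt_Rplus f v : (forall x, p x = 0 -> f x = 0) -> hasint setT f v -> hasint (@Rplus R) f v.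
Proof.
move=> f0; apply: (@hasintT_restrict _ (@Rplus R) f v (measurable_itv _) _).1 => x; rewrite /Rplus /= in_itv/= andbT => /negP.
rewrite -ltNge => x0; apply: f0; rewrite opt_density_out//= in_itv/= => /andP[ax _].
by have := lt_trans a0 ax; rewrite ltNge ltW.
Qed.

Lemma opt_constrained : constrained_space rho r p.
Proof.
have p0 x := opt_density_ge0 gam0 rho0 a0 ab x.
have h1 := opt_Rplus (fun x px => px) (opt_mass_whole gam0 rho0 a0 ab eq1 eq2).
have [M hM] := opt_square gam0 rho0 a0 ab eq1 eq2.
split; first split.
- split; first exact: hasint_integrable h1.
  + have h := opt_Rplus (fun x px => etrans (congr1 (fun z => z * x) px) (mul0r x))
      (opt_mean_whole gam0 rho0 a0 ab eq1 eq2).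
    rewrite (_ : (\int[mu]_(x in (@Rplus R)) _)%E = \int[mu]_(x in (@Rplus R)) (p x * x)%:E)%E.
      by apply: eq_integral => x _; rewrite ger0_norm ?p0// mulrC.
    by rewrite (hasint_int h) ltry.
  + exists 1 => //.
    have e1 (x : R) : p x = 0 -> p x `^ (1 + 1) = 0 by move=> ->; rewrite powR0// gt_eqF.
    rewrite (_ : (\int[mu]_(x in (@Rplus R)) _)%E = \int[mu]_(x in (@Rplus R)) (p x `^ (1 + 1))%:E)%E.
      by apply: eq_integral => x _; rewrite ger0_norm ?p0.
    by rewrite (hasint_int (opt_Rplus e1 hM)) ltry.
- by apply: aeW => x _; exact: p0.
- exact: hasint_int h1.
apply: hasint_int; apply: opt_Rplus; first by move=> x ->; rewrite mul0r.
exact: opt_whole.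
Qed.

(** Let [W] be the Euler-Lagrange function and [u = hpart q]. The difference of the energies of [q]
    and [p] is the integral of [(u - p) W] minus [mutual u u - 2 * mutual u p + mutual p p]; the
    terms [k * r] cancel as both densities satisfy the constraint. The first part is nonnegative
    because [W] equals its constant on [[a, b]] and is at least that on [x > 0], and the form is
    nonpositive. Equality of energies forces the form to be 0, hence [u = p] almost everywhere. *)
Lemma opt_minimizes q : constrained_space rho r q ->
  (energy (gam + 1) p <= energy (gam + 1) q)%E /\
  ((energy (gam + 1) q <= energy (gam + 1) p)%E -> ae_eq mu (@Rplus R) q p).
Proof.
move=> Xq; have Xp := opt_constrained; have r0 := rho0.
have [mq [Cq lq]] := pdf_log_density Xq.1.
have [mp [Cp lp]] := pdf_log_density Xp.1.
have hq := hpart_constraint r0 Xq; have hp := hpart_constraint r0 Xp.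
have EE v m C (Xv : pdf_space v) (lv : log_density (hpart v) m C) : exists2 F,
    F = m - gam * pot (hpart v) 0 - mutual (hpart v) (hpart v) & energy (gam + 1) v = F%:E.
  by exists (m - gam * pot (hpart v) 0 - mutual (hpart v) (hpart v)); rewrite // (energyE _ Xv lv) (addrK 1 gam).
have [Fq FqE ->] := EE _ _ _ Xq.1 lq; have [Fp FpE ->] := EE _ _ _ Xp.1 lp.
rewrite !lee_fin; rewrite opt_hpart in lp hp FpE.
set u := hpart q in lq hq FqE *.
have u0 x : 0 <= u x by exact: hpart_ge0.
pose W x := x - gam * ln x - k * ln (1 + rho * x) - 2 * pot p x.
pose cst := euler_lagrange_cst gam rho k a b.
have [mu_ _ u1 umean _] := lq; have [mp_ p0 p1 pmean _] := lp.
have WE v m C : log_density v m C -> (forall x, x <= 0 -> v x = 0) ->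
    hasint setT (fun x => v x * ln (1 + rho * x)) r ->
    hasint setT (fun x => v x * W x) (m - gam * pot v 0 - k * r - 2 * mutual v p).
  move=> lv v0 hv; have [_ _ _ vm _] := lv; have [vl _] := log_density_pot lv 0.
  have h := hasintB measurableT (hasintB measurableT (hasintB measurableT vm (hasintZ gam measurableT vl))
    (hasintZ k measurableT hv)) (hasintZ 2 measurableT (mutual_hasint lv lp)).
  apply: hasint_eq h => // x _; rewrite /W sub0r normrN.
  have [x0|x0] := leP x 0; first by rewrite v0// !(mul0r, mulr0) !subr0.
  by rewrite gtr0_norm//; ring.
have Wu := WE _ _ _ lq (@hpart_out _ q) hq.
have Wp := WE _ _ _ lp _ hp.
have {}Wp : hasint setT (fun x => p x * W x) (mp - gam * pot p 0 - k * r - 2 * mutual p p).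
  by apply: Wp => x x0; rewrite -opt_hpart hpart_out.
have cu := hasintZ cst measurableT u1; have cp := hasintZ cst measurableT p1.
rewrite mulr1 in cu cp.
have Ep : mp - gam * pot p 0 - k * r - 2 * mutual p p = cst.
  apply: (hasint_unique Wp); apply: hasint_eq cp => // x _.
  have [/=|/opt_density_out->] := pselect (`]a, b[%classic x); last by rewrite mul0r mulr0.
  rewrite in_itv/= => /andP[ax xb]; rewrite mulrC /W euler_lagrange_eq//.
  by rewrite !ltW.
have Eu : cst <= mq - gam * pot u 0 - k * r - 2 * mutual u p.
  apply: (hasint_le measurableT cu Wu) => x _; have [x0|x0] := leP x 0.
    by rewrite /u hpart_out// mulr0 mul0r.
  by rewrite mulrC ler_wpM2l// /W euler_lagrange_ge.
have uu := mutual_le lq lp.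
have ue := mutual_eq lq lp.
move: Ep Eu uu ue FqE FpE; move: (mutual u u) (mutual u p) (mutual p p) (pot p 0) (pot u 0).
move=> Duu Dup Dpp P0 U0 Ep Eu uu ue FqE FpE.
split; first by clear -Ep Eu uu FqE FpE; lra.
move=> le; have {}ue : ae_eq mu setT u p by apply: ue; clear -Ep Eu le FqE FpE; lra.
have [_ q0 _] := Xq.1; move: (hpart_ae q0) ue.
apply: (@filterS2 _ _ (ae_filter_ringOfSetsType mu)) => x h1 h2 xp.
by rewrite h1// -/u h2.
Qed.

End minimization.

Theorem mainTheorem1 (R : realType) (beta rho : R) (beta_gt1 : 1 < beta)
    (rho_gt0 : 0 < rho) (r : R) (r_gt0 : 0 < r) :
  exists k a b : R,
    let S := Num.sqrt ((1 + rho * a) * (1 + rho * b)) in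
    let Delta := b - a in
    let p := opt_density beta rho a b in
    (0 < a /\ a < b) /\
    k * rho / S + (beta - 1) / Num.sqrt (a * b) = 1 /\
    (a + b - 2 * k - 2 * (beta - 1)) / 4 + k / (2 * S) = 1 /\
    (\int[@lebesgue_measure R]_(x in `[a, b]) (p x * ln (1 + rho * x))%:E
       = r%:E)%E /\
    unique_minimizer (energy beta) (constrained_space rho r) p /\
    min_energy beta rho r =
      (Delta ^+ 2 / 32 + a / 2 - ln Delta - (beta - 1) / 2 * ln (a * Delta)
       + k / 2 * (r - ln (1 + rho * a)
                  - (Num.sqrt (1 + rho * b) - Num.sqrt (1 + rho * a)) ^+ 2
                    / (4 * rho * S))
       - Delta * k * rho / (2 * S)
         * (G 0 ((1 + rho * a) / (Delta * rho))
            + (beta - 1) / 2 * G (a / Delta) ((1 + rho * a) / (Delta * rho)))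
       - Delta / 2 * (1 - k * rho / S)
         * (G 0 (a / Delta)
            + (beta - 1) / 2 * G (a / Delta) (a / Delta)))%:E.
Proof.
have gam0 : 0 < beta - 1 by rewrite subr_gt0.
have : beta = beta - 1 + 1 by rewrite subrK.
move: (beta - 1) gam0 => gam gam0 E; subst beta.
have [k [a [b [a0 ab eq1 eq2 hr]]]] := exists_solution gam0 rho_gt0 r_gt0.
exists k, a, b => S D p.
have Xp := opt_constrained gam0 rho_gt0 a0 ab eq1 eq2 hr.
have min q := opt_minimizes gam0 rho_gt0 a0 ab eq1 eq2 hr (q := q).
split; first by split.
split; first exact: eq1.
split; first exact: eq2.
split; first by apply: hasint_int; apply/hasint_oo; exact: hr.
split.
  split; first by split; [exact: Xp|move=> q Xq; exact: (min q Xq).1].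
  by move=> q [Xq qmin]; apply: (min q Xq).2; exact: qmin.
have -> : min_energy (gam + 1) rho r = energy (gam + 1) p.
  apply/le_anti/andP; split.
    by apply: ereal_inf_lbound; exists p.
  by apply: le_ereal_inf_tmp => _ [q Xq <-]; have [] := min q Xq.
have [m [C ld]] := pdf_log_density Xp.1.
rewrite (energyE _ Xp.1 ld) (opt_hpart gam0 rho_gt0 a0 ab) addrK.
have p_out x : x <= 0 -> p x = 0.
  by move=> x0; rewrite /p -(opt_hpart gam0 rho_gt0 a0 ab) hpart_out.
have -> : m = D ^+ 2 / 16 + k / (2 * rho) * (1 - (1 + rho * ((a + b) / 2)) / S).
  have [_ _ _ hm _] := ld; rewrite (opt_hpart gam0 rho_gt0 a0 ab) in hm.
  apply: (hasint_unique hm).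
  apply: hasint_eq (opt_mean_whole gam0 rho_gt0 a0 ab eq1 eq2) => // x _.
  by have [x0|x0] := leP x 0; [rewrite -/p p_out// mul0r mulr0|rewrite gtr0_norm// mulrC].
have -> : pot p 0 = ln D + D / 2 * ((1 - k * rho / S) * G (a / D) (a / D) +
    k * rho / S * G (a / D) ((1 + rho * a) / (D * rho))).
  have [hl _] := log_density_pot ld 0; rewrite (opt_hpart gam0 rho_gt0 a0 ab) in hl.
  apply: (hasint_unique hl).
  apply: hasint_eq (opt_ln gam0 rho_gt0 a0 ab eq1 eq2) => // x _; rewrite sub0r normrN.
  by have [x0|x0] := leP x 0; [rewrite -/p p_out// !mul0r|rewrite gtr0_norm].
have hrT := opt_whole (H := fun x => ln (1 + rho * x)) hr.
by rewrite (opt_energy gam0 rho_gt0 a0 ab eq1 eq2 hrT).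
Qed.
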